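(* Let $\operatorname{Re}(w)>0$. For $b>0$ let $E_{2,b}(z)=\sum_{k=0}^{\infty}\frac{z^k}{\Gamma(2k+b)}$ be the two-variable Mittag-Leffler function. Then \begin{align*} \left.\frac{\partial^2}{\partial b^2}E_{2, b}(w^2)\right|_{b=1}=\log^{2}(w)\cosh(w)+2\int_{0}^{\infty}\frac{u\cos(u)\log(u)}{u^2+w^2}\, du. \end{align*}
   Context: $\log$ denotes the principal branch of the logarithm; the integral is an improper (convergent) integral at $\infty$. *)

(* Defs.v *)
(* Stdlib real numbers with Coquelicot; complex numbers are Coquelicot's [C]. *)
From Stdlib Require Export Reals.
From Coquelicot Require Export Coquelicot.
Open Scope R_scope.

(* Euler's integral, convergent exactly for x > 0.  Only positive arguments
   matter below; for x <= 0 the value is unspecified and is not the analytic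
   continuation. *)
Definition Gamma (x : R) : R :=
  RInt_gen (fun t : R => Rpower t (x - 1) * exp (- t))
           (at_right 0) (Rbar_locally p_infty).

(* Coquelicot's [Series] is real-valued only. *)
Definition CSeries (a : nat -> C) : C :=
  (Series (fun k => Re (a k)), Series (fun k => Im (a k))).

Lemma CSeries_unique (a : nat -> C) (l : C) :
  is_series (V := C_R_NormedModule) a l -> CSeries a = l.
Proof.
intros H.
assert (Hs : forall n,
  sum_n (G := C_R_NormedModule) a n
  = (sum_n (fun k => Re (a k)) n, sum_n (fun k => Im (a k)) n)).
{ induction n as [|n IH].
  - rewrite !sum_O; destruct (a 0%nat); reflexivity.
  - rewrite !sum_Sn, IH; destruct (a (S n)); reflexivity. }
unfold CSeries; rewrite (surjective_pairing l); f_equal;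
  apply is_series_unique; intros P [e He].
- destruct (H (fun z : C => P (fst z))) as [N HN].
  { exists e; intros y [Hy _]; exact (He _ Hy). }
  exists N; intros n Hn; generalize (HN n Hn); rewrite Hs; trivial.
- destruct (H (fun z : C => P (snd z))) as [N HN].
  { exists e; intros y [_ Hy]; exact (He _ Hy). }
  exists N; intros n Hn; generalize (HN n Hn); rewrite Hs; trivial.
Qed.

Definition MittagLeffler2 (b : R) (z : C) : C :=
  CSeries (fun k : nat => (z ^ k / RtoC (Gamma (2 * INR k + b)))%C).

Definition Cexp (z : C) : C :=
  (exp (Re z) * cos (Im z), exp (Re z) * sin (Im z)).

Definition Ccosh (z : C) : C := ((Cexp z + Cexp (- z)) / RtoC 2)%C.

(* Principal argument, with values in (-PI, PI] for z <> 0. *)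
Definition Carg (z : C) : R :=
  if Rle_dec 0 (Im z) then acos (Re z / Cmod z) else - acos (Re z / Cmod z).

Definition Clog (z : C) : C := (ln (Cmod z), Carg z).

(* [is_derive_n] is restricted to real-valued functions. *)
Definition is_derive2 {V : NormedModule R_AbsRing} (f : R -> V) (x : R) (l : V)
    : Prop :=
  exists f' : R -> V,
    locally x (fun y => is_derive f y (f' y)) /\ is_derive f' x l.

(* At u = 0 Stdlib's [ln 0 = 0] makes the value 0, which is also the limit of
   the integrand as u tends to 0 from the right (for w <> 0). *)
Definition integrand (w : C) (u : R) : C :=
  (RtoC (u * cos u * ln u) / (RtoC u ^ 2 + w ^ 2))%C.

(* Main.v *)
(* The function [E_{2,b}(w^2)] equals [(1 + w int_0^1 s^(b-1) sinh(w(1-s)) ds) / Gamma b], so its second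
   [b]-derivative at [1] is a combination of [int_0^1 (log s)^j sinh(w(1-s)) ds], [Gamma'(1)] and [Gamma''(1)].
   For [Re p > 0], [p int_0^oo (log s)^j e^(-ps) ds] is an explicit polynomial in [log p], whose coefficients involve
   the same Gamma constants; subtracting [cosh w] times the case [p = w] produces [log^2 w cosh w] and
   leaves [int_0^oo (log^2 s - 2 Gamma'(1) log s) N(s) ds], up to sign, where [N] solves
   [w^2 N - N'' = w^2 delta_1] on [(0,oo)].
   To recognize twice the cosine integral there, damp it by [e^(-eu)] and let the frequency [t] vary: [J(t)], with
   [u cos(tu)], and its antiderivative [K(t)], with [sin(tu)], satisfy [J' - w^2 K = H'], where [H] is an explicit
   function of [log(e +- it)].  Pairing with [N] gives [J(1) = H(1) - int N H], and then [e] tends to [0]. *)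

Require Import Defs.
From Stdlib Require Import Lra Lia Psatz FunctionalExtensionality.
Open Scope R_scope.

(** * Dominated improper integrals *)

(* Integrable with explicit primitive [2 atan (sqrt s)]; up to constants it dominates every improper
   integrand below, singular at [0] at most like a power of [ln s]. *)
Definition dominator (s : R) : R := / (sqrt s * (1 + s)).

Lemma dom_pos s : 0 < s -> 0 < dominator s.
Proof.
intros Hs; unfold dominator; apply Rinv_0_lt_compat, Rmult_lt_0_compat; [apply sqrt_lt_R0|]; lra.
Qed.

Lemma is_derive_dom s : 0 < s -> is_derive (fun x => 2 * atan (sqrt x)) s (dominator s).
Proof.
intros Hs.
assert (H0 : 0 < sqrt s) by (apply sqrt_lt_R0; lra).
assert (H1 := sqrt_sqrt s (Rlt_le _ _ Hs)).
unfold dominator; auto_derive; [lra|].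
replace (sqrt s * (sqrt s * 1)) with s by lra.
field; split; nra.
Qed.

Lemma continuous_dom s : 0 < s -> continuous dominator s.
Proof.
intros Hs; apply (ex_derive_continuous dominator); unfold dominator; auto_derive.
assert (H0 : 0 < sqrt s) by (apply sqrt_lt_R0; lra).
split; [lra|]; split; [|trivial]; nra.
Qed.

Lemma filterlim_atan_p : filterlim atan (Rbar_locally p_infty) (locally (PI / 2)).
Proof.
apply filterlim_locally; intros eps.
destruct (Rlt_dec eps PI) as [He|He].
- exists (tan (PI / 2 - eps)); intros x Hx.
  change (Rabs (atan x - PI / 2) < eps).
  assert (Hb := atan_bound x); destruct eps as [e He0]; simpl in *.
  assert (PI / 2 - e < atan x).
  { rewrite <- (atan_tan (PI / 2 - e)) by lra. now apply atan_increasing. }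
  rewrite Rabs_left; lra.
- exists 0; intros x Hx; change (Rabs (atan x - PI / 2) < eps).
  assert (Hb := atan_bound x); rewrite Rabs_left; try lra.
Qed.

Lemma filterlim_sqrt_p : filterlim sqrt (Rbar_locally p_infty) (Rbar_locally p_infty).
Proof.
intros P [M HM]; exists (Rmax M 0 * Rmax M 0); intros x Hx; apply HM.
assert (H := Rmax_l M 0); assert (H' := Rmax_r M 0).
apply Rle_lt_trans with (Rmax M 0); trivial.
rewrite <- (sqrt_square (Rmax M 0)) by trivial. apply sqrt_lt_1; nra.
Qed.

Lemma filterlim_at_right_continuous {V : UniformSpace} (f : R -> V) x :
  continuous f x -> filterlim f (at_right x) (locally (f x)).
Proof. intros H; eapply filterlim_filter_le_1; [|exact H]. apply filter_le_within. Qed.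

Lemma domprim_0 : filterlim (fun x => 2 * atan (sqrt x)) (at_right 0) (locally 0).
Proof.
replace 0 with (2 * atan (sqrt 0)) at 2 by (rewrite sqrt_0, atan_0; ring).
apply (filterlim_at_right_continuous (fun x => 2 * atan (sqrt x))).
apply (continuous_mult (fun _ => 2)); [apply continuous_const|].
apply (continuous_comp sqrt atan).
- apply continuous_sqrt.
- apply continuous_atan.
Qed.

Lemma domprim_p :
  filterlim (fun x => 2 * atan (sqrt x)) (Rbar_locally p_infty) (locally PI).
Proof.
replace PI with (2 * (PI / 2)) by field.
apply (filterlim_comp _ _ _ (fun x => atan (sqrt x)) (fun y => 2 * y) _ (locally (PI / 2))).
- eapply filterlim_comp; [apply filterlim_sqrt_p|apply filterlim_atan_p].
- apply (continuous_mult (fun _ => 2) (fun y => y)); [apply continuous_const|apply continuous_id].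
Qed.

Lemma is_RInt_gen_antideriv {V : CompleteNormedModule R_AbsRing}
    (Fa Fb : (R -> Prop) -> Prop) {HFa : Filter Fa} {HFb : Filter Fb}
    (f F : R -> V) (a b : V) :
  filter_prod Fa Fb (fun ab => forall x, Rmin (fst ab) (snd ab) <= x <= Rmax (fst ab) (snd ab)
     -> is_derive F x (f x) /\ continuous f x) ->
  filterlim F Fa (locally a) -> filterlim F Fb (locally b) ->
  is_RInt_gen f Fa Fb (minus b a).
Proof.
intros HD Ha Hb P HP.
assert (Hl : filterlim (fun ab : R * R => minus (F (snd ab)) (F (fst ab))) (filter_prod Fa Fb)
               (locally (minus b a))).
{ apply (filterlim_comp_2 (G := locally b) (H := locally (opp a)) (fun ab => F (snd ab)) (fun ab => opp (F (fst ab))) plus);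
    [| |apply (filterlim_plus (V := V))].
  - eapply filterlim_comp; [apply filterlim_snd|exact Hb].
  - apply (filterlim_comp _ _ _ (fun ab : R * R => F (fst ab)) opp _ (locally a));
      [|apply (filterlim_opp (V := V))].
    eapply filterlim_comp; [apply filterlim_fst|exact Ha]. }
specialize (Hl P HP); unfold filtermap in Hl; unfold filtermapi.
generalize (filter_and _ _ HD Hl); apply filter_imp; intros [x y] [H1 H2]; simpl in *.
eexists; split; [|exact H2].
apply (is_RInt_derive F f); intros z Hz; apply H1; trivial.
Qed.

Lemma pos_interval : filter_prod (at_right 0) (Rbar_locally p_infty)
  (fun ab : R * R => 0 < fst ab /\ fst ab <= snd ab).
Proof.
exists (fun x => 0 < x < 1) (fun x => 1 < x).
- exists (mkposreal 1 Rlt_0_1); intros y Hy H0.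
  change (Rabs (y - 0) < 1) in Hy; rewrite Rabs_right in Hy; lra.
- now exists 1.
- intros x y Hx Hy; simpl; lra.
Qed.

Lemma is_RInt_gen_pos_antideriv {V : CompleteNormedModule R_AbsRing} (f F : R -> V) (a b : V) :
  (forall s, 0 < s -> is_derive F s (f s)) -> (forall s, 0 < s -> continuous f s) ->
  filterlim F (at_right 0) (locally a) -> filterlim F (Rbar_locally p_infty) (locally b) ->
  is_RInt_gen f (at_right 0) (Rbar_locally p_infty) (minus b a).
Proof.
intros HD HC; apply is_RInt_gen_antideriv; try apply _.
generalize pos_interval; apply filter_imp; intros [x y] [H1 H2] z; simpl in *.
rewrite Rmin_left by trivial; intros [Hz _]; split; [apply HD|apply HC]; lra.
Qed.

Lemma is_RInt_gen_dom : is_RInt_gen dominator (at_right 0) (Rbar_locally p_infty) PI.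
Proof.
replace PI with (minus PI 0 : R) by (unfold minus, plus, opp; simpl; ring).
apply (is_RInt_gen_pos_antideriv (V := R_CompleteNormedModule) dominator (fun x => 2 * atan (sqrt x))).
- apply is_derive_dom.
- apply continuous_dom.
- apply domprim_0.
- apply domprim_p.
Qed.

Lemma norm_RInt_dom {V : CompleteNormedModule R_AbsRing} (f : R -> V) (C : R) x y :
  (forall s, 0 < s -> continuous f s) -> (forall s, 0 < s -> norm (f s) <= C * dominator s) ->
  0 < x -> 0 < y ->
  norm (RInt f x y) <= C * Rabs (2 * atan (sqrt y) - 2 * atan (sqrt x)).
Proof.
intros Hc Hb.
assert (Hi : forall x y, 0 < x -> 0 < y -> ex_RInt f x y).
{ intros a b Ha Hb'; apply ex_RInt_continuous; intros z [Hz _]; apply Hc.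
  generalize (Rmin_glb_lt _ _ _ Ha Hb'); lra. }
assert (Hle : forall x y, 0 < x -> x <= y ->
  norm (RInt f x y) <= C * (2 * atan (sqrt y) - 2 * atan (sqrt x))).
{ intros a b Ha Hab.
  apply (norm_RInt_le f (fun s => C * dominator s) a b); trivial.
  - intros z Hz; apply Hb; lra.
  - apply (RInt_correct (V := V)), Hi; lra.
  - apply (is_RInt_scal (V := R_NormedModule) dominator a b C).
    apply (is_RInt_derive (V := R_CompleteNormedModule) (fun x => 2 * atan (sqrt x)) dominator).
    + intros z [Hz _]; apply is_derive_dom; revert Hz; rewrite Rmin_left; lra.
    + intros z [Hz _]; apply continuous_dom; revert Hz; rewrite Rmin_left; lra. }
assert (Hmon : forall x y, 0 < x -> x <= y -> 2 * atan (sqrt x) <= 2 * atan (sqrt y)).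
{ intros a b Ha [Hab| ->]; [|lra].
  assert (sqrt a < sqrt b) by (apply sqrt_lt_1; lra).
  generalize (atan_increasing _ _ H); lra. }
intros Hx Hy; destruct (Rle_dec x y) as [H|H].
- rewrite Rabs_right by (generalize (Hmon _ _ Hx H); lra); now apply Hle.
- rewrite <- opp_RInt_swap by (apply Hi; trivial).
  eapply Rle_trans; [apply Req_le, (norm_opp (RInt f y x))|].
  rewrite Rabs_minus_sym, Rabs_right by (assert (Hyx : y <= x) by lra; generalize (Hmon _ _ Hy Hyx); lra).
  apply Hle; lra.
Qed.

Lemma minus_plus_l {G : AbelianGroup} (a b : G) : minus (plus a b) a = b.
Proof.
unfold minus; rewrite (plus_comm a b), <- plus_assoc.
transitivity (plus b zero); [f_equal; apply plus_opp_r|apply plus_zero_r].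
Qed.

Lemma ex_RInt_gen_dom {V : CompleteNormedModule R_AbsRing} (f : R -> V) (C : R) :
  (forall s, 0 < s -> continuous f s) -> (forall s, 0 < s -> norm (f s) <= C * dominator s) ->
  ex_RInt_gen f (at_right 0) (Rbar_locally p_infty).
Proof.
intros Hc Hb.
assert (Hi : forall x y, 0 < x -> 0 < y -> ex_RInt f x y).
{ intros a b Ha Hb'; apply ex_RInt_continuous; intros z [Hz _]; apply Hc.
  generalize (Rmin_glb_lt _ _ _ Ha Hb'); lra. }
assert (HC : 0 <= C).
{ generalize (Hb 1 Rlt_0_1) (dom_pos 1 Rlt_0_1) (norm_ge_0 (f 1)); nra. }
set (F := fun x => RInt f 1 x).
assert (Hlim : forall (G : (R -> Prop) -> Prop) l, ProperFilter G -> G (fun x => 0 < x) ->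
  filterlim (fun x => 2 * atan (sqrt x)) G (locally l) -> exists y, filterlim F G (locally y)).
{ intros G l PG Gp Hl; apply filterlim_locally_cauchy; intros eps.
  assert (He : 0 < eps / (2 * (C + 1))).
  { apply Rdiv_lt_0_compat; [apply cond_pos|lra]. }
  exists (fun x => 0 < x /\ ball l (mkposreal _ He) (2 * atan (sqrt x))); split.
  { apply filter_and; trivial; apply Hl; now exists (mkposreal _ He). }
  intros u v [Hu Hu'] [Hv Hv'].
  apply (norm_compat1 (V := V) (F u) (F v) eps).
  apply Rle_lt_trans with (norm (RInt f u v)).
  { apply Req_le, (f_equal (norm (V := V))).
      unfold F; rewrite <- (RInt_Chasles f 1 u v) by (apply Hi; lra).
      apply (minus_plus_l (G := V)). }
  eapply Rle_lt_trans; [apply (norm_RInt_dom f C u v Hc Hb Hu Hv)|].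
  change (Rabs (2 * atan (sqrt u) - l) < eps / (2 * (C + 1))) in Hu'.
  change (Rabs (2 * atan (sqrt v) - l) < eps / (2 * (C + 1))) in Hv'.
  replace (2 * atan (sqrt v) - 2 * atan (sqrt u)) with
    ((2 * atan (sqrt v) - l) - (2 * atan (sqrt u) - l)) by ring.
  generalize (Rabs_triang (2 * atan (sqrt v) - l) (- (2 * atan (sqrt u) - l))).
  rewrite Rabs_Ropp; fold ((2 * atan (sqrt v) - l) - (2 * atan (sqrt u) - l)); intros Ht.
  set (q := eps / (2 * (C + 1))) in *.
  assert (Hq : eps = 2 * (C + 1) * q :> R) by (unfold q; field; lra).
  rewrite Hq.
  apply Rle_lt_trans with (C * (2 * q)); [|nra].
  apply Rmult_le_compat_l; trivial; unfold Rminus in *; lra. }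
destruct (Hlim (at_right 0) 0) as [a Ha]; [apply _| |apply domprim_0|].
{ now exists (mkposreal 1 Rlt_0_1). }
destruct (Hlim (Rbar_locally p_infty) PI) as [b Hb']; [apply _| |apply domprim_p|].
{ now exists 0. }
exists (minus b a); apply (is_RInt_gen_pos_antideriv f F); trivial.
intros s Hs; apply (is_derive_RInt f F 1 s); [|now apply Hc].
exists (mkposreal s Hs); intros y Hy; change (Rabs (y - s) < s) in Hy.
apply Rabs_def2 in Hy.
apply (RInt_correct f), Hi; lra.
Qed.

(** * Derivatives of complex-valued functions *)

Notation Ccont f x := (continuous (T := R_UniformSpace) (U := C_R_NormedModule) f x).
Notation Cder f x l := (is_derive (K := R_AbsRing) (V := C_R_NormedModule) f x l).

Lemma Cder_pair (f : R -> C) x (l : C) :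
  Cder f x l <-> is_derive (fun t => Re (f t)) x (Re l) /\ is_derive (fun t => Im (f t)) x (Im l).
Proof.
split.
- intros H; split.
  + apply (filterdiff_ext_lin _ (fun y : R => Re (scal (V := C_R_NormedModule) y l)));
      [|intros y; reflexivity].
    apply (filterdiff_comp' (V := C_R_NormedModule) f Re x _ (fun z => fst z) H).
    apply filterdiff_linear, is_linear_fst.
  + apply (filterdiff_ext_lin _ (fun y : R => Im (scal (V := C_R_NormedModule) y l)));
      [|intros y; reflexivity].
    apply (filterdiff_comp' (V := C_R_NormedModule) f Im x _ (fun z => snd z) H).
    apply filterdiff_linear, is_linear_snd.
- intros [[_ H1] [_ H2]]; split; [apply is_linear_scal_l|].
  intros y Hy eps.
  assert (He : 0 < eps / 2) by (apply is_pos_div_2).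
  generalize (filter_and _ _ (H1 y Hy (mkposreal _ He)) (H2 y Hy (mkposreal _ He))).
  apply filter_imp; intros t [A1 A2].
  change (sqrt (Rabs (Re (f t) - Re (f y) - (t - y) * Re l) ^ 2
    + Rabs (Im (f t) - Im (f y) - (t - y) * Im l) ^ 2) <= eps * Rabs (t - y)).
  change (Rabs (Re (f t) - Re (f y) - (t - y) * Re l) <= eps / 2 * Rabs (t - y)) in A1.
  change (Rabs (Im (f t) - Im (f y) - (t - y) * Im l) <= eps / 2 * Rabs (t - y)) in A2.
  assert (P1 := Rabs_pos (Re (f t) - Re (f y) - (t - y) * Re l)).
  assert (P2 := Rabs_pos (Im (f t) - Im (f y) - (t - y) * Im l)).
  set (u := Rabs (Re (f t) - Re (f y) - (t - y) * Re l)) in *.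
  set (v := Rabs (Im (f t) - Im (f y) - (t - y) * Im l)) in *.
  apply Rle_trans with (sqrt ((u + v) ^ 2)); [apply sqrt_le_1; nra|].
  rewrite sqrt_pow2 by lra; lra.
Qed.

Lemma Ccont_pair (f : R -> C) x :
  Ccont f x <-> continuous (fun t => Re (f t)) x /\ continuous (fun t => Im (f t)) x.
Proof.
split.
- intros H; split; apply (continuous_comp (V := C_R_NormedModule) f); trivial;
    [apply continuous_fst|apply continuous_snd].
- intros [H1 H2].
  apply (continuous_ext (fun t => (Re (f t), Im (f t)))).
  { intros t; destruct (f t); reflexivity. }
  intros P [e He].
  assert (A1 : locally x (fun t => ball (Re (f x)) e (Re (f t)))) by exact (H1 _ (locally_ball _ e)).
  assert (A2 : locally x (fun t => ball (Im (f x)) e (Im (f t)))) by exact (H2 _ (locally_ball _ e)).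
  refine (filter_imp (F := locally x) _ (fun t => P (Re (f t), Im (f t))) _ (filter_and _ _ A1 A2)).
  intros t Ht; apply He; exact Ht.
Qed.

Lemma Cder_Ccont f x (l : C) : Cder f x l -> Ccont f x.
Proof. intros H; apply (ex_derive_continuous (V := C_R_NormedModule) f); now exists l. Qed.

Lemma Cder_eq (f : R -> C) x (l l' : C) : Cder f x l -> l = l' -> Cder f x l'.
Proof. now intros H <-. Qed.

Lemma Cder_ext (f g : R -> C) x (l : C) : (forall t, f t = g t) -> Cder f x l -> Cder g x l.
Proof. intros H; apply (is_derive_ext (V := C_R_NormedModule)); exact H. Qed.

Lemma Cder_const (c : C) x : Cder (fun _ => c) x (RtoC 0).
Proof. apply (is_derive_const (V := C_R_NormedModule) c x). Qed.

Lemma Cder_RtoC (f : R -> R) x (l : R) : is_derive f x l -> Cder (fun t => RtoC (f t)) x (RtoC l).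
Proof. intros H; apply Cder_pair; split; simpl; [exact H|apply (is_derive_const (0 : R))]. Qed.

Lemma Cder_plus (f g : R -> C) x (l m : C) :
  Cder f x l -> Cder g x m -> Cder (fun t => Cplus (f t) (g t)) x (Cplus l m).
Proof. apply (is_derive_plus (V := C_R_NormedModule)). Qed.

Lemma Cder_opp (f : R -> C) x (l : C) : Cder f x l -> Cder (fun t => Copp (f t)) x (Copp l).
Proof. apply (is_derive_opp (V := C_R_NormedModule)). Qed.

Lemma Cder_minus (f g : R -> C) x (l m : C) :
  Cder f x l -> Cder g x m -> Cder (fun t => Cminus (f t) (g t)) x (Cminus l m).
Proof. apply (is_derive_minus (V := C_R_NormedModule)). Qed.

Lemma Cder_mult (f g : R -> C) x (l m : C) :
  Cder f x l -> Cder g x m ->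
  Cder (fun t => Cmult (f t) (g t)) x (Cplus (Cmult l (g x)) (Cmult (f x) m)).
Proof.
rewrite !Cder_pair; intros [F1 F2] [G1 G2]; split.
- apply (is_derive_ext (fun t => Re (f t) * Re (g t) - Im (f t) * Im (g t))); [reflexivity|].
  replace (Re _) with ((Re l * Re (g x) + Re (f x) * Re m) - (Im l * Im (g x) + Im (f x) * Im m))
    by (unfold Re, Im; simpl; ring).
  apply (is_derive_minus (V := R_NormedModule)); apply (is_derive_mult (K := R_AbsRing)); trivial;
    intros; apply Rmult_comm.
- apply (is_derive_ext (fun t => Re (f t) * Im (g t) + Im (f t) * Re (g t))); [reflexivity|].
  replace (Im _) with ((Re l * Im (g x) + Re (f x) * Im m) + (Im l * Re (g x) + Im (f x) * Re m))
    by (unfold Re, Im; simpl; ring).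
  apply (is_derive_plus (V := R_NormedModule)); apply (is_derive_mult (K := R_AbsRing)); trivial;
    intros; apply Rmult_comm.
Qed.

Lemma Cder_scal (c : C) (f : R -> C) x (l : C) : Cder f x l -> Cder (fun t => Cmult c (f t)) x (Cmult c l).
Proof.
intros H; eapply Cder_eq; [apply Cder_mult; [apply Cder_const|exact H]|]; cbv beta; ring.
Qed.

Lemma Cder_inv (f : R -> C) x (l : C) : f x <> RtoC 0 -> Cder f x l ->
  Cder (fun t => Cinv (f t)) x (Copp (Cdiv l (Cmult (f x) (f x)))).
Proof.
rewrite !Cder_pair; intros Hx [F1 F2].
assert (Hn : Re (f x) ^ 2 + Im (f x) ^ 2 <> 0).
{ intros H; apply Hx, Cmod_eq_0; rewrite <- (sqrt_pow2 (Cmod _)) by apply Cmod_ge_0.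
  rewrite Cmod2_alt, H; apply sqrt_0. }
set (u := fun t => Re (f t)) in *; set (v := fun t => Im (f t)) in *.
change (u x ^ 2 + v x ^ 2 <> 0) in Hn.
assert (E1 : Derive (fun t => u t) x = Re l) by exact (is_derive_unique _ _ _ F1).
assert (E2 : Derive (fun t => v t) x = Im l) by exact (is_derive_unique _ _ _ F2).
assert (D1 : ex_derive u x) by (eexists; eauto).
assert (D2 : ex_derive v x) by (eexists; eauto).
assert (Ef : f x = (u x, v x)) by apply surjective_pairing.
split.
- apply (is_derive_ext (fun t => u t / (u t ^ 2 + v t ^ 2))); [reflexivity|].
  auto_derive; [tauto|]. rewrite E1, E2, Ef; clear - Hn.
  generalize dependent (u x); generalize dependent (v x); intros a b Hn.
  destruct l as [c d]; unfold Re, Im in *; simpl in *; field.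
  split; [|nra]. intros H; apply Hn; nra.
- apply (is_derive_ext (fun t => - v t / (u t ^ 2 + v t ^ 2))); [reflexivity|].
  auto_derive; [tauto|]. rewrite E1, E2, Ef; clear - Hn.
  generalize dependent (u x); generalize dependent (v x); intros a b Hn.
  destruct l as [c d]; unfold Re, Im in *; simpl in *; field.
  split; [|nra]. intros H; apply Hn; nra.
Qed.

Lemma Cder_Cexp (f : R -> C) x (l : C) : Cder f x l ->
  Cder (fun t => Cexp (f t)) x (Cmult l (Cexp (f x))).
Proof.
rewrite !Cder_pair; intros [F1 F2].
set (u := fun t => Re (f t)) in *; set (v := fun t => Im (f t)) in *.
assert (E1 : Derive (fun t => u t) x = Re l) by exact (is_derive_unique _ _ _ F1).
assert (E2 : Derive (fun t => v t) x = Im l) by exact (is_derive_unique _ _ _ F2).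
assert (D1 : ex_derive u x) by (eexists; eauto).
assert (D2 : ex_derive v x) by (eexists; eauto).
assert (Ef : f x = (u x, v x)) by apply surjective_pairing.
split.
- apply (is_derive_ext (fun t => exp (u t) * cos (v t))); [reflexivity|].
  auto_derive; [tauto|]. rewrite E1, E2, Ef; unfold Cexp, Re, Im; simpl; ring.
- apply (is_derive_ext (fun t => exp (u t) * sin (v t))); [reflexivity|].
  auto_derive; [tauto|]. rewrite E1, E2, Ef; unfold Cexp, Re, Im; simpl; ring.
Qed.

Lemma Ccont_ext (f g : R -> C) x : (forall t, f t = g t) -> Ccont f x -> Ccont g x.
Proof. apply (continuous_ext (U := C_R_NormedModule)). Qed.

Lemma Ccont_const (c : C) x : Ccont (fun _ => c) x.
Proof. apply (continuous_const (U := R_UniformSpace) (V := C_R_NormedModule)). Qed.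

Lemma Ccont_RtoC (f : R -> R) x : continuous f x -> Ccont (fun t => RtoC (f t)) x.
Proof. intros H; apply Ccont_pair; split; simpl; [exact H|apply continuous_const]. Qed.

Lemma Ccont_plus (f g : R -> C) x : Ccont f x -> Ccont g x -> Ccont (fun t => Cplus (f t) (g t)) x.
Proof. apply (continuous_plus (V := C_R_NormedModule)). Qed.

Lemma Ccont_minus (f g : R -> C) x : Ccont f x -> Ccont g x -> Ccont (fun t => Cminus (f t) (g t)) x.
Proof. apply (continuous_minus (V := C_R_NormedModule)). Qed.

Lemma Ccont_opp (f : R -> C) x : Ccont f x -> Ccont (fun t => Copp (f t)) x.
Proof. apply (continuous_opp (V := C_R_NormedModule)). Qed.

Lemma Ccont_mult (f g : R -> C) x : Ccont f x -> Ccont g x -> Ccont (fun t => Cmult (f t) (g t)) x.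
Proof.
rewrite !Ccont_pair; intros [F1 F2] [G1 G2]; split.
- apply (continuous_minus (V := R_NormedModule) (fun t => Re (f t) * Re (g t)) (fun t => Im (f t) * Im (g t)));
    apply (continuous_mult (K := R_AbsRing)); trivial.
- apply (continuous_plus (V := R_NormedModule) (fun t => Re (f t) * Im (g t)) (fun t => Im (f t) * Re (g t)));
    apply (continuous_mult (K := R_AbsRing)); trivial.
Qed.

Lemma Ccont_Cexp (f : R -> C) x : Ccont f x -> Ccont (fun t => Cexp (f t)) x.
Proof.
rewrite !Ccont_pair; intros [F1 F2]; split; apply (continuous_mult (K := R_AbsRing)).
- apply (continuous_comp _ exp); trivial; apply (ex_derive_continuous exp); auto_derive; trivial.
- apply (continuous_comp _ cos); trivial; apply continuous_cos.
- apply (continuous_comp _ exp); trivial; apply (ex_derive_continuous exp); auto_derive; trivial.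
- apply (continuous_comp _ sin); trivial; apply continuous_sin.
Qed.

Lemma Cexp_plus (a b : C) : Cexp (a + b) = (Cexp a * Cexp b)%C.
Proof.
destruct a as [a1 a2]; destruct b as [b1 b2]; unfold Cexp, Cplus, Cmult, Re, Im; simpl.
rewrite exp_plus, cos_plus, sin_plus; f_equal; ring.
Qed.

Lemma Cexp_0 : Cexp (RtoC 0) = RtoC 1.
Proof. unfold Cexp, RtoC, Re, Im; simpl; rewrite exp_0, cos_0, sin_0; f_equal; ring. Qed.

Lemma Cmod_Cexp (z : C) : Cmod (Cexp z) = exp (Re z).
Proof.
unfold Cexp, Cmod; simpl fst; simpl snd.
replace ((exp (Re z) * cos (Im z)) ^ 2 + (exp (Re z) * sin (Im z)) ^ 2) with (exp (Re z) ^ 2).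
- apply sqrt_pow2, Rlt_le, exp_pos.
- generalize (sin2_cos2 (Im z)); unfold Rsqr; intros H; simpl; nra.
Qed.

Lemma Cexp_RtoC (x : R) : Cexp (RtoC x) = RtoC (exp x).
Proof. unfold Cexp, RtoC, Re, Im; simpl; rewrite cos_0, sin_0; f_equal; ring. Qed.

Lemma Cmod_mult_RtoC (t : R) (z : C) : Cmod (RtoC t * z) = Rabs t * Cmod z.
Proof. now rewrite Cmod_mult, Cmod_R. Qed.

Lemma Re_RtoC_mult (t : R) (z : C) : Re (RtoC t * z) = t * Re z.
Proof. destruct z; unfold Re; simpl; ring. Qed.

Lemma exp_le x y : x <= y -> exp x <= exp y.
Proof. intros [H| ->]; [left; now apply exp_increasing|right; trivial]. Qed.

Lemma Re_le_Cmod z : Re z <= Cmod z.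
Proof. eapply Rle_trans; [apply Rle_abs|apply re_le_Cmod]. Qed.

Lemma Cder_line (p d : C) t : Cder (fun t => p + RtoC t * d)%C t d.
Proof.
eapply Cder_eq; [apply Cder_plus; [apply Cder_const|apply Cder_mult; [apply Cder_RtoC|apply Cder_const]]|].
- apply (is_derive_id (K := R_AbsRing)).
- simpl; change (@one R_AbsRing) with 1; ring.
Qed.

Lemma Cder_lin (d : C) t : Cder (fun t => RtoC t * d)%C t d.
Proof. apply (Cder_ext (fun t => 0 + RtoC t * d)%C); [intros; ring|apply Cder_line]. Qed.

Lemma norm_Cmod (z : C) : norm (V := C_R_NormedModule) z = Cmod z.
Proof. symmetry; apply Cmod_norm. Qed.

Lemma Cmod_Cexp_sub1 z : Cmod (Cexp z - 1) <= Cmod z * exp (Cmod z).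
Proof.
assert (HI := is_RInt_derive (V := C_R_CompleteNormedModule) (fun t => Cexp (RtoC t * z))
  (fun t => z * Cexp (RtoC t * z))%C 0 1).
assert (HI' : is_RInt (V := C_R_NormedModule) (fun t => z * Cexp (RtoC t * z))%C 0 1 (Cexp z - 1)%C).
{ replace (Cexp z - 1)%C with (minus (G := C_R_NormedModule) (Cexp (RtoC 1 * z)) (Cexp (RtoC 0 * z))).
  - apply HI.
    + intros x _; apply (Cder_Cexp (fun t => RtoC t * z)%C), Cder_lin.
    + intros x _; apply Ccont_mult; [apply Ccont_const|]; apply Ccont_Cexp.
      eapply Cder_Ccont, Cder_lin.
  - rewrite Cmult_1_l, Cmult_0_l, Cexp_0; reflexivity. }
assert (Hb : forall x, 0 <= x <= 1 ->
  norm (V := C_R_NormedModule) (z * Cexp (RtoC x * z))%C <= Cmod z * exp (Cmod z)).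
{ intros x Hx; rewrite norm_Cmod, Cmod_mult, Cmod_Cexp, Re_RtoC_mult.
  apply Rmult_le_compat_l; [apply Cmod_ge_0|apply exp_le].
  generalize (Re_le_Cmod z) (Cmod_ge_0 z); nra. }
assert (Hn := norm_RInt_le_const _ 0 1 _ _ Rle_0_1 Hb HI').
rewrite Rminus_0_r, Rmult_1_l, norm_Cmod in Hn; exact Hn.
Qed.

Lemma Cmod_Cexp_sub2 z : Cmod (Cexp z - 1 - z) <= Cmod z ^ 2 * exp (Cmod z).
Proof.
assert (HI := is_RInt_derive (V := C_R_CompleteNormedModule) (fun t => Cexp (RtoC t * z) - RtoC t * z)%C
  (fun t => z * Cexp (RtoC t * z) - z)%C 0 1).
assert (HI' : is_RInt (V := C_R_NormedModule) (fun t => z * Cexp (RtoC t * z) - z)%C 0 1 (Cexp z - 1 - z)%C).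
{ replace (Cexp z - 1 - z)%C with (minus (G := C_R_NormedModule)
     (Cexp (RtoC 1 * z) - RtoC 1 * z)%C (Cexp (RtoC 0 * z) - RtoC 0 * z)%C).
  - apply HI.
    + intros x _; apply Cder_minus; [apply (Cder_Cexp (fun t => RtoC t * z)%C), Cder_lin|apply Cder_lin].
    + intros x _; apply Ccont_minus; [apply Ccont_mult; [apply Ccont_const|]; apply Ccont_Cexp|apply Ccont_const].
      eapply Cder_Ccont, Cder_lin.
  - rewrite !Cmult_1_l, !Cmult_0_l, Cexp_0.
    change (Cexp z - z - (1 - 0) = Cexp z - 1 - z)%C; ring. }
assert (Hb : forall x, 0 <= x <= 1 ->
  norm (V := C_R_NormedModule) (z * Cexp (RtoC x * z) - z)%C <= Cmod z ^ 2 * exp (Cmod z)).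
{ intros x Hx; rewrite norm_Cmod.
  replace (z * Cexp (RtoC x * z) - z)%C with (z * (Cexp (RtoC x * z) - 1))%C by ring.
  rewrite Cmod_mult; replace (Cmod z ^ 2 * exp (Cmod z)) with (Cmod z * (Cmod z * exp (Cmod z))) by ring.
  apply Rmult_le_compat_l; [apply Cmod_ge_0|].
  eapply Rle_trans; [apply Cmod_Cexp_sub1|].
  rewrite Cmod_mult_RtoC, Rabs_right by lra.
  assert (Hz := Cmod_ge_0 z).
  apply Rmult_le_compat; [nra|apply Rlt_le, exp_pos|nra|apply exp_le; nra]. }
assert (Hn := norm_RInt_le_const _ 0 1 _ _ Rle_0_1 Hb HI').
rewrite Rminus_0_r, Rmult_1_l, norm_Cmod in Hn; exact Hn.
Qed.

Lemma Cder_of_quadratic (f : R -> C) x (l : C) d K : 0 < d ->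
  (forall h, Rabs h <= d -> Cmod (f (x + h)%R - f x - RtoC h * l) <= K * h ^ 2) -> Cder f x l.
Proof.
intros Hd HK; split; [apply is_linear_scal_l|].
intros y Hy eps.
apply (is_filter_lim_locally_unique (V := R_NormedModule)) in Hy; subst y.
assert (K0 : 0 <= K).
{ specialize (HK d ltac:(rewrite Rabs_right; lra)).
  assert (0 < d ^ 2) by nra.
  generalize (Cmod_ge_0 (f (x + d)%R - f x - RtoC d * l)%C); nra. }
assert (He : 0 < Rmin d (eps / (K + 1))).
{ apply Rmin_glb_lt; trivial; apply Rdiv_lt_0_compat; [apply cond_pos|lra]. }
exists (mkposreal _ He); intros t Ht; change (Rabs (t - x) < Rmin d (eps / (K + 1))) in Ht.
change (norm (V := C_R_NormedModule) (f t - f x - scal (V := C_R_NormedModule) (t - x)%R l)%C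
  <= eps * Rabs (t - x)).
rewrite norm_Cmod, scal_R_Cmult.
assert (Ht1 := Rlt_le_trans _ _ _ Ht (Rmin_l _ _)).
assert (Ht2 := Rlt_le_trans _ _ _ Ht (Rmin_r _ _)).
specialize (HK (t - x) ltac:(lra)); rewrite (Rplus_minus x t) in HK.
eapply Rle_trans; [exact HK|].
rewrite <- (pow2_abs (t - x)).
assert (Hp := Rabs_pos (t - x)); set (r := Rabs (t - x)) in *.
apply (Rmult_lt_compat_r (K + 1)) in Ht2; [|lra].
replace (eps / (K + 1) * (K + 1)) with (eps : R) in Ht2 by (field; lra).
nra.
Qed.

(** * Complex improper integrals depending on a parameter *)

Notation isCI f l := (is_RInt_gen (V := C_R_NormedModule) f (at_right 0) (Rbar_locally p_infty) l).

Definition CInt (f : R -> C) : C :=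
  RInt_gen (V := C_R_CompleteNormedModule) f (at_right 0) (Rbar_locally p_infty).

Definition dominated (f : R -> C) : Prop :=
  (forall s, 0 < s -> Ccont f s) /\ exists K, forall s, 0 < s -> Cmod (f s) <= K * dominator s.

Lemma isCI_unique (f : R -> C) (l : C) : isCI f l -> CInt f = l.
Proof. apply (is_RInt_gen_unique (V := C_R_CompleteNormedModule)). Qed.

Lemma isCI_CInt f : dominated f -> isCI f (CInt f).
Proof.
intros [Hc [K HK]]; apply (RInt_gen_correct (V := C_R_CompleteNormedModule)).
apply (ex_RInt_gen_dom (V := C_R_CompleteNormedModule) f K); [exact Hc|].
intros s Hs; eapply Rle_trans; [apply Req_le, norm_Cmod|auto].
Qed.

Lemma isCI_bound (f : R -> C) (l : C) K : isCI f l ->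
  (forall s, 0 < s -> Cmod (f s) <= K * dominator s) -> Cmod l <= K * PI.
Proof.
intros Hl HK; rewrite <- norm_Cmod.
apply (RInt_gen_norm (V := C_R_CompleteNormedModule) (Fa := at_right 0) (Fb := Rbar_locally p_infty)
  f (fun s => K * dominator s) l (K * PI)); trivial.
- generalize pos_interval; apply filter_imp; tauto.
- generalize pos_interval; apply filter_imp; intros [x y] [Hx Hy] z Hz; simpl in *.
  eapply Rle_trans; [apply Req_le, norm_Cmod|apply HK; lra].
- apply (is_RInt_gen_scal (V := R_NormedModule) dominator K PI), is_RInt_gen_dom.
Qed.

Lemma is_RInt_gen_map {V W : NormedModule R_AbsRing} (L : V -> W)
    (Fa Fb : (R -> Prop) -> Prop) {HFa : Filter Fa} {HFb : Filter Fb} (f : R -> V) (l : V) :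
  (forall a b y, is_RInt f a b y -> is_RInt (fun t => L (f t)) a b (L y)) ->
  continuous L l -> is_RInt_gen f Fa Fb l -> is_RInt_gen (fun t => L (f t)) Fa Fb (L l).
Proof.
intros HL HC H P HP.
specialize (H _ (HC P HP)); unfold filtermapi in *; revert H.
apply filter_imp; intros [a b] [y [H1 H2]]; exists (L y); split; auto.
Qed.

Lemma Cmult_continuous (c l : C) :
  continuous (T := C_R_NormedModule) (U := C_R_NormedModule) (fun z => Cmult c z) l.
Proof.
intros P [e He].
assert (Hd : 0 < e / (2 * (Cmod c + 1))).
{ apply Rdiv_lt_0_compat; [apply cond_pos|generalize (Cmod_ge_0 c); lra]. }
apply (locally_le_locally_norm (V := C_R_NormedModule)).
exists (mkposreal _ Hd); intros y Hy; apply He.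
apply (norm_compat1 (V := C_R_NormedModule)).
change (norm (V := C_R_NormedModule) (y - l)%C < e / (2 * (Cmod c + 1))) in Hy.
change (norm (V := C_R_NormedModule) (c * y - c * l)%C < e).
rewrite norm_Cmod in *; replace (c * y - c * l)%C with (c * (y - l))%C by ring.
rewrite Cmod_mult; generalize (Cmod_ge_0 c) (Cmod_ge_0 (y - l)%C); intros H1 H2.
apply (Rmult_lt_compat_r (Cmod c + 1)) in Hy; [|lra].
replace (e / (2 * (Cmod c + 1)) * (Cmod c + 1)) with (e / 2) in Hy by (field; lra).
generalize (cond_pos e); nra.
Qed.

Lemma is_RInt_Cmult (c : C) f a b (y : C) : is_RInt (V := C_R_NormedModule) f a b y ->
  is_RInt (V := C_R_NormedModule) (fun s => Cmult c (f s)) a b (Cmult c y).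
Proof.
intros H.
assert (H1 := is_RInt_fct_extend_fst (U := R_NormedModule) (V := R_NormedModule) _ _ _ _ H).
assert (H2 := is_RInt_fct_extend_snd (U := R_NormedModule) (V := R_NormedModule) _ _ _ _ H).
apply (is_RInt_fct_extend_pair (U := R_NormedModule) (V := R_NormedModule)).
- apply (is_RInt_minus (V := R_NormedModule) (fun t => scal (fst c) (fst (f t))) (fun t => scal (snd c) (snd (f t))));
    apply (is_RInt_scal (V := R_NormedModule)); assumption.
- apply (is_RInt_plus (V := R_NormedModule) (fun t => scal (fst c) (snd (f t))) (fun t => scal (snd c) (fst (f t))));
    apply (is_RInt_scal (V := R_NormedModule)); assumption.
Qed.

Lemma isCI_scal (c : C) (f : R -> C) (l : C) : isCI f l -> isCI (fun s => Cmult c (f s)) (Cmult c l).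
Proof.
apply (is_RInt_gen_map (V := C_R_NormedModule) (W := C_R_NormedModule) (fun z => Cmult c z)
  (at_right 0) (Rbar_locally p_infty)).
- intros a b y; apply is_RInt_Cmult.
- apply Cmult_continuous.
Qed.

Lemma isCI_plus (f g : R -> C) (l m : C) : isCI f l -> isCI g m -> isCI (fun s => Cplus (f s) (g s)) (Cplus l m).
Proof. apply (is_RInt_gen_plus (V := C_R_NormedModule)). Qed.

Lemma isCI_minus (f g : R -> C) (l m : C) : isCI f l -> isCI g m -> isCI (fun s => Cminus (f s) (g s)) (Cminus l m).
Proof. apply (is_RInt_gen_minus (V := C_R_NormedModule)). Qed.

Lemma isCI_ext (f g : R -> C) (l : C) : (forall s, 0 < s -> f s = g s) -> isCI f l -> isCI g l.
Proof.
intros H; apply (is_RInt_gen_ext (V := C_R_NormedModule)).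
generalize pos_interval; apply filter_imp; intros [x y] [Hx Hy] z; simpl in *.
rewrite Rmin_left by trivial; intros [Hz _]; apply H; lra.
Qed.

Lemma isCI_eq (f : R -> C) (l l' : C) : isCI f l -> l = l' -> isCI f l'.
Proof. now intros H <-. Qed.

Lemma isCI_deriv (f F : R -> C) (a b : C) :
  (forall s, 0 < s -> Cder F s (f s)) -> (forall s, 0 < s -> Ccont f s) ->
  filterlim F (at_right 0) (locally (T := C_R_NormedModule) a) ->
  filterlim F (Rbar_locally p_infty) (locally (T := C_R_NormedModule) b) -> isCI f (b - a)%C.
Proof. apply (is_RInt_gen_pos_antideriv (V := C_R_CompleteNormedModule)). Qed.

Lemma isCI_deriv2 (f f1 f2 F1 F2 : R -> C) (a b : C) :
  (forall s, 0 < s <= 1 -> Cder F1 s (f1 s)) -> (forall s, 1 <= s -> Cder F2 s (f2 s)) ->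
  (forall s, 0 < s <= 1 -> Ccont f1 s) -> (forall s, 1 <= s -> Ccont f2 s) ->
  (forall s, 0 < s < 1 -> f1 s = f s) -> (forall s, 1 < s -> f2 s = f s) ->
  filterlim F1 (at_right 0) (locally (T := C_R_NormedModule) a) ->
  filterlim F2 (Rbar_locally p_infty) (locally (T := C_R_NormedModule) b) ->
  isCI f (F1 1 - a + (b - F2 1))%C.
Proof.
intros D1 D2 C1 C2 E1 E2 L1 L2.
assert (HA : filter_prod (at_right 0) (at_point 1) (fun ab : R * R => 0 < fst ab < 1 /\ snd ab = 1)).
{ exists (fun x => 0 < x < 1) (fun x => x = 1); [|reflexivity|simpl; tauto].
  exists (mkposreal 1 Rlt_0_1); intros y Hy H0.
  change (Rabs (y - 0) < 1) in Hy; rewrite Rabs_right in Hy; lra. }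
assert (HB : filter_prod (at_point 1) (Rbar_locally p_infty) (fun ab : R * R => fst ab = 1 /\ 1 < snd ab)).
{ exists (fun x => x = 1) (fun x => 1 < x); [reflexivity|now exists 1|simpl; tauto]. }
apply (is_RInt_gen_Chasles (V := C_R_NormedModule) f 1).
- apply (is_RInt_gen_ext (V := C_R_NormedModule) f1).
  + revert HA; apply filter_imp; intros [x y] [Hx ->] z; simpl in *.
    rewrite Rmin_left, Rmax_right by lra; intros Hz; apply E1; lra.
  + apply (is_RInt_gen_antideriv (V := C_R_CompleteNormedModule) _ _ f1 F1 a (F1 1)); trivial.
    * revert HA; apply filter_imp; intros [x y] [Hx ->] z; simpl in *.
      rewrite Rmin_left, Rmax_right by lra; intros Hz; split; [apply D1|apply C1]; lra.
    * intros P HP; apply (locally_singleton _ _ HP).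
- apply (is_RInt_gen_ext (V := C_R_NormedModule) f2).
  + revert HB; apply filter_imp; intros [x y] [-> Hx] z; simpl in *.
    rewrite Rmin_left, Rmax_right by lra; intros Hz; apply E2; lra.
  + apply (is_RInt_gen_antideriv (V := C_R_CompleteNormedModule) _ _ f2 F2 (F2 1) b); trivial.
    * revert HB; apply filter_imp; intros [x y] [-> Hx] z; simpl in *.
      rewrite Rmin_left, Rmax_right by lra; intros Hz; split; [apply D2|apply C2]; lra.
    * intros P HP; apply (locally_singleton _ _ HP).
Qed.

Lemma filterlim_C0 (F : (R -> Prop) -> Prop) {HF : Filter F} (f : R -> C) (g : R -> R) :
  F (fun s => Cmod (f s) <= g s) -> filterlim g F (locally 0) ->
  filterlim f F (locally (T := C_R_NormedModule) (RtoC 0)).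
Proof.
intros H1 H2 P [e He].
specialize (H2 _ (locally_ball (0 : R) e)); unfold filtermap in *.
generalize (filter_and _ _ H1 H2); apply filter_imp; intros s [A1 A2]; apply He.
apply (norm_compat1 (V := C_R_NormedModule)).
change (norm (V := C_R_NormedModule) (f s - 0)%C < e); rewrite norm_Cmod.
replace (f s - 0)%C with (f s) by ring.
change (Rabs (g s - 0) < e) in A2; rewrite Rminus_0_r in A2.
generalize (Rle_abs (g s)); lra.
Qed.

Lemma pow2_le_exp x d : 0 < d -> 0 <= x -> x ^ 2 <= 4 / d ^ 2 * exp (d * x).
Proof.
intros Hd Hx.
assert (H : (d * x) ^ 2 / 4 <= exp (d * x)).
{ assert (H0 := exp_ineq1_le (d * x / 2)).
  replace (d * x) with (d * x / 2 + d * x / 2) at 2 by field; rewrite exp_plus.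
  assert (0 <= d * x) by nra; set (y := d * x) in *; set (E := exp (y / 2)) in *; nra. }
apply Rmult_le_reg_l with (d ^ 2); [nra|].
replace (d ^ 2 * (4 / d ^ 2 * exp (d * x))) with (4 * exp (d * x)) by (field; lra); nra.
Qed.

(* Domination of [|phi e^(t a)| e^(d |a|)] for some [d > 0] makes the integral of [phi e^(t a)]
   smooth in [t], and is inherited by [a * phi] and by nearby [t]. *)
Definition expdom (a phi : R -> C) (t d : R) : Prop :=
  (forall s, 0 < s -> Ccont a s) /\ (forall s, 0 < s -> Ccont phi s) /\
  exists K, forall s, 0 < s -> Cmod (phi s) * exp (t * Re (a s) + d * Cmod (a s)) <= K * dominator s.

Lemma expdom_dominated a phi t d : 0 <= d -> expdom a phi t d ->
  dominated (fun s => Cexp (RtoC t * a s) * phi s)%C.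
Proof.
intros Hd [Ha [Hp [K HK]]]; split.
- intros s Hs; apply Ccont_mult; auto; apply Ccont_Cexp, Ccont_mult; auto; apply Ccont_const.
- exists K; intros s Hs; eapply Rle_trans; [|apply HK; trivial].
  rewrite Cmod_mult, Cmod_Cexp, Re_RtoC_mult, Rmult_comm.
  apply Rmult_le_compat_l; [apply Cmod_ge_0|apply exp_le].
  generalize (Cmod_ge_0 (a s)); nra.
Qed.

Lemma expdom_mult a phi t d d' : d' < d -> expdom a phi t d -> expdom a (fun s => a s * phi s)%C t d'.
Proof.
intros Hd [Ha [Hp [K HK]]]; split; [|split]; trivial; [intros; apply Ccont_mult; auto|].
exists (K / (d - d')); intros s Hs.
assert (H := HK s Hs); set (x := Cmod (a s)) in *; assert (Hx : 0 <= x) by apply Cmod_ge_0.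
rewrite Cmod_mult; fold x.
apply Rmult_le_reg_l with (d - d'); [lra|].
replace ((d - d') * (K / (d - d') * dominator s)) with (K * dominator s) by (field; lra).
eapply Rle_trans; [|apply H].
replace (t * Re (a s) + d * x) with ((t * Re (a s) + d' * x) + (d - d') * x) by ring.
rewrite (exp_plus _ ((d - d') * x)).
assert (H0 := exp_ineq1_le ((d - d') * x)).
assert (H1 := Cmod_ge_0 (phi s)); assert (H2 := exp_pos (t * Re (a s) + d' * x)).
set (E := exp (t * Re (a s) + d' * x)) in *.
apply Rle_trans with ((Cmod (phi s) * E) * ((d - d') * x)); [right; ring|].
apply Rle_trans with ((Cmod (phi s) * E) * exp ((d - d') * x)); [|right; ring].
apply Rmult_le_compat_l; [apply Rmult_le_pos|]; lra.
Qed.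

Lemma expdom_near a phi t d d' u : d' + Rabs (u - t) <= d -> expdom a phi t d -> expdom a phi u d'.
Proof.
intros Hd [Ha [Hp [K HK]]]; split; [|split]; trivial.
exists K; intros s Hs; eapply Rle_trans; [|apply HK; trivial].
apply Rmult_le_compat_l; [apply Cmod_ge_0|apply exp_le].
assert (H : (u - t) * Re (a s) <= Rabs (u - t) * Cmod (a s)).
{ eapply Rle_trans; [apply Rle_abs|]; rewrite Rabs_mult.
  apply Rmult_le_compat_l; [apply Rabs_pos|apply re_le_Cmod]. }
generalize (Cmod_ge_0 (a s)); nra.
Qed.

Lemma Cder_CInt_exp a phi t d : 0 < d -> expdom a phi t d ->
  Cder (fun u => CInt (fun s => Cexp (RtoC u * a s) * phi s)%C) t
       (CInt (fun s => Cexp (RtoC t * a s) * (a s * phi s))%C).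
Proof.
intros Hd Hdom.
assert (H1 := isCI_CInt _ (expdom_dominated a _ t (d / 2) ltac:(lra)
  (expdom_mult _ _ t d (d / 2) ltac:(lra) Hdom))).
assert (H0 := isCI_CInt _ (expdom_dominated a phi t d ltac:(lra) Hdom)).
assert (Hdom' := Hdom); destruct Hdom' as [Ha [Hp [K HK]]].
apply (Cder_of_quadratic _ _ _ (d / 2) (16 / d ^ 2 * K * PI)); [lra|].
intros h Hh.
assert (Hh' : d / 2 + Rabs (t + h - t) <= d) by (replace (t + h - t) with h by ring; lra).
assert (H2 := isCI_CInt _ (expdom_dominated a phi (t + h) (d / 2) ltac:(lra)
  (expdom_near _ _ t d _ _ Hh' Hdom))).
assert (H3 := isCI_minus _ _ _ _ (isCI_minus _ _ _ _ H2 H0) (isCI_scal (RtoC h) _ _ H1)).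
replace (16 / d ^ 2 * K * PI * h ^ 2) with ((16 / d ^ 2 * K * h ^ 2) * PI) by ring.
apply (isCI_bound _ _ _ H3); intros s Hs; clear H0 H1 H2 H3.
replace (Cexp (RtoC (t + h) * a s) * phi s - Cexp (RtoC t * a s) * phi s -
   RtoC h * (Cexp (RtoC t * a s) * (a s * phi s)))%C with
  (Cexp (RtoC t * a s) * phi s * (Cexp (RtoC h * a s) - 1 - RtoC h * a s))%C.
2:{ replace (RtoC (t + h) * a s)%C with (RtoC t * a s + RtoC h * a s)%C
      by (rewrite RtoC_plus; ring). rewrite Cexp_plus; ring. }
rewrite !Cmod_mult, Cmod_Cexp, Re_RtoC_mult.
specialize (HK s Hs).
assert (H4 := Cmod_Cexp_sub2 (RtoC h * a s)); rewrite Cmod_mult_RtoC in H4.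
set (x := Cmod (a s)) in *; assert (Hx : 0 <= x) by apply Cmod_ge_0.
assert (H5 := pow2_le_exp x (d / 2) ltac:(lra) Hx).
assert (H6 : Cmod (Cexp (RtoC h * a s) - 1 - RtoC h * a s) <= h ^ 2 * (16 / d ^ 2) * exp (d * x)).
{ eapply Rle_trans; [apply H4|].
  replace ((Rabs h * x) ^ 2) with (h ^ 2 * x ^ 2) by (rewrite Rpow_mult_distr, pow2_abs; ring).
  replace (d * x) with (d / 2 * x + d / 2 * x) by field; rewrite (exp_plus (d / 2 * x)).
  replace (h ^ 2 * (16 / d ^ 2) * (exp (d / 2 * x) * exp (d / 2 * x))) with
    ((h ^ 2 * (4 / (d / 2) ^ 2 * exp (d / 2 * x))) * exp (d / 2 * x)) by (field; lra).
  apply Rmult_le_compat.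
  - apply Rmult_le_pos; apply pow2_ge_0.
  - apply Rlt_le, exp_pos.
  - apply Rmult_le_compat_l; [apply pow2_ge_0|trivial].
  - apply exp_le; generalize (Rabs_pos h); nra. }
assert (P1 := Cmod_ge_0 (phi s)); assert (P2 := exp_pos (t * Re (a s))).
eapply Rle_trans; [apply Rmult_le_compat_l; [|apply H6]|].
{ apply Rmult_le_pos; lra. }
rewrite exp_plus in HK.
assert (0 <= h ^ 2 * (16 / d ^ 2)).
{ apply Rmult_le_pos; [apply pow2_ge_0|]; apply Rlt_le, Rdiv_lt_0_compat; nra. }
replace (16 / d ^ 2 * K * h ^ 2 * dominator s) with (h ^ 2 * (16 / d ^ 2) * (K * dominator s)) by ring.
replace (exp (t * Re (a s)) * Cmod (phi s) * (h ^ 2 * (16 / d ^ 2) * exp (d * x))) with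
 (h ^ 2 * (16 / d ^ 2) * (Cmod (phi s) * (exp (t * Re (a s)) * exp (d * x)))) by ring.
apply Rmult_le_compat_l; trivial.
Qed.

(** * The Gamma function *)

Lemma CInt_ext f g : (forall s, f s = g s) -> CInt f = CInt g.
Proof. now intros H; apply functional_extensionality in H; subst. Qed.

Lemma isCI_RtoC (f : R -> R) l :
  is_RInt_gen f (at_right 0) (Rbar_locally p_infty) l -> isCI (fun s => RtoC (f s)) (RtoC l).
Proof.
apply (is_RInt_gen_map (V := R_NormedModule) (W := C_R_NormedModule) RtoC (at_right 0) (Rbar_locally p_infty)).
- intros a b y H; apply (is_RInt_fct_extend_pair (U := R_NormedModule) (V := R_NormedModule)).
  + exact H.
  + replace 0 with (scal (V := R_NormedModule) (b - a) 0) by (change ((b - a) * 0 = 0); ring).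
    apply (is_RInt_const (V := R_NormedModule)).
- apply (Ccont_RtoC (fun t => t)), continuous_id.
Qed.

Lemma sqrt_exp_ln s : 0 < s -> sqrt s = exp (ln s / 2).
Proof. intros Hs; rewrite <- Rpower_sqrt by trivial; unfold Rpower; f_equal; field. Qed.

Lemma Rpower_le_exp s y : 0 < s -> 0 <= y ->
  Rpower s y <= exp (y * ln (2 * (y + 1))) * exp (s / 2).
Proof.
intros Hs Hy; unfold Rpower; rewrite <- exp_plus; apply exp_le.
assert (H := exp_ineq1_le (ln (s / (2 * (y + 1))))).
rewrite exp_ln in H by (apply Rdiv_lt_0_compat; lra).
rewrite ln_div in H by lra.
assert (H1 : s / (2 * (y + 1)) * (y + 1) = s / 2) by (field; lra).
assert (H2 : 0 < s / (2 * (y + 1))) by (apply Rdiv_lt_0_compat; lra).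
nra.
Qed.

Lemma is_derive_Rpower s y : 0 < s -> is_derive (fun s => Rpower s y) s (y * Rpower s (y - 1)).
Proof.
intros Hs; apply is_derive_Reals, derivable_pt_lim_power; trivial.
Qed.

Lemma continuous_Rpower s y : 0 < s -> continuous (fun s => Rpower s y) s.
Proof.
intros Hs; apply (ex_derive_continuous (fun s => Rpower s y)).
eexists; now apply is_derive_Rpower.
Qed.

Lemma continuous_exp_opp s : continuous (fun s => exp (- s)) s.
Proof. apply (ex_derive_continuous (fun s => exp (- s))); auto_derive; trivial. Qed.

Definition gamma_ker (x s : R) : R := Rpower s (x - 1) * exp (- s).

Lemma continuous_gamma_ker x s : 0 < s -> continuous (gamma_ker x) s.
Proof.
intros Hs; apply (continuous_mult (K := R_AbsRing));
  [now apply continuous_Rpower|apply continuous_exp_opp].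
Qed.

Lemma gamma_ker_dom x : / 2 <= x -> exists K, forall s, 0 < s -> gamma_ker x s <= K * dominator s.
Proof.
intros Hx; set (E := exp ((x - / 2) * ln (2 * ((x - / 2) + 1)))); exists (2 * E); intros s Hs.
assert (H1 := Rpower_le_exp s (x - / 2) Hs ltac:(lra)); fold E in H1.
assert (Hq : 0 < sqrt s) by (apply sqrt_lt_R0; lra).
assert (H2 : Rpower s (x - / 2) = Rpower s (x - 1) * sqrt s).
{ rewrite <- Rpower_sqrt, <- Rpower_plus by trivial; f_equal; lra. }
unfold dominator, gamma_ker; apply Rmult_le_reg_r with (sqrt s * (1 + s)); [nra|].
replace (2 * E * / (sqrt s * (1 + s)) * (sqrt s * (1 + s))) with (2 * E) by (field; nra).
replace (Rpower s (x - 1) * exp (- s) * (sqrt s * (1 + s))) with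
  (Rpower s (x - / 2) * exp (- s) * (1 + s)) by (rewrite H2; ring).
assert (H3 := exp_ineq1_le (s / 2)).
assert (H4 : exp (- s) * (exp (s / 2) * exp (s / 2)) = 1).
{ rewrite <- !exp_plus, <- exp_0; f_equal; field. }
assert (HE : 0 < E) by apply exp_pos.
assert (Hs2 := exp_pos (s / 2)); assert (Hs3 := exp_pos (- s)).
set (A := exp (- s)) in *; set (B := exp (s / 2)) in *; set (P := Rpower s (x - / 2)) in *.
assert (HP : 0 < P) by apply exp_pos.
replace (2 * E) with ((E * B) * A * (2 * B)) by (transitivity (2 * E * (A * (B * B))); [ring|rewrite H4; ring]).
apply Rmult_le_compat; [nra|lra| |lra].
apply Rmult_le_compat_r; lra.
Qed.

Lemma gamma_ker_pos x s : 0 < gamma_ker x s.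
Proof. apply Rmult_lt_0_compat; apply exp_pos. Qed.

Lemma is_RInt_gen_Gamma x : / 2 <= x ->
  is_RInt_gen (gamma_ker x) (at_right 0) (Rbar_locally p_infty) (Gamma x).
Proof.
intros Hx; apply (RInt_gen_correct (V := R_CompleteNormedModule)).
destruct (gamma_ker_dom x Hx) as [K HK].
apply (ex_RInt_gen_dom (V := R_CompleteNormedModule) (gamma_ker x) K).
- apply continuous_gamma_ker.
- intros s Hs; change (Rabs (gamma_ker x s) <= K * dominator s).
  rewrite Rabs_right by (apply Rle_ge, Rlt_le, gamma_ker_pos); auto.
Qed.

Lemma isCI_Gamma x : / 2 <= x -> isCI (fun s => RtoC (gamma_ker x s)) (RtoC (Gamma x)).
Proof. intros Hx; now apply isCI_RtoC, is_RInt_gen_Gamma. Qed.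

Lemma filterlim_le_0 (F : (R -> Prop) -> Prop) {HF : Filter F} (f g : R -> R) :
  F (fun s => Rabs (f s) <= g s) -> filterlim g F (locally 0) -> filterlim f F (locally 0).
Proof.
intros H1 H2 P [e He].
specialize (H2 _ (locally_ball (0 : R) e)); unfold filtermap in *.
generalize (filter_and _ _ H1 H2); apply filter_imp; intros s [A1 A2]; apply He.
change (Rabs (f s - 0) < e); rewrite Rminus_0_r.
change (Rabs (g s - 0) < e) in A2; rewrite Rminus_0_r in A2.
generalize (Rle_abs (g s)); lra.
Qed.

Lemma at_right_lt d : 0 < d -> at_right 0 (fun s => 0 < s < d).
Proof.
intros Hd; exists (mkposreal d Hd); intros y Hy H0.
change (Rabs (y - 0) < d) in Hy; rewrite Rabs_right in Hy; lra.
Qed.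

Lemma filterlim_sqrt_0 : filterlim sqrt (at_right 0) (locally 0).
Proof. rewrite <- sqrt_0 at 2; apply (filterlim_at_right_continuous sqrt), continuous_sqrt. Qed.

Lemma filterlim_scal_0 (F : (R -> Prop) -> Prop) (f : R -> R) K :
  filterlim f F (locally 0) -> filterlim (fun s => K * f s) F (locally 0).
Proof.
intros H; replace 0 with (K * 0) by ring.
apply (filterlim_comp _ _ _ f (fun y => K * y) _ (locally 0)); trivial.
apply (continuous_mult (K := R_AbsRing) (fun _ => K) (fun y => y)); [apply continuous_const|apply continuous_id].
Qed.

Lemma filterlim_exp_m c : 0 < c -> filterlim (fun s => exp (- (c * s))) (Rbar_locally p_infty) (locally 0).
Proof.
intros Hc P [e He]; exists (1 / (c * e)); intros s Hs; apply He.
change (Rabs (exp (- (c * s)) - 0) < e); rewrite Rminus_0_r, Rabs_right by (apply Rle_ge, Rlt_le, exp_pos).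
assert (He0 := cond_pos e).
apply (Rmult_lt_compat_r (c * e)) in Hs; [|nra].
replace (1 / (c * e) * (c * e)) with 1 in Hs by (field; lra).
rewrite exp_Ropp; assert (H := exp_ineq1_le (c * s)).
apply Rmult_lt_reg_r with (exp (c * s)); [apply exp_pos|].
rewrite Rinv_l by (generalize (exp_pos (c * s)); lra); nra.
Qed.

Lemma Rpower_small s y : 0 < s <= 1 -> / 2 <= y -> Rpower s y <= sqrt s.
Proof.
intros Hs Hy; rewrite sqrt_exp_ln by lra; unfold Rpower; apply exp_le.
assert (ln s <= 0) by (rewrite <- ln_1; apply Rcomplements.ln_le; lra); nra.
Qed.

Lemma Gamma_S x : / 2 <= x -> Gamma (x + 1) = x * Gamma x.
Proof.
intros Hx.
assert (H1 := is_RInt_gen_Gamma x Hx).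
assert (H2 := is_RInt_gen_Gamma (x + 1) ltac:(lra)).
assert (H3 := is_RInt_gen_minus (V := R_NormedModule) _ _ _ _ (is_RInt_gen_scal (V := R_NormedModule) _ x _ H1) H2).
assert (HA : forall s, 0 < s -> is_derive (fun s => Rpower s x * exp (- s)) s (x * gamma_ker x s - gamma_ker (x + 1) s)).
{ intros s Hs; unfold gamma_ker; replace (x + 1 - 1) with x by ring.
  replace (x * (Rpower s (x - 1) * exp (- s)) - Rpower s x * exp (- s)) with
    ((x * Rpower s (x - 1)) * exp (- s) + Rpower s x * (- exp (- s))) by ring.
  apply (is_derive_mult (K := R_AbsRing) (fun s => Rpower s x) (fun s => exp (- s)));
    [now apply is_derive_Rpower| |intros; apply Rmult_comm].
  auto_derive; trivial; ring. }
assert (H4 := is_RInt_gen_pos_antideriv (V := R_CompleteNormedModule) _ _ 0 0 HA).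
assert (H5 : is_RInt_gen (fun s => x * gamma_ker x s - gamma_ker (x + 1) s) (at_right 0) (Rbar_locally p_infty) 0).
{ replace 0 with (minus (0 : R) 0) at 2 by (change (0 - 0 = 0); ring).
  apply H4; clear - Hx.
  - intros s Hs; apply (continuous_minus (V := R_NormedModule) (fun s => x * gamma_ker x s)); [|now apply continuous_gamma_ker].
    apply (continuous_mult (K := R_AbsRing)); [apply continuous_const|now apply continuous_gamma_ker].
  - apply (filterlim_le_0 _ _ sqrt); [|apply filterlim_sqrt_0].
    generalize (at_right_lt 1 Rlt_0_1); apply filter_imp; intros s Hs.
    rewrite Rabs_right by (apply Rle_ge, Rlt_le, Rmult_lt_0_compat; apply exp_pos).
    assert (exp (- s) <= 1) by (rewrite <- exp_0; apply exp_le; lra).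
    assert (Hr := Rpower_small s x ltac:(lra) Hx); assert (0 < Rpower s x) by apply exp_pos.
    generalize (exp_pos (- s)); nra.
  - apply (filterlim_le_0 _ _ (fun s => exp (x * ln (2 * (x + 1))) * exp (- (/ 2 * s)))).
    + exists 0; intros s Hs.
      rewrite Rabs_right by (apply Rle_ge, Rlt_le, Rmult_lt_0_compat; apply exp_pos).
      replace (- (/ 2 * s)) with (s / 2 + - s) by field; rewrite exp_plus, <- Rmult_assoc.
      apply Rmult_le_compat_r; [apply Rlt_le, exp_pos|apply Rpower_le_exp; lra].
    + apply filterlim_scal_0, filterlim_exp_m; lra. }
assert (U1 := is_RInt_gen_unique (V := R_CompleteNormedModule) _ _ H3).
assert (U2 := is_RInt_gen_unique (V := R_CompleteNormedModule) _ _ H5).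
assert (U3 : x * Gamma x - Gamma (x + 1) = 0) by (etransitivity; [symmetry; exact U1|exact U2]).
lra.
Qed.

Lemma Gamma_1 : Gamma 1 = 1.
Proof.
assert (H : is_RInt_gen (gamma_ker 1) (at_right 0) (Rbar_locally p_infty) (minus (0 : R) (- 1))).
{ apply (is_RInt_gen_pos_antideriv (V := R_CompleteNormedModule) _ (fun s => - exp (- s))).
  - intros s Hs; unfold gamma_ker; rewrite Rminus_diag, Rpower_O by trivial; auto_derive; trivial; ring.
  - intros s; apply continuous_gamma_ker.
  - replace (- 1) with (- exp (- 0)) by (rewrite Ropp_0, exp_0; ring).
    apply (filterlim_at_right_continuous (fun s => - exp (- s))).
    apply (continuous_opp (V := R_NormedModule)), continuous_exp_opp.
  - apply (filterlim_le_0 _ _ (fun s => exp (- (1 * s)))); [|apply filterlim_exp_m; lra].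
    exists 0; intros s Hs; rewrite Rabs_Ropp, Rabs_right by (apply Rle_ge, Rlt_le, exp_pos).
    rewrite Rmult_1_l; apply Rle_refl. }
assert (H1 := is_RInt_gen_Gamma 1 ltac:(lra)).
assert (U1 := is_RInt_gen_unique (V := R_CompleteNormedModule) _ _ H1).
assert (U2 := is_RInt_gen_unique (V := R_CompleteNormedModule) _ _ H).
etransitivity; [symmetry; exact U1|]; etransitivity; [exact U2|].
change (0 - - 1 = 1); ring.
Qed.

Lemma expdom_ln phi K : (forall s, 0 < s -> Ccont phi s) ->
  (forall s, 0 < s -> Cmod (phi s) * (1 + s) ^ 2 <= K) -> expdom (fun s => RtoC (ln s)) phi 0 (/ 2).
Proof.
intros Hc HK; split; [|split]; trivial.
- intros s Hs; apply Ccont_RtoC, (ex_derive_continuous ln); auto_derive; trivial.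
- exists K; intros s Hs; specialize (HK s Hs).
  rewrite Rmult_0_l, Rplus_0_l, Cmod_R.
  assert (Hq : 0 < sqrt s) by (apply sqrt_lt_R0; lra); assert (Hq2 := sqrt_sqrt s ltac:(lra)).
  assert (HE : exp (/ 2 * Rabs (ln s)) * sqrt s <= 1 + s).
  { unfold Rabs; destruct (Rcase_abs (ln s)).
    - rewrite (sqrt_exp_ln s Hs), <- exp_plus. replace (/ 2 * - ln s + ln s / 2) with 0 by field.
      rewrite exp_0; lra.
    - replace (/ 2 * ln s) with (ln s / 2) by field; rewrite <- (sqrt_exp_ln s Hs), Hq2; lra. }
  unfold dominator; apply Rmult_le_reg_r with (sqrt s * (1 + s)); [nra|].
  replace (K * / (sqrt s * (1 + s)) * (sqrt s * (1 + s))) with K by (field; lra).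
  eapply Rle_trans; [|apply HK].
  replace (Cmod (phi s) * exp (/ 2 * Rabs (ln s)) * (sqrt s * (1 + s))) with
    (Cmod (phi s) * ((exp (/ 2 * Rabs (ln s)) * sqrt s) * (1 + s))) by ring.
  apply Rmult_le_compat_l; [apply Cmod_ge_0|].
  replace ((1 + s) ^ 2) with ((1 + s) * (1 + s)) by ring.
  apply Rmult_le_compat_r; lra.
Qed.

Definition expint (a phi : R -> C) (t : R) : C := CInt (fun s => Cexp (RtoC t * a s) * phi s)%C.

Lemma Cder_expint2 a phi d t : 0 < d -> expdom a phi 0 d -> Rabs t < d / 4 ->
  Cder (expint a phi) t (expint a (fun s => a s * phi s)%C t) /\
  Cder (expint a (fun s => a s * phi s)%C) t (expint a (fun s => a s * (a s * phi s))%C t).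
Proof.
intros Hd H Ht; split.
- apply (Cder_CInt_exp a phi t (d / 4)); [lra|].
  apply (expdom_near _ _ 0 d); trivial; rewrite Rminus_0_r; lra.
- apply (Cder_CInt_exp a (fun s => a s * phi s)%C t (d / 4)); [lra|].
  apply (expdom_near _ _ 0 (d / 2)); [rewrite Rminus_0_r; lra|].
  apply (expdom_mult _ _ _ d); trivial; lra.
Qed.

(** * An integral representation of the Mittag-Leffler function *)

Definition Csinh (z : C) : C := ((Cexp z - Cexp (- z)) / RtoC 2)%C.

Lemma RtoC2_neq0 : RtoC 2 <> RtoC 0.
Proof. intros H; apply RtoC_inj in H; lra. Qed.

Lemma Cder_Csinh (f : R -> C) x (l : C) : Cder f x l ->
  Cder (fun t => Csinh (f t)) x (Cmult l (Ccosh (f x))).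
Proof.
intros H; unfold Csinh, Ccosh, Cdiv; eapply Cder_eq.
- apply Cder_mult; [apply Cder_minus; [apply Cder_Cexp, H|apply Cder_Cexp, Cder_opp, H]|apply Cder_const].
- cbv beta; ring.
Qed.

Lemma Cder_Ccosh (f : R -> C) x (l : C) : Cder f x l ->
  Cder (fun t => Ccosh (f t)) x (Cmult l (Csinh (f x))).
Proof.
intros H; unfold Csinh, Ccosh, Cdiv; eapply Cder_eq.
- apply Cder_mult; [apply Cder_plus; [apply Cder_Cexp, H|apply Cder_Cexp, Cder_opp, H]|apply Cder_const].
- cbv beta; ring.
Qed.

Lemma Ccont_Csinh (f : R -> C) x : Ccont f x -> Ccont (fun t => Csinh (f t)) x.
Proof.
intros H; unfold Csinh, Cdiv; apply Ccont_mult; [|apply Ccont_const].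
apply Ccont_minus; apply Ccont_Cexp; trivial; now apply Ccont_opp.
Qed.

Lemma Csinh_0 : Csinh 0 = RtoC 0.
Proof. unfold Csinh; replace (- (0))%C with (RtoC 0) by ring; field; apply RtoC2_neq0. Qed.

Lemma Ccosh_0 : Ccosh 0 = RtoC 1.
Proof.
unfold Ccosh; replace (- (0))%C with (RtoC 0) by ring; rewrite Cexp_0; field; apply RtoC2_neq0.
Qed.

Lemma Cmod_half (z : C) : Cmod (z / RtoC 2) = Cmod z / 2.
Proof. rewrite Cmod_div by apply RtoC2_neq0; rewrite Cmod_R, Rabs_right; lra. Qed.

Lemma Cmod_Csinh z : Cmod (Csinh z) <= exp (Cmod z).
Proof.
unfold Csinh; rewrite Cmod_half.
assert (H1 := exp_le _ _ (Re_le_Cmod z)); assert (H2 := exp_le _ _ (Re_le_Cmod (- z)%C)).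
rewrite <- Cmod_Cexp, Cmod_opp in H2; rewrite <- Cmod_Cexp in H1.
assert (H3 := Cmod_triangle (Cexp z) (- Cexp (- z))); rewrite Cmod_opp in H3.
unfold Cminus; lra.
Qed.

(* The cut-off at [s = 1] stays continuous because [sinh] vanishes at [0]. *)
Definition sker (w : C) (s : R) : C := (w * Csinh (w * RtoC (Rmax (1 - s) 0)))%C.

Lemma sker_le w s : s <= 1 -> sker w s = (w * Csinh (w * RtoC (1 - s)))%C.
Proof. intros H; unfold sker; rewrite Rmax_left by lra; trivial. Qed.

Lemma sker_ge w s : 1 <= s -> sker w s = RtoC 0.
Proof.
intros H; unfold sker; rewrite Rmax_right by lra.
replace (w * RtoC 0)%C with (RtoC 0) by ring; rewrite Csinh_0; ring.
Qed.

Lemma Cmod_sker w s : 0 < s <= 1 -> Cmod (sker w s) <= Cmod w * exp (Cmod w).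
Proof.
intros H; rewrite sker_le, Cmod_mult by lra.
apply Rmult_le_compat_l; [apply Cmod_ge_0|].
eapply Rle_trans; [apply Cmod_Csinh|]; apply exp_le.
rewrite Cmod_mult, Cmod_R, Rabs_right by lra; generalize (Cmod_ge_0 w); nra.
Qed.

Lemma continuous_Rmax_1 s : continuous (fun s => Rmax (1 - s) 0) s.
Proof.
apply (continuous_ext (fun s => (1 - s + Rabs (1 - s)) / 2)).
{ intros t; unfold Rmax, Rabs; destruct (Rle_dec (1 - t) 0), (Rcase_abs (1 - t)); lra. }
assert (H : continuous (fun s => 1 - s) s).
{ apply (ex_derive_continuous (fun s => 1 - s)); auto_derive; trivial. }
apply (continuous_mult (K := R_AbsRing) (fun s => 1 - s + Rabs (1 - s))); [|apply continuous_const].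
apply (continuous_plus (V := R_NormedModule)); trivial.
apply (continuous_comp _ Rabs); trivial; apply continuous_Rabs.
Qed.

Lemma Ccont_sker w s : Ccont (sker w) s.
Proof.
apply Ccont_mult; [apply Ccont_const|]; apply Ccont_Csinh, Ccont_mult; [apply Ccont_const|].
apply Ccont_RtoC, continuous_Rmax_1.
Qed.

Lemma Cmod_sker_Rpower w b s : / 2 <= b -> 0 < s ->
  Cmod (RtoC (Rpower s (b - 1)) * sker w s) <= 2 * (Cmod w * exp (Cmod w)) * dominator s.
Proof.
intros Hb Hs; assert (Hd := dom_pos s Hs).
assert (H0 : 0 <= Cmod w * exp (Cmod w)) by (apply Rmult_le_pos; [apply Cmod_ge_0|apply Rlt_le, exp_pos]).
rewrite Cmod_mult_RtoC.
destruct (Rle_dec s 1) as [H1|H1].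
2:{ rewrite sker_ge, Cmod_0 by lra; nra. }
rewrite Rabs_right by (apply Rle_ge, Rlt_le, exp_pos).
assert (H2 := Cmod_sker w s ltac:(lra)).
assert (Hq : 0 < sqrt s) by (apply sqrt_lt_R0; lra).
assert (H3 : Rpower s (b - 1) <= 2 * dominator s).
{ apply Rle_trans with (/ sqrt s).
  - rewrite sqrt_exp_ln, <- exp_Ropp by trivial; unfold Rpower; apply exp_le.
    assert (ln s <= 0) by (rewrite <- ln_1; apply Rcomplements.ln_le; lra); nra.
  - unfold dominator; apply Rmult_le_reg_r with (sqrt s * (1 + s)); [nra|].
    replace (2 * / (sqrt s * (1 + s)) * (sqrt s * (1 + s))) with 2 by (field; lra).
    replace (/ sqrt s * (sqrt s * (1 + s))) with (1 + s) by (field; lra); lra. }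
replace (2 * (Cmod w * exp (Cmod w)) * dominator s) with (2 * dominator s * (Cmod w * exp (Cmod w))) by ring.
apply Rmult_le_compat; trivial; [apply Rlt_le, exp_pos|apply Cmod_ge_0].
Qed.

Definition sint (w : C) (b : R) : C := CInt (fun s => RtoC (Rpower s (b - 1)) * sker w s)%C.

Lemma isCI_sint w b : / 2 <= b -> isCI (fun s => RtoC (Rpower s (b - 1)) * sker w s)%C (sint w b).
Proof.
intros Hb; apply isCI_CInt; split.
- intros s Hs; apply Ccont_mult; [now apply Ccont_RtoC, continuous_Rpower|apply Ccont_sker].
- exists (2 * (Cmod w * exp (Cmod w))); intros s; now apply Cmod_sker_Rpower.
Qed.

Lemma Cmod_sint w b : / 2 <= b -> Cmod (sint w b) <= 2 * (Cmod w * exp (Cmod w)) * PI.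
Proof.
intros Hb; apply (isCI_bound _ _ _ (isCI_sint w b Hb)); intros s; now apply Cmod_sker_Rpower.
Qed.

Lemma Cder_Rpower y s : 0 < s -> Cder (fun s => RtoC (Rpower s y)) s (RtoC (y * Rpower s (y - 1))).
Proof. intros Hs; now apply Cder_RtoC, is_derive_Rpower. Qed.

Lemma Cder_1m (w : C) s : Cder (fun s => w * RtoC (1 - s))%C s (- w)%C.
Proof.
eapply Cder_eq; [apply Cder_scal, (Cder_RtoC (fun s => 1 - s) s (Ropp 1))|].
- auto_derive; trivial; ring.
- rewrite RtoC_opp; ring.
Qed.

Lemma RtoC_neq0 x : x <> 0 -> RtoC x <> RtoC 0.
Proof. intros H E; apply H; now apply RtoC_inj. Qed.

(* Integrate [s^(b-1) w sinh(w(1-s))] by parts twice. *)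
Lemma sint_rec w b : / 2 <= b ->
  (1 + sint w b = 1 + w ^ 2 / RtoC (b * (b + 1)) * (1 + sint w (b + 2)))%C.
Proof.
intros Hb.
assert (Hc : RtoC (b * (b + 1)) <> RtoC 0) by (apply RtoC_neq0; nra).
assert (Hc1 : RtoC b <> RtoC 0) by (apply RtoC_neq0; lra).
assert (Hc2 : RtoC (b + 1) <> RtoC 0) by (apply RtoC_neq0; lra).
assert (H := isCI_minus _ _ _ _ (isCI_sint w b Hb)
  (isCI_scal (w ^ 2 / RtoC (b * (b + 1)))%C _ _ (isCI_sint w (b + 2) ltac:(lra)))).
set (F1 := fun s => (w * (RtoC (Rpower s b) * Csinh (w * RtoC (1 - s)) / RtoC b +
   w * RtoC (Rpower s (b + 1)) * Ccosh (w * RtoC (1 - s)) / RtoC (b * (b + 1))))%C).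
set (f1 := fun s => (RtoC (Rpower s (b - 1)) * (w * Csinh (w * RtoC (1 - s))) -
  w ^ 2 / RtoC (b * (b + 1)) * (RtoC (Rpower s (b + 2 - 1)) * (w * Csinh (w * RtoC (1 - s)))))%C).
assert (HD : forall s, 0 < s -> Cder F1 s (f1 s)).
{ intros s Hs; unfold F1, f1, Cdiv; eapply Cder_eq.
  - apply Cder_scal, Cder_plus.
    + apply Cder_mult; [apply Cder_mult|apply Cder_const].
      * now apply Cder_Rpower.
      * apply Cder_Csinh, Cder_1m.
    + apply Cder_mult; [apply Cder_mult; [apply Cder_scal|]|apply Cder_const].
      * now apply Cder_Rpower.
      * apply Cder_Ccosh, Cder_1m.
  - cbv beta. replace (b + 1 - 1) with b by ring. replace (b + 2 - 1) with (b + 1) by ring.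
    rewrite !RtoC_mult; field; split; trivial. }
assert (HC : forall s, 0 < s -> Ccont f1 s).
{ assert (HW : forall s, Ccont (fun s => w * Csinh (w * RtoC (1 - s)))%C s).
  { intros s; apply Ccont_mult; [apply Ccont_const|apply Ccont_Csinh].
    eapply Cder_Ccont, Cder_1m. }
  intros s Hs; apply Ccont_minus; [|apply Ccont_mult; [apply Ccont_const|]];
    (apply Ccont_mult; [now apply Ccont_RtoC, continuous_Rpower|apply HW]). }
assert (H2 : isCI (fun s => RtoC (Rpower s (b - 1)) * sker w s -
   w ^ 2 / RtoC (b * (b + 1)) * (RtoC (Rpower s (b + 2 - 1)) * sker w s))%C
   (F1 1 - 0 + (0 - 0))%C).
{ apply (isCI_deriv2 _ f1 (fun _ => RtoC 0) F1 (fun _ => RtoC 0) (RtoC 0) (RtoC 0)).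
  - intros s Hs; apply HD; lra.
  - intros; apply Cder_const.
  - intros s Hs; apply HC; lra.
  - intros; apply Ccont_const.
  - intros s Hs; unfold f1; rewrite sker_le by lra; reflexivity.
  - intros s Hs; rewrite sker_ge by lra; ring.
  - set (K1 := Cmod w * (Cmod w * exp (Cmod w) / b)).
    assert (HX : forall s, 0 < s < 1 -> Cmod (w * RtoC (1 - s))%C <= Cmod w).
    { intros s Hs; rewrite Cmod_mult, Cmod_R, Rabs_right by lra; generalize (Cmod_ge_0 w); nra. }
    set (M := Cmod w * (exp (Cmod w) / b + Cmod w * exp (Cmod w) / (b * (b + 1)))).
    apply (filterlim_C0 _ _ (fun s => M * sqrt s)); [|apply filterlim_scal_0, filterlim_sqrt_0].
    generalize (at_right_lt 1 Rlt_0_1); apply filter_imp; intros s Hs.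
    assert (E1 := Rle_trans _ _ _ (Cmod_Csinh _) (exp_le _ _ (HX s Hs))).
    assert (E2 : Cmod (Ccosh (w * RtoC (1 - s))) <= exp (Cmod w)).
    { eapply Rle_trans; [|apply exp_le, (HX s Hs)]; unfold Ccosh; rewrite Cmod_half.
      set (u := (w * RtoC (1 - s))%C).
      assert (A1 := exp_le _ _ (Re_le_Cmod u)); assert (A2 := exp_le _ _ (Re_le_Cmod (- u)%C)).
      rewrite <- Cmod_Cexp, Cmod_opp in A2; rewrite <- Cmod_Cexp in A1.
      assert (A3 := Cmod_triangle (Cexp u) (Cexp (- u))); lra. }
    assert (E3 := Rpower_small s b ltac:(lra) Hb).
    assert (E4 := Rpower_small s (b + 1) ltac:(lra) ltac:(lra)).
    assert (P1 : 0 < Rpower s b) by apply exp_pos; assert (P2 : 0 < Rpower s (b + 1)) by apply exp_pos.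
    assert (P3 := Cmod_ge_0 w); assert (Q : 0 < sqrt s) by (apply sqrt_lt_R0; lra).
    unfold F1; rewrite Cmod_mult; unfold M; rewrite Rmult_assoc; apply Rmult_le_compat_l; trivial.
    eapply Rle_trans; [apply Cmod_triangle|].
    rewrite !Cmod_div, !Cmod_mult, !Cmod_R by trivial.
    rewrite (Rabs_right b), (Rabs_right (b * (b + 1))), (Rabs_right (Rpower s b)), (Rabs_right (Rpower s (b + 1))) by nra.
    rewrite Rmult_plus_distr_r; apply Rplus_le_compat.
    + unfold Rdiv; rewrite (Rmult_assoc (exp _)), (Rmult_comm (/ b)), <- Rmult_assoc.
      apply Rmult_le_compat_r; [apply Rlt_le, Rinv_0_lt_compat; lra|].
      rewrite (Rmult_comm (exp _)); apply Rmult_le_compat; trivial; [lra|apply Cmod_ge_0].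
    + unfold Rdiv; rewrite (Rmult_assoc (_ * exp _)), (Rmult_comm (/ _)), <- Rmult_assoc.
      apply Rmult_le_compat_r; [apply Rlt_le, Rinv_0_lt_compat; nra|].
      replace (Cmod w * exp (Cmod w) * sqrt s) with (Cmod w * sqrt s * exp (Cmod w)) by ring.
      apply Rmult_le_compat; trivial; [nra|apply Cmod_ge_0|nra].
  - apply (filterlim_const (U := C_R_NormedModule)). }
assert (E := eq_trans (eq_sym (isCI_unique _ _ H)) (isCI_unique _ _ H2)).
assert (E1 : F1 1 = (w ^ 2 / RtoC (b * (b + 1)))%C).
{ unfold F1; rewrite Rminus_diag; replace (w * RtoC 0)%C with (RtoC 0) by ring.
  rewrite Csinh_0, Ccosh_0; unfold Rpower; rewrite ln_1, !Rmult_0_r, exp_0; field; split; trivial. }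
rewrite E1 in E.
replace (sint w b) with ((sint w b - w ^ 2 / RtoC (b * (b + 1)) * sint w (b + 2)) +
   w ^ 2 / RtoC (b * (b + 1)) * sint w (b + 2))%C by ring.
rewrite E; ring.
Qed.

Lemma Gamma_SS b : / 2 <= b -> Gamma (b + 2) = b * (b + 1) * Gamma b.
Proof.
intros Hb; replace (b + 2) with (b + 1 + 1) by ring; rewrite !Gamma_S by lra; ring.
Qed.

Lemma Gamma_neq0 b n : / 2 <= b -> Gamma b <> 0 -> Gamma (2 * INR n + b) <> 0.
Proof.
intros Hb Hg; induction n as [|n IH].
- simpl; rewrite Rmult_0_r, Rplus_0_l; trivial.
- rewrite S_INR; replace (2 * (INR n + 1) + b) with ((2 * INR n + b) + 2) by ring.
  assert (Hn := pos_INR n).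
  rewrite Gamma_SS by lra; repeat apply Rmult_integral_contrapositive_currified; trivial; lra.
Qed.

Lemma lim_pow_Gamma (r b : R) : 0 < r -> / 2 <= b -> Gamma b <> 0 ->
  is_lim_seq (fun n => Rabs (r ^ n / Gamma (2 * INR n + b))) 0.
Proof.
intros Hr Hb Hg.
assert (Hn : forall n, r ^ n / Gamma (2 * INR n + b) <> 0).
{ intros n; apply Rmult_integral_contrapositive_currified; [apply pow_nonzero; lra|].
  now apply Rinv_neq_0_compat, Gamma_neq0. }
apply ex_series_lim_0.
apply (ex_series_DAlembert (fun n => r ^ n / Gamma (2 * INR n + b)) 0) in Hn; [trivial|lra|].
apply (is_lim_seq_ext (fun n => r / ((2 * INR n + b) * (2 * INR n + b + 1)))).
- intros n; assert (Hp := pos_INR n); assert (Hg' := Gamma_neq0 b n Hb Hg).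
  rewrite S_INR; replace (2 * (INR n + 1) + b) with ((2 * INR n + b) + 2) by ring.
  rewrite Gamma_SS by lra; simpl pow.
  replace (r * r ^ n / ((2 * INR n + b) * (2 * INR n + b + 1) * Gamma (2 * INR n + b)) /
    (r ^ n / Gamma (2 * INR n + b))) with (r / ((2 * INR n + b) * (2 * INR n + b + 1))).
  + rewrite Rabs_right; trivial; apply Rle_ge, Rlt_le, Rdiv_lt_0_compat; nra.
  + field; repeat split; trivial; try lra; apply pow_nonzero; lra.
- apply (is_lim_seq_le_le (fun _ => 0) _ (fun n => (2 * r) * / (INR n + 1))).
  + intros n; assert (Hp := pos_INR n); split.
    * apply Rlt_le, Rdiv_lt_0_compat; nra.
    * apply Rmult_le_reg_r with ((2 * INR n + b) * (2 * INR n + b + 1)); [nra|].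
      unfold Rdiv; rewrite Rmult_assoc, Rinv_l, Rmult_1_r by nra.
      apply Rmult_le_reg_r with (INR n + 1); [lra|].
      replace (2 * r * / (INR n + 1) * ((2 * INR n + b) * (2 * INR n + b + 1)) * (INR n + 1)) with
        (2 * r * ((2 * INR n + b) * (2 * INR n + b + 1))) by (field; lra).
      assert (INR n + 1 <= 2 * ((2 * INR n + b) * (2 * INR n + b + 1))) by nra; nra.
  + apply is_lim_seq_const.
  + replace (Finite 0) with (Rbar_mult (2 * r) 0) by (simpl; f_equal; ring).
    apply is_lim_seq_scal_l.
    apply (is_lim_seq_inv _ p_infty); [|discriminate].
    apply (is_lim_seq_ext (fun n => INR (S n))); [intros; apply S_INR|].
    apply (is_lim_seq_incr_1 INR), is_lim_seq_INR.
Qed.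

Lemma MittagLeffler2_sint w b : w <> RtoC 0 -> / 2 <= b -> Gamma b <> 0 ->
  MittagLeffler2 b (w ^ 2)%C = ((1 + sint w b) / RtoC (Gamma b))%C.
Proof.
intros Hw Hb Hg; apply CSeries_unique.
set (a := fun k => ((w ^ 2) ^ k / RtoC (Gamma (2 * INR k + b)))%C).
assert (Hg' : forall n, RtoC (Gamma (2 * INR n + b)) <> RtoC 0).
{ intros n; now apply RtoC_neq0, Gamma_neq0. }
assert (HR : forall n, (sum_n (G := C_R_NormedModule) a n : C) =
  ((1 + sint w b) / RtoC (Gamma b) - (w ^ 2) ^ S n * (1 + sint w (2 * INR (S n) + b))
     / RtoC (Gamma (2 * INR (S n) + b)))%C).
{ assert (HS : forall n, ((w ^ 2) ^ n * (1 + sint w (2 * INR n + b)) / RtoC (Gamma (2 * INR n + b)) =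
     a n + (w ^ 2) ^ S n * (1 + sint w (2 * INR (S n) + b)) / RtoC (Gamma (2 * INR (S n) + b)))%C).
  { intros n; assert (Hp := pos_INR n); rewrite (sint_rec w (2 * INR n + b)) by lra.
    rewrite S_INR; replace (2 * (INR n + 1) + b) with ((2 * INR n + b) + 2) by ring.
    unfold a; rewrite Gamma_SS by lra; rewrite (RtoC_mult (_ * _) (Gamma _)).
    assert (RtoC ((2 * INR n + b) * (2 * INR n + b + 1)) <> RtoC 0) by (apply RtoC_neq0; nra).
    rewrite (Cpow_S _ n); field; split; trivial; apply Hg'. }
  induction n as [|n IH].
  - rewrite sum_O; specialize (HS 0%nat).
    replace (2 * INR 0 + b) with b in HS by (simpl; ring).
    simpl (_ ^ 0)%C in HS; rewrite Cmult_1_l in HS; rewrite HS; ring.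
  - rewrite sum_Sn, IH; specialize (HS (S n)).
    change (plus (G := C_R_NormedModule)) with Cplus; rewrite HS; ring. }
set (l := ((1 + sint w b) / RtoC (Gamma b))%C).
set (B := 1 + 2 * (Cmod w * exp (Cmod w)) * PI).
intros P [e He].
assert (Hr : 0 < Cmod (w ^ 2)%C).
{ apply Cmod_gt_0, Cpow_nz; trivial. }
assert (HL := lim_pow_Gamma _ b Hr Hb Hg).
apply is_lim_seq_incr_1, (is_lim_seq_scal_l _ B) in HL.
replace (Rbar_mult B 0) with (Finite 0) in HL by (simpl; f_equal; ring).
apply is_lim_seq_spec in HL; specialize (HL e).
refine (filter_imp (F := eventually) _ (fun n => P (sum_n (G := C_R_NormedModule) a n)) _ HL).
intros n Hn; apply He.
apply (norm_compat1 (V := C_R_NormedModule)).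
change (norm (V := C_R_NormedModule) ((sum_n (G := C_R_NormedModule) a n : C) - l)%C < e).
rewrite norm_Cmod, HR; fold l.
replace (l - (w ^ 2) ^ S n * (1 + sint w (2 * INR (S n) + b)) / RtoC (Gamma (2 * INR (S n) + b)) - l)%C
 with (- ((w ^ 2) ^ S n * (1 + sint w (2 * INR (S n) + b)) / RtoC (Gamma (2 * INR (S n) + b))))%C by ring.
rewrite Cmod_opp, Cmod_div, Cmod_mult, Cmod_pow, Cmod_R by apply Hg'.
eapply Rle_lt_trans; [|exact Hn].
rewrite Rminus_0_r, Rabs_mult, Rabs_Rabsolu, Rabs_div by (apply Gamma_neq0; trivial).
rewrite (Rabs_right (_ ^ _)) by (apply Rle_ge, pow_le, Cmod_ge_0).
assert (HB : Cmod (1 + sint w (2 * INR (S n) + b)) <= Rabs B).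
{ eapply Rle_trans; [|apply Rle_abs]; eapply Rle_trans; [apply Cmod_triangle|]; unfold B.
  rewrite Cmod_1; apply Rplus_le_compat_l, Cmod_sint; generalize (pos_INR (S n)); lra. }
unfold Rdiv; rewrite (Rmult_comm (_ ^ _)), Rmult_assoc; apply Rmult_le_compat_r; trivial.
apply Rmult_le_pos; [apply pow_le, Cmod_ge_0|apply Rlt_le, Rinv_0_lt_compat, Rabs_pos_lt].
apply Gamma_neq0; trivial.
Qed.

Definition lnC (s : R) : C := RtoC (ln s).

Lemma Cexp_lnC b s : Cexp (RtoC b * lnC s) = RtoC (Rpower s b).
Proof. unfold lnC; rewrite <- RtoC_mult; apply Cexp_RtoC. Qed.

Definition expC (s : R) : C := RtoC (exp (- s)).

Lemma Ccont_expC s : Ccont expC s.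
Proof. apply Ccont_RtoC, continuous_exp_opp. Qed.

Lemma expdom_expC : expdom lnC expC 0 (/ 2).
Proof.
apply (expdom_ln expC 4); [intros; apply Ccont_expC|].
intros s Hs; unfold expC; rewrite Cmod_R, Rabs_right by (apply Rle_ge, Rlt_le, exp_pos).
assert (H := exp_ineq1_le (s / 2)).
assert (H4 : exp (- s) * (exp (s / 2) * exp (s / 2)) = 1).
{ rewrite <- !exp_plus, <- exp_0; f_equal; field. }
assert (Hs3 := exp_pos (- s)).
apply Rle_trans with (exp (- s) * (4 * (exp (s / 2) * exp (s / 2)))); [|nra].
apply Rmult_le_compat_l; nra.
Qed.

Lemma Cmod_sker_pow2 w s : 0 < s -> Cmod (sker w s) * (1 + s) ^ 2 <= 4 * (Cmod w * exp (Cmod w)).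
Proof.
intros Hs; assert (H0 : 0 <= Cmod w * exp (Cmod w)).
{ apply Rmult_le_pos; [apply Cmod_ge_0|apply Rlt_le, exp_pos]. }
destruct (Rle_dec s 1) as [H|H].
- assert (H1 := Cmod_sker w s ltac:(lra)); rewrite (Rmult_comm 4).
  apply Rmult_le_compat; trivial; [apply Cmod_ge_0|nra|nra].
- rewrite sker_ge, Cmod_0 by lra; lra.
Qed.

Lemma expdom_sker w : expdom lnC (sker w) 0 (/ 2).
Proof.
apply (expdom_ln (sker w) (4 * (Cmod w * exp (Cmod w)))); [intros; apply Ccont_sker|].
intros s; apply Cmod_sker_pow2.
Qed.

Lemma sint_expint w b : sint w b = expint lnC (sker w) (b - 1).
Proof. apply CInt_ext; intros s; now rewrite Cexp_lnC. Qed.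

Lemma Gamma_expint b : / 2 <= b -> RtoC (Gamma b) = expint lnC expC (b - 1).
Proof.
intros Hb; rewrite <- (isCI_unique _ _ (isCI_Gamma b Hb)); apply CInt_ext; intros s.
unfold gamma_ker, expC; now rewrite RtoC_mult, Cexp_lnC.
Qed.

Lemma expint_0 a phi : expint a phi 0 = CInt phi.
Proof.
apply CInt_ext; intros s; replace (RtoC 0 * a s)%C with (RtoC 0) by ring.
rewrite Cexp_0; ring.
Qed.

Lemma Cder_shift (f : R -> C) x (l : C) : Cder f (x - 1) l -> Cder (fun b => f (b - 1)) x l.
Proof.
intros H; eapply Cder_eq.
- apply (is_derive_comp (V := C_R_NormedModule) f (fun b => b - 1) x l 1); trivial.
  auto_derive; trivial; ring.
- rewrite scal_R_Cmult; ring.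
Qed.

Definition lnint (j : nat) (phi : R -> C) : C := CInt (fun s => lnC s ^ j * phi s)%C.

Lemma is_derive2_MittagLeffler2 w : w <> RtoC 0 ->
  is_derive2 (V := C_R_NormedModule) (fun b => MittagLeffler2 b (w ^ 2)%C) 1
    ((1 + lnint 0 (sker w)) * (RtoC 2 * lnint 1 expC ^ 2 - lnint 2 expC)
     - RtoC 2 * lnint 1 expC * lnint 1 (sker w) + lnint 2 (sker w))%C.
Proof.
intros Hw.
set (X0 := fun b => expint lnC (sker w) (b - 1)).
set (X1 := fun b => expint lnC (fun s => lnC s * sker w s)%C (b - 1)).
set (X2 := fun b => expint lnC (fun s => lnC s * (lnC s * sker w s))%C (b - 1)).
set (G0 := fun b => expint lnC expC (b - 1)).
set (G1 := fun b => expint lnC (fun s => lnC s * expC s)%C (b - 1)).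
set (G2 := fun b => expint lnC (fun s => lnC s * (lnC s * expC s))%C (b - 1)).
assert (HX : forall b, Rabs (b - 1) < / 2 / 4 -> Cder X0 b (X1 b) /\ Cder X1 b (X2 b)).
{ intros b Hb; destruct (Cder_expint2 lnC (sker w) (/ 2) (b - 1) ltac:(lra) (expdom_sker w) Hb) as [D1 D2].
  exact (conj (Cder_shift _ _ _ D1) (Cder_shift _ _ _ D2)). }
assert (HG : forall b, Rabs (b - 1) < / 2 / 4 -> Cder G0 b (G1 b) /\ Cder G1 b (G2 b)).
{ intros b Hb; destruct (Cder_expint2 lnC expC (/ 2) (b - 1) ltac:(lra) expdom_expC Hb) as [D1 D2].
  exact (conj (Cder_shift _ _ _ D1) (Cder_shift _ _ _ D2)). }
assert (HG1 : G0 1 = RtoC 1).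
{ unfold G0; rewrite <- Gamma_expint, Gamma_1 by lra; trivial. }
assert (Hloc1 : locally 1 (fun b => Rabs (b - 1) < / 2 / 4)).
{ assert (H8 : 0 < / 2 / 4) by lra; now exists (mkposreal _ H8). }
assert (H10 : Rabs (1 - 1) < / 2 / 4) by (rewrite Rminus_diag, Rabs_R0; lra).
assert (Hloc2 : locally 1 (fun b => G0 b <> RtoC 0)).
{ assert (Hc := Cder_Ccont _ _ _ (proj1 (HG 1 H10))).
  apply Ccont_pair in Hc; destruct Hc as [Hc _].
  assert (Hh : 0 < / 2) by lra.
  specialize (Hc _ (locally_ball _ (mkposreal _ Hh))); unfold filtermap in Hc.
  revert Hc; apply filter_imp; intros b Hb E.
  change (Rabs (Re (G0 b) - Re (G0 1)) < / 2) in Hb; rewrite E, HG1 in Hb; simpl in Hb.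
  rewrite Rabs_left in Hb; lra. }
assert (HM : locally 1 (fun b => MittagLeffler2 b (w ^ 2)%C = ((1 + X0 b) * / G0 b)%C)).
{ generalize (filter_and _ _ Hloc1 Hloc2); apply filter_imp; intros b [H1 H2].
  apply Rabs_def2 in H1.
  assert (Eg : RtoC (Gamma b) = G0 b) by (apply Gamma_expint; lra).
  rewrite MittagLeffler2_sint, sint_expint, Eg; trivial; [lra|].
  intros E; apply H2; now rewrite <- Eg, E. }
exists (fun b => X1 b * / G0 b + (1 + X0 b) * - (G1 b / (G0 b * G0 b)))%C; split.
- generalize (filter_and _ _ (filter_and _ _ Hloc1 Hloc2) (locally_locally _ _ HM)).
  apply filter_imp; intros b [[H1 H2] H3].
  apply (is_derive_ext_loc (V := C_R_NormedModule) (fun b => (1 + X0 b) * / G0 b)%C).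
  { revert H3; apply filter_imp; intros y Hy; now symmetry. }
  destruct (HX b H1) as [D1 _]; destruct (HG b H1) as [D2 _].
  eapply Cder_eq.
  + apply Cder_mult; [apply Cder_plus; [apply Cder_const|apply D1]|apply Cder_inv; [trivial|apply D2]].
  + cbv beta; ring.
- destruct (HX 1 H10) as [D1 D2]; destruct (HG 1 H10) as [D3 D4].
  assert (N0 : G0 1 <> RtoC 0) by (rewrite HG1; apply RtoC_neq0; lra).
  eapply Cder_eq.
  + apply Cder_plus.
    * apply Cder_mult; [apply D2|apply Cder_inv; [exact N0|apply D3]].
    * apply Cder_mult; [apply Cder_plus; [apply Cder_const|apply D1]|].
      apply Cder_opp; unfold Cdiv; apply Cder_mult; [apply D4|].
      apply (Cder_inv (fun b => G0 b * G0 b)%C); [now apply Cmult_neq_0|apply Cder_mult; apply D3].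
  + cbv beta.
    replace (X0 1) with (lnint 0 (sker w)).
    2:{ unfold X0; rewrite Rminus_diag, expint_0; apply CInt_ext; intros; simpl; ring. }
    replace (X1 1) with (lnint 1 (sker w)).
    2:{ unfold X1; rewrite Rminus_diag, expint_0; apply CInt_ext; intros; simpl; ring. }
    replace (X2 1) with (lnint 2 (sker w)).
    2:{ unfold X2; rewrite Rminus_diag, expint_0; apply CInt_ext; intros; simpl; ring. }
    replace (G1 1) with (lnint 1 expC).
    2:{ unfold G1; rewrite Rminus_diag, expint_0; apply CInt_ext; intros; simpl; ring. }
    replace (G2 1) with (lnint 2 expC).
    2:{ unfold G2; rewrite Rminus_diag, expint_0; apply CInt_ext; intros; simpl; ring. }
    rewrite HG1; field.
Qed.

(** * Laplace transforms of powers of the logarithm *)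

Definition lap (phi : R -> C) (p : C) : C := CInt (fun s => Cexp (- (p * RtoC s)) * phi s)%C.

Definition lapdom (phi : R -> C) : Prop :=
  (forall s, 0 < s -> Ccont phi s) /\
  exists K n, forall s, 0 < s -> Cmod (phi s) * sqrt s <= K * (1 + s) ^ n.

Lemma pow_exp_bound c n : 0 < c -> exists K, forall s, 0 < s -> (1 + s) ^ n * exp (- (c * s)) <= K.
Proof.
intros Hc.
assert (Hm : 0 < INR (S n)) by (apply lt_0_INR; lia); set (m := INR (S n)) in *.
assert (Hcm : 0 < m / c) by (apply Rdiv_lt_0_compat; lra).
exists ((1 + m / c) ^ S n); intros s Hs.
assert (H := exp_ineq1_le (c * s / m)).
assert (H1 : 1 + s <= (1 + m / c) * exp (c * s / m)).
{ apply Rle_trans with ((1 + m / c) * (1 + c * s / m)); [|apply Rmult_le_compat_l; lra].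
  replace ((1 + m / c) * (1 + c * s / m)) with (1 + s + m / c + c * s / m) by (field; lra).
  assert (0 < c * s / m) by (apply Rdiv_lt_0_compat; nra); lra. }
assert (H2 : (1 + s) ^ S n <= ((1 + m / c) * exp (c * s / m)) ^ S n) by (apply pow_incr; lra).
rewrite Rpow_mult_distr in H2.
assert (He : exp (c * s / m) ^ S n = exp (c * s)).
{ rewrite <- Rpower_pow by apply exp_pos; fold m; unfold Rpower; rewrite ln_exp.
  f_equal; field; lra. }
rewrite He in H2.
assert (H3 : (1 + s) ^ n <= (1 + s) ^ S n).
{ simpl; assert (0 < (1 + s) ^ n) by (apply pow_lt; lra); nra. }
rewrite exp_Ropp; apply Rmult_le_reg_r with (exp (c * s)); [apply exp_pos|].
rewrite Rmult_assoc, Rinv_l by (generalize (exp_pos (c * s)); lra); lra.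
Qed.

Lemma lapdom_exp phi c : 0 < c -> lapdom phi -> exists K, forall s, 0 < s ->
  Cmod (phi s) * exp (- (c * s)) <= K * dominator s.
Proof.
intros Hc [_ [K [n HK]]].
destruct (pow_exp_bound c (S n) Hc) as [L HL].
exists (K * L); intros s Hs; specialize (HK s Hs); specialize (HL s Hs).
assert (Hq : 0 < sqrt s) by (apply sqrt_lt_R0; lra).
assert (Hp : 0 < (1 + s) ^ n) by (apply pow_lt; lra).
assert (HK0 : 0 <= K).
{ assert (0 <= Cmod (phi s) * sqrt s) by (apply Rmult_le_pos; [apply Cmod_ge_0|lra]); nra. }
unfold dominator; apply Rmult_le_reg_r with (sqrt s * (1 + s)); [nra|].
replace (K * L * / (sqrt s * (1 + s)) * (sqrt s * (1 + s))) with (K * L) by (field; lra).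
apply Rle_trans with (K * ((1 + s) ^ S n * exp (- (c * s)))); [|now apply Rmult_le_compat_l].
replace (Cmod (phi s) * exp (- (c * s)) * (sqrt s * (1 + s))) with
  (Cmod (phi s) * sqrt s * (exp (- (c * s)) * (1 + s))) by ring.
replace (K * ((1 + s) ^ S n * exp (- (c * s)))) with
  (K * (1 + s) ^ n * (exp (- (c * s)) * (1 + s))) by (simpl; ring).
apply Rmult_le_compat_r; trivial.
apply Rmult_le_pos; [apply Rlt_le, exp_pos|lra].
Qed.

Lemma Ccont_lin (p : C) s : Ccont (fun s => p * RtoC s)%C s.
Proof. apply Ccont_mult; [apply Ccont_const|apply (Ccont_RtoC (fun s => s)), continuous_id]. Qed.

Lemma Ccont_lapker (p : C) s : Ccont (fun s => Cexp (- (p * RtoC s)))%C s.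
Proof. apply Ccont_Cexp, Ccont_opp, Ccont_lin. Qed.

Lemma Re_mult_RtoC (p : C) s : Re (p * RtoC s) = Re p * s.
Proof. unfold Re; simpl; ring. Qed.

Lemma Re_opp (p : C) : Re (- p) = - Re p.
Proof. reflexivity. Qed.

Lemma Cmod_lapker p s : Cmod (Cexp (- (p * RtoC s))) = exp (- (Re p * s)).
Proof. now rewrite Cmod_Cexp, Re_opp, Re_mult_RtoC. Qed.

Lemma lap_dominated phi p : 0 < Re p -> lapdom phi ->
  dominated (fun s => Cexp (- (p * RtoC s)) * phi s)%C.
Proof.
intros Hp H; split.
- intros s Hs; apply Ccont_mult; [apply Ccont_lapker|now apply H].
- destruct (lapdom_exp phi (Re p) Hp H) as [K HK]; exists K; intros s Hs.
  rewrite Cmod_mult, Cmod_lapker, Rmult_comm; auto.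
Qed.

Lemma isCI_lap phi p : 0 < Re p -> lapdom phi ->
  isCI (fun s => Cexp (- (p * RtoC s)) * phi s)%C (lap phi p).
Proof. intros; now apply isCI_CInt, lap_dominated. Qed.

Lemma Cder_lap phi p d t : lapdom phi -> 0 < Re (p + RtoC t * d)%C ->
  Cder (fun t => lap phi (p + RtoC t * d)%C) t
    (- d * lap (fun s => RtoC s * phi s)%C (p + RtoC t * d))%C.
Proof.
intros H Hc; set (c := Re (p + RtoC t * d)%C) in *.
set (a := fun s => (- (d * RtoC s))%C); set (psi := fun s => (Cexp (- (p * RtoC s)) * phi s)%C).
assert (Hd := Cmod_ge_0 d); set (e := c / (2 * (Cmod d + 1))).
assert (He : 0 < e) by (apply Rdiv_lt_0_compat; lra).
assert (Hed : e * Cmod d <= c / 2).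
{ assert (e * (Cmod d + 1) = c / 2) by (unfold e; field; lra); nra. }
assert (Hdom : expdom a psi t e).
{ split; [|split].
  - intros s Hs; apply Ccont_opp, Ccont_lin.
  - intros s Hs; apply Ccont_mult; [apply Ccont_lapker|now apply H].
  - destruct (lapdom_exp phi (c / 2) ltac:(lra) H) as [K HK]; exists K; intros s Hs.
    eapply Rle_trans; [|apply HK; trivial].
    unfold psi, a; rewrite Cmod_mult, Cmod_lapker, (Rmult_comm (exp _)), Rmult_assoc, <- exp_plus.
    apply Rmult_le_compat_l; [apply Cmod_ge_0|apply exp_le].
    rewrite Re_opp, Re_mult_RtoC, Cmod_opp, Cmod_mult, Cmod_R, Rabs_right by lra.
    assert (Ec : c = Re p + t * Re d) by (unfold c, Re; simpl; ring).
    assert (e * Cmod d * s <= c / 2 * s) by (apply Rmult_le_compat_r; lra).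
    nra. }
assert (Hpsi : forall u f s, (Cexp (RtoC u * a s) * (Cexp (- (p * RtoC s)) * f) =
  Cexp (- ((p + RtoC u * d) * RtoC s)) * f)%C).
{ intros u f s; replace (- ((p + RtoC u * d) * RtoC s))%C with (RtoC u * a s + - (p * RtoC s))%C
    by (unfold a; ring). rewrite Cexp_plus; ring. }
assert (HD := Cder_CInt_exp a psi t e He Hdom).
eapply Cder_eq.
- eapply Cder_ext; [|apply HD].
  intros u; apply CInt_ext; intros s; apply Hpsi.
- assert (Hdm : dominated (fun s => Cexp (RtoC t * a s) * (a s * psi s))%C).
  { apply (expdom_dominated a _ t (e / 2)); [lra|apply (expdom_mult _ _ _ e); trivial; lra]. }
  destruct (Ceq_dec d (RtoC 0)) as [E|E].
  + replace (- d * _)%C with (RtoC 0) by (rewrite E; ring).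
    apply isCI_unique.
    apply (isCI_ext (fun s => RtoC 0 * (Cexp (RtoC t * a s) * (a s * psi s)))%C).
    * intros s Hs; unfold a; rewrite E; ring.
    * eapply isCI_eq; [apply isCI_scal, isCI_CInt, Hdm|ring].
  + set (X := CInt _).
    replace (lap _ _) with (- / d * X)%C; [field; trivial|].
    symmetry; apply isCI_unique.
    apply (isCI_ext (fun s => - / d * (Cexp (RtoC t * a s) * (a s * psi s)))%C).
    * intros s Hs; unfold psi; rewrite <- Hpsi; unfold a; field; trivial.
    * apply isCI_scal, isCI_CInt, Hdm.
Qed.

Lemma lapdom_mult_s phi : lapdom phi -> lapdom (fun s => RtoC s * phi s)%C.
Proof.
intros [Hc [K [n HK]]]; split.
- intros s Hs; apply Ccont_mult; [apply (Ccont_RtoC (fun s => s)), continuous_id|auto].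
- exists K, (S n); intros s Hs; rewrite Cmod_mult_RtoC, Rabs_right by lra.
  assert (H0 : 0 <= Cmod (phi s) * sqrt s) by (apply Rmult_le_pos; [apply Cmod_ge_0|apply sqrt_pos]).
  specialize (HK s Hs); simpl; nra.
Qed.

Lemma lap_limits phi p : 0 < Re p -> lapdom phi ->
  filterlim (fun s => RtoC s * (Cexp (- (p * RtoC s)) * phi s))%C (at_right 0)
    (locally (T := C_R_NormedModule) (RtoC 0)) /\
  filterlim (fun s => RtoC s * (Cexp (- (p * RtoC s)) * phi s))%C (Rbar_locally p_infty)
    (locally (T := C_R_NormedModule) (RtoC 0)).
Proof.
intros Hp H; set (c := Re p) in *.
assert (Hm : forall s, 0 < s -> Cmod (RtoC s * (Cexp (- (p * RtoC s)) * phi s))%C =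
  sqrt s * (Cmod (phi s) * sqrt s) * exp (- (c * s))).
{ intros s Hs; rewrite Cmod_mult_RtoC, Cmod_mult, Cmod_lapker, Rabs_right by lra.
  rewrite <- (sqrt_sqrt s) at 1 by lra; fold c; ring. }
destruct H as [_ [K [n HK]]].
assert (HK0 : 0 <= K).
{ specialize (HK 1 Rlt_0_1); rewrite sqrt_1, Rmult_1_r in HK.
  assert (0 < (1 + 1) ^ n) by (apply pow_lt; lra).
  generalize (Cmod_ge_0 (phi 1)); nra. }
split.
- apply (filterlim_C0 _ _ (fun s => K * 2 ^ n * sqrt s)); [|apply filterlim_scal_0, filterlim_sqrt_0].
  generalize (at_right_lt 1 Rlt_0_1); apply filter_imp; intros s Hs.
  rewrite Hm by lra; specialize (HK s ltac:(lra)).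
  assert (H1 : (1 + s) ^ n <= 2 ^ n) by (apply pow_incr; lra).
  assert (H2 : exp (- (c * s)) <= 1) by (rewrite <- exp_0; apply exp_le; nra).
  assert (H3 := exp_pos (- (c * s))); assert (H4 := sqrt_pos s).
  assert (H5 : 0 <= Cmod (phi s) * sqrt s) by (apply Rmult_le_pos; [apply Cmod_ge_0|lra]).
  apply Rle_trans with (sqrt s * (Cmod (phi s) * sqrt s) * 1).
  + apply Rmult_le_compat_l; [apply Rmult_le_pos|]; lra.
  + rewrite Rmult_1_r, (Rmult_comm (sqrt s)); apply Rmult_le_compat_r; trivial.
    eapply Rle_trans; [apply HK|]; apply Rmult_le_compat_l; lra.
- destruct (pow_exp_bound (c / 2) (S n) ltac:(lra)) as [L HL].
  apply (filterlim_C0 _ _ (fun s => K * L * exp (- (c / 2 * s)))).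
  + exists 0; intros s Hs; rewrite Hm by lra.
    replace (- (c * s)) with (- (c / 2 * s) + - (c / 2 * s)) by field; rewrite exp_plus, <- Rmult_assoc.
    apply Rmult_le_compat_r; [apply Rlt_le, exp_pos|].
    apply Rle_trans with (K * ((1 + s) ^ S n * exp (- (c / 2 * s)))); [|apply Rmult_le_compat_l; auto].
    apply Rle_trans with (K * (1 + s) ^ S n * exp (- (c / 2 * s))); [|right; ring].
    apply Rmult_le_compat_r; [apply Rlt_le, exp_pos|].
    assert (Hq : sqrt s <= 1 + s).
    { assert (H4 := sqrt_sqrt s ltac:(lra)); assert (H5 := sqrt_pos s); nra. }
    replace (K * (1 + s) ^ S n) with ((1 + s) * (K * (1 + s) ^ n)) by (simpl; ring).
    apply Rmult_le_compat; auto; [apply sqrt_pos|].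
    apply Rmult_le_pos; [apply Cmod_ge_0|apply sqrt_pos].
  + apply filterlim_scal_0, filterlim_exp_m; lra.
Qed.

Lemma Cder_lapker p s : Cder (fun s => Cexp (- (p * RtoC s)))%C s (- p * Cexp (- (p * RtoC s)))%C.
Proof.
apply (Cder_Cexp (fun s => - (p * RtoC s))%C), Cder_opp.
eapply Cder_eq; [apply Cder_scal, (Cder_RtoC (fun s => s) s 1), (is_derive_id (K := R_AbsRing))|ring].
Qed.

Lemma lap_ibp phi dphi p : 0 < Re p -> lapdom phi -> lapdom (fun s => RtoC s * dphi s)%C ->
  (forall s, 0 < s -> Cder phi s (dphi s)) ->
  (p * lap (fun s => RtoC s * phi s) p = lap phi p + lap (fun s => RtoC s * dphi s) p)%C.
Proof.
intros Hp H1 H2 HD.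
assert (I1 := isCI_lap _ p Hp H1); assert (I2 := isCI_lap _ p Hp H2).
assert (I3 := isCI_lap _ p Hp (lapdom_mult_s _ H1)).
destruct (lap_limits phi p Hp H1) as [L0 Lp].
assert (I5 : isCI (fun s => Cexp (- (p * RtoC s)) * phi s + Cexp (- (p * RtoC s)) * (RtoC s * dphi s)
   - p * (Cexp (- (p * RtoC s)) * (RtoC s * phi s)))%C (RtoC 0 - RtoC 0)%C).
{ apply (isCI_deriv _ (fun s => RtoC s * (Cexp (- (p * RtoC s)) * phi s))%C); trivial.
  - intros s Hs; eapply Cder_eq.
    + apply Cder_mult; [apply (Cder_RtoC (fun s => s) s 1), (is_derive_id (K := R_AbsRing))|].
      apply Cder_mult; [apply Cder_lapker|apply HD, Hs].
    + cbv beta; ring.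
  - destruct H1 as [H1 _]; destruct H2 as [H2 _]; intros s Hs.
    apply Ccont_minus; [apply Ccont_plus|apply Ccont_mult; [apply Ccont_const|]];
      (apply Ccont_mult; [apply Ccont_lapker|]).
    + now apply H1.
    + now apply H2.
    + apply Ccont_mult; [apply (Ccont_RtoC (fun s => s)), continuous_id|now apply H1]. }
assert (E := eq_trans (eq_sym (isCI_unique _ _ (isCI_minus _ _ _ _ (isCI_plus _ _ _ _ I1 I2)
  (isCI_scal p _ _ I3)))) (isCI_unique _ _ I5)).
replace (lap phi p + lap (fun s => RtoC s * dphi s) p)%C with
  ((lap phi p + lap (fun s => RtoC s * dphi s) p - p * lap (fun s => RtoC s * phi s) p)
    + p * lap (fun s => RtoC s * phi s) p)%C by ring.
rewrite E; ring.
Qed.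

Lemma abs_ln_le x : 0 < x -> Rabs (ln x) <= x + / x.
Proof.
intros Hx; assert (Hi := Rinv_0_lt_compat x Hx).
assert (H1 := exp_ineq1_le (ln x)); rewrite exp_ln in H1 by trivial.
assert (H2 := exp_ineq1_le (- ln x)); rewrite exp_Ropp, exp_ln in H2 by trivial.
unfold Rabs; destruct (Rcase_abs (ln x)); lra.
Qed.

Lemma abs_ln_root x : 0 < x -> Rabs (ln x) * sqrt (sqrt x) <= 4 * (1 + sqrt x).
Proof.
intros Hx; assert (Hq : 0 < sqrt x) by now apply sqrt_lt_R0.
assert (Hr : 0 < sqrt (sqrt x)) by now apply sqrt_lt_R0.
assert (E : ln x = 4 * ln (sqrt (sqrt x))).
{ rewrite (sqrt_exp_ln (sqrt x)), ln_exp by trivial.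
  rewrite (sqrt_exp_ln x), ln_exp by trivial; field. }
assert (H := abs_ln_le _ Hr).
rewrite E, Rabs_mult, (Rabs_right 4) by lra.
assert (H2 := sqrt_sqrt (sqrt x) ltac:(lra)); set (r := sqrt (sqrt x)) in *.
rewrite <- H2; apply (Rmult_le_compat_r r) in H; [|lra].
replace ((r + / r) * r) with (1 + r * r) in H by (field; lra); lra.
Qed.

Lemma continuous_ln s : 0 < s -> continuous ln s.
Proof. intros Hs; apply (ex_derive_continuous ln); auto_derive; trivial. Qed.

Lemma lapdom_lnC j : (j <= 2)%nat -> lapdom (fun s => lnC s ^ j)%C.
Proof.
intros Hj; split.
- intros s Hs; assert (H : Ccont lnC s) by now apply Ccont_RtoC, continuous_ln.
  induction j as [|j IH]; [apply Ccont_const|].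
  apply (Ccont_mult lnC (fun s => lnC s ^ j)%C); trivial; apply IH; lia.
- exists 64, 2%nat; intros s Hs; unfold lnC; rewrite Cmod_pow, Cmod_R.
  assert (H := abs_ln_root s Hs).
  assert (H2 := sqrt_sqrt s ltac:(lra)); assert (H3 := sqrt_sqrt (sqrt s) (sqrt_pos s)).
  assert (H4 := sqrt_pos s); assert (H5 := sqrt_pos (sqrt s)); assert (H6 := Rabs_pos (ln s)).
  set (q := sqrt s) in *; set (r := sqrt q) in *; set (L := Rabs (ln s)) in *.
  assert (Hq : q <= 1 + s) by nra.
  assert (Hr : r <= 1 + q) by nra.
  assert (Hj' : j = 0%nat \/ j = 1%nat \/ j = 2%nat) by lia.
  destruct Hj' as [->|[->| ->]]; simpl.
  + nra.
  + rewrite <- H3; replace (L * 1 * (r * r)) with ((L * r) * r) by ring.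
    apply Rle_trans with (4 * (1 + q) * (1 + q)); [|nra].
    apply Rmult_le_compat; trivial; apply Rmult_le_pos; trivial.
  + rewrite <- H3; replace (L * (L * 1) * (r * r)) with ((L * r) * (L * r)) by ring.
    apply Rle_trans with ((4 * (1 + q)) * (4 * (1 + q))); [|nra].
    apply Rmult_le_compat; trivial; apply Rmult_le_pos; trivial.
Qed.

Lemma Cder_lnC s : 0 < s -> Cder lnC s (RtoC (/ s)).
Proof. intros Hs; apply Cder_RtoC; auto_derive; trivial; ring. Qed.

Lemma lapdom_ext (phi psi : R -> C) : (forall s, 0 < s -> phi s = psi s) -> (forall s, 0 < s -> Ccont psi s) ->
  lapdom phi -> lapdom psi.
Proof.
intros E Hc [_ [K [n HK]]]; split; trivial; exists K, n; intros s Hs; rewrite <- E; auto.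
Qed.

Lemma lapdom_scal (c : C) phi : lapdom phi -> lapdom (fun s => c * phi s)%C.
Proof.
intros [Hc [K [n HK]]]; split; [intros; apply Ccont_mult; [apply Ccont_const|auto]|].
exists (Cmod c * K), n; intros s Hs; rewrite Cmod_mult, !Rmult_assoc.
apply Rmult_le_compat_l; [apply Cmod_ge_0|auto].
Qed.

Definition lapln (j : nat) (p : C) : C := lap (fun s => lnC s ^ j)%C p.

Lemma Cder_lnC_pow j s : 0 < s ->
  Cder (fun s => lnC s ^ S j)%C s (RtoC (INR (S j)) * lnC s ^ j * RtoC (/ s))%C.
Proof.
intros Hs; induction j as [|j IH].
- apply (Cder_ext lnC); [intros t; simpl; ring|].
  eapply Cder_eq; [now apply Cder_lnC|simpl; ring].
- apply (Cder_ext (fun s => lnC s * lnC s ^ S j)%C); [reflexivity|].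
  eapply Cder_eq; [apply Cder_mult; [now apply Cder_lnC|apply IH]|].
  rewrite (S_INR (S j)), RtoC_plus; cbv beta; rewrite !Cpow_S; ring.
Qed.

Lemma lapln_ibp j p : (j <= 1)%nat -> 0 < Re p ->
  (p * lap (fun s => RtoC s * lnC s ^ S j) p = lapln (S j) p + RtoC (INR (S j)) * lapln j p)%C.
Proof.
intros Hj Hp.
assert (HE : forall s, 0 < s ->
  (RtoC (INR (S j)) * lnC s ^ j = RtoC s * (RtoC (INR (S j)) * lnC s ^ j * RtoC (/ s)))%C).
{ intros s Hs; rewrite RtoC_inv by lra; field; apply RtoC_neq0; lra. }
assert (HL : lapdom (fun s => RtoC s * (RtoC (INR (S j)) * lnC s ^ j * RtoC (/ s)))%C).
{ apply (lapdom_ext (fun s => RtoC (INR (S j)) * lnC s ^ j)%C); trivial.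
  - intros s Hs; apply Ccont_mult; [apply (Ccont_RtoC (fun s => s)), continuous_id|].
    apply Ccont_mult; [apply Ccont_mult; [apply Ccont_const|apply (lapdom_lnC j); [lia|trivial]]|].
    apply (Ccont_RtoC (fun s => / s)), (ex_derive_continuous (fun s => / s)); auto_derive; lra.
  - apply lapdom_scal, lapdom_lnC; lia. }
assert (HL0 : lapdom (fun s => lnC s ^ S j)%C) by (apply lapdom_lnC; lia).
rewrite (lap_ibp (fun s => lnC s ^ S j)%C _ p Hp HL0 HL);
  [|intros; now apply Cder_lnC_pow].
f_equal; apply isCI_unique.
apply (isCI_ext (fun s => RtoC (INR (S j)) * (Cexp (- (p * RtoC s)) * lnC s ^ j))%C).
- intros s Hs; rewrite <- HE by trivial; ring.
- apply isCI_scal, isCI_lap; trivial; apply lapdom_lnC; lia.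
Qed.

Lemma filterlim_at_right_Ccont (f : R -> C) x (l : C) : Ccont f x -> f x = l ->
  filterlim f (at_right x) (locally (T := C_R_NormedModule) l).
Proof. intros H <-; now apply (filterlim_at_right_continuous (V := C_R_NormedModule)). Qed.

Lemma lapln_0 p : 0 < Re p -> (p * lapln 0 p)%C = RtoC 1.
Proof.
intros Hp.
assert (Hp0 : p <> RtoC 0) by (intros E; rewrite E in Hp; simpl in Hp; lra).
assert (H : isCI (fun s => Cexp (- (p * RtoC s)) * lnC s ^ 0)%C (RtoC 0 - - / p)%C).
{ apply (isCI_deriv _ (fun s => - / p * Cexp (- (p * RtoC s)))%C).
  - intros s Hs; eapply Cder_eq; [apply Cder_scal, Cder_lapker|simpl; field; trivial].
  - intros s Hs; apply Ccont_mult; [apply Ccont_lapker|apply Ccont_const].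
  - apply (filterlim_at_right_Ccont (fun s => - / p * Cexp (- (p * RtoC s)))%C).
    + apply Ccont_mult; [apply Ccont_const|apply Ccont_lapker].
    + replace (- (p * RtoC 0))%C with (RtoC 0) by ring; rewrite Cexp_0; ring.
  - apply (filterlim_C0 _ _ (fun s => Cmod (- / p)%C * exp (- (Re p * s)))).
    + exists 0; intros s Hs; rewrite Cmod_mult, Cmod_lapker; lra.
    + now apply filterlim_scal_0, filterlim_exp_m. }
unfold lapln, lap; rewrite (isCI_unique _ _ H); field; trivial.
Qed.

(* Principal logarithm on the right half-plane; only used for [0 < Re z]. *)
Definition clog (z : C) : C := (ln (Re z ^ 2 + Im z ^ 2) / 2, atan (Im z / Re z)).

Lemma Cder_clog (f : R -> C) x (l : C) : 0 < Re (f x) -> Cder f x l ->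
  Cder (fun t => clog (f t)) x (l / f x)%C.
Proof.
rewrite !Cder_pair; intros Hx [F1 F2].
set (u := fun t => Re (f t)) in *; set (v := fun t => Im (f t)) in *.
change (0 < u x) in Hx.
assert (E1 : Derive (fun t => u t) x = Re l) by exact (is_derive_unique _ _ _ F1).
assert (E2 : Derive (fun t => v t) x = Im l) by exact (is_derive_unique _ _ _ F2).
assert (D1 : ex_derive u x) by (eexists; eauto).
assert (D2 : ex_derive v x) by (eexists; eauto).
assert (Ef : f x = (u x, v x)) by apply surjective_pairing.
assert (Hn : 0 < u x * u x + v x * v x) by nra.
split.
- apply (is_derive_ext (fun t => ln (u t ^ 2 + v t ^ 2) / 2)); [reflexivity|].
  auto_derive; [repeat split; trivial; nra|]. rewrite E1, E2, Ef; clear - Hn Hx.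
  generalize dependent (u x); generalize dependent (v x); intros b a Ha Hn.
  destruct l as [c d]; unfold Re, Im in *; simpl in *; field; nra.
- apply (is_derive_ext (fun t => atan (v t / u t))); [reflexivity|].
  auto_derive; [repeat split; trivial; lra|]. rewrite E1, E2, Ef; clear - Hn Hx.
  generalize dependent (u x); generalize dependent (v x); intros b a Ha Hn.
  destruct l as [c d]; unfold Re, Im in *; simpl in *; field; repeat split; nra.
Qed.

Lemma Cder_0_const (f : R -> C) : (forall t, 0 <= t <= 1 -> Cder f t (RtoC 0)) -> f 1 = f 0.
Proof.
intros H.
assert (H1 : is_RInt (V := C_R_NormedModule) (fun _ => RtoC 0) 0 1 (f 1 - f 0)%C).
{ apply (is_RInt_derive (V := C_R_CompleteNormedModule) f (fun _ => RtoC 0)).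
  - intros x; rewrite Rmin_left, Rmax_right by lra; apply H.
  - intros; apply Ccont_const. }
assert (H2 := is_RInt_const (V := C_R_NormedModule) 0 1 (RtoC 0)).
rewrite scal_R_Cmult in H2.
assert (E := eq_trans (eq_sym (is_RInt_unique (V := C_R_CompleteNormedModule) _ _ _ _ H1))
  (is_RInt_unique (V := C_R_CompleteNormedModule) _ _ _ _ H2)).
replace (f 1) with ((f 1 - f 0) + f 0)%C by ring; rewrite E; ring.
Qed.

Lemma clog_1 : clog 1 = RtoC 0.
Proof.
unfold clog, RtoC; simpl; f_equal.
- replace (1 * (1 * 1) + 0 * (0 * 1)) with 1 by ring; rewrite ln_1; field.
- unfold Rdiv; rewrite Rmult_0_l; apply atan_0.
Qed.

Lemma lapln_1 j : lapln j 1 = lnint j expC.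
Proof.
apply CInt_ext; intros s; unfold expC.
replace (- (1 * RtoC s))%C with (RtoC (- s)) by (rewrite RtoC_opp; ring).
rewrite Cexp_RtoC; ring.
Qed.

Lemma Cder_mult_lapln j p d t : (j <= 1)%nat -> 0 < Re (p + RtoC t * d)%C ->
  Cder (fun t => (p + RtoC t * d) * lapln (S j) (p + RtoC t * d))%C t
    (- d * (RtoC (INR (S j)) * lapln j (p + RtoC t * d)))%C.
Proof.
intros Hj Hc; eapply Cder_eq.
- apply Cder_mult; [apply Cder_line|apply Cder_lap; trivial; apply lapdom_lnC; lia].
- cbv beta; assert (E := lapln_ibp j _ Hj Hc); set (q := (p + RtoC t * d)%C) in *.
  unfold lapln in *; replace (q * (- d * lap (fun s => RtoC s * lnC s ^ S j) q))%C with
   (- d * (q * lap (fun s => RtoC s * lnC s ^ S j) q))%C by ring; rewrite E; ring.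
Qed.

Lemma Re_segment p t : 0 < Re p -> 0 <= t <= 1 -> 0 < Re (1 + RtoC t * (p - 1))%C.
Proof.
intros Hp Ht; replace (Re _) with ((1 - t) + t * Re p) by (unfold Re; simpl; ring).
destruct (Req_dec t 1) as [->|H]; nra.
Qed.

(* Both sides have the same derivative along the segment from [1] to [p]. *)
Lemma lapln_1_clog p : 0 < Re p -> (p * lapln 1 p = lnint 1 expC - clog p)%C.
Proof.
intros Hp; set (q := fun t => (1 + RtoC t * (p - 1))%C).
assert (H := Cder_0_const (fun t => q t * lapln 1 (q t) + clog (q t))%C).
assert (E0 : q 0 = RtoC 1) by (unfold q; ring); assert (E1 : q 1 = p) by (unfold q; ring).
cbv beta in H; rewrite E0, E1, clog_1, lapln_1 in H.
replace (p * lapln 1 p)%C with (p * lapln 1 p + clog p - clog p)%C by ring; rewrite H; [ring|].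
intros t Ht; assert (Hq := Re_segment p t Hp Ht); eapply Cder_eq.
- apply Cder_plus; [apply (Cder_mult_lapln 0); trivial; lia|apply Cder_clog; [exact Hq|apply Cder_line]].
- assert (E := lapln_0 _ Hq); fold (q t) in *.
  assert (Hq0 : q t <> RtoC 0) by (intros E'; rewrite E' in Hq; simpl in Hq; lra).
  replace (lapln 0 (q t)) with (/ q t * (q t * lapln 0 (q t)))%C by (field; trivial).
  rewrite E; simpl; field; trivial.
Qed.

Lemma lapln_2_clog p : 0 < Re p ->
  (p * lapln 2 p = clog p ^ 2 - RtoC 2 * lnint 1 expC * clog p + lnint 2 expC)%C.
Proof.
intros Hp; set (q := fun t => (1 + RtoC t * (p - 1))%C); set (g := lnint 1 expC).
assert (H := Cder_0_const (fun t => q t * lapln 2 (q t) - (clog (q t) * clog (q t) - RtoC 2 * g * clog (q t)))%C).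
assert (E0 : q 0 = RtoC 1) by (unfold q; ring); assert (E1 : q 1 = p) by (unfold q; ring).
cbv beta in H; rewrite E0, E1, clog_1, lapln_1 in H.
replace (p * lapln 2 p)%C with (p * lapln 2 p - (clog p * clog p - RtoC 2 * g * clog p) +
  (clog p * clog p - RtoC 2 * g * clog p))%C by ring; rewrite H; [simpl; ring|].
intros t Ht; assert (Hq := Re_segment p t Hp Ht).
assert (HD : Cder (fun t => clog (q t)) t ((p - 1) / q t)%C).
{ apply Cder_clog; [exact Hq|apply Cder_line]. }
eapply Cder_eq.
- apply Cder_minus; [apply (Cder_mult_lapln 1); trivial; lia|apply Cder_minus; [apply Cder_mult; exact HD|]].
  apply Cder_scal, HD.
- assert (E := lapln_1_clog _ Hq); fold g in E; fold (q t) in *.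
  assert (Hq0 : q t <> RtoC 0) by (intros E'; rewrite E' in Hq; simpl in Hq; lra).
  replace (lapln 1 (q t)) with (/ q t * (q t * lapln 1 (q t)))%C by (field; trivial).
  rewrite E; simpl INR; rewrite RtoC_plus; field; trivial.
Qed.

(** * The Abel-regularized integrals *)

Lemma Ci_sqr : (Ci * Ci)%C = (- (1))%C.
Proof. unfold Ci, Cmult, Copp, RtoC; simpl; f_equal; ring. Qed.

Definition den (w : C) (v : R) : C := (RtoC v * RtoC v + w * w)%C.

Lemma Cmod_linear_lower (z : C) v : Im z <> 0 -> 0 <= v ->
  1 + v <= ((1 + Cmod z) / Rabs (Im z) + 1) * Cmod (RtoC v + z)%C.
Proof.
intros Hz Hv; assert (Hi := Rabs_pos_lt _ Hz); assert (Hm := Cmod_ge_0 z).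
assert (H1 : Rabs (Im z) <= Cmod (RtoC v + z)%C).
{ eapply Rle_trans; [|apply Rmax_Cmod]; eapply Rle_trans; [|apply Rmax_r].
  right; f_equal; unfold Im; simpl; ring. }
assert (H2 : v <= Cmod (RtoC v + z)%C + Cmod z).
{ assert (H := Cmod_triangle (RtoC v + z) (- z)); rewrite Cmod_opp in H.
  replace (RtoC v + z + - z)%C with (RtoC v) in H by ring.
  rewrite Cmod_R, Rabs_right in H; lra. }
set (m := Cmod (RtoC v + z)%C) in *.
assert (H3 : 1 + Cmod z <= (1 + Cmod z) / Rabs (Im z) * m).
{ unfold Rdiv; rewrite Rmult_assoc; rewrite <- (Rmult_1_r (1 + Cmod z)) at 1.
  apply Rmult_le_compat_l; [lra|]; apply Rmult_le_reg_l with (Rabs (Im z)); trivial.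
  rewrite <- Rmult_assoc, Rinv_r; lra. }
lra.
Qed.

Lemma den_lower w : 0 < Re w -> exists K, 0 < K /\ forall v, 0 <= v -> (1 + v) ^ 2 <= K * Cmod (den w v).
Proof.
intros Hw.
assert (I1 : Im (Ci * w)%C = Re w) by (unfold Im, Re; simpl; ring).
assert (I2 : Im (- (Ci * w))%C = - Re w) by (unfold Im, Re; simpl; ring).
exists (((1 + Cmod (Ci * w)%C) / Rabs (Re w) + 1) ^ 2).
assert (Hp : 0 < (1 + Cmod (Ci * w)%C) / Rabs (Re w) + 1).
{ assert (0 <= (1 + Cmod (Ci * w)%C) / Rabs (Re w)); [|lra].
  apply Rlt_le, Rdiv_lt_0_compat; [generalize (Cmod_ge_0 (Ci * w)%C); lra|apply Rabs_pos_lt; lra]. }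
split; [apply pow_lt; trivial|]; intros v Hv.
assert (H1 := Cmod_linear_lower (Ci * w) v ltac:(rewrite I1; lra) Hv); rewrite I1 in H1.
assert (H2 := Cmod_linear_lower (- (Ci * w)) v ltac:(rewrite I2; lra) Hv).
rewrite I2, Rabs_Ropp, Cmod_opp in H2.
replace (den w v) with ((RtoC v + Ci * w) * (RtoC v + - (Ci * w)))%C.
- rewrite (Cmod_mult (RtoC v + Ci * w)); set (k := _ / _ + 1) in *.
  replace (k ^ 2 * _) with ((k * Cmod (RtoC v + Ci * w)%C) * (k * Cmod (RtoC v + - (Ci * w))%C)) by ring.
  replace ((1 + v) ^ 2) with ((1 + v) * (1 + v)) by ring; apply Rmult_le_compat; lra.
- unfold den; replace ((RtoC v + Ci * w) * (RtoC v + - (Ci * w)))%C with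
    (RtoC v * RtoC v - (Ci * Ci) * (w * w))%C by ring; rewrite Ci_sqr; ring.
Qed.

Lemma den_neq0 w v : 0 < Re w -> 0 <= v -> den w v <> RtoC 0.
Proof.
intros Hw Hv E; destruct (den_lower w Hw) as [K [HK H]]; specialize (H v Hv).
rewrite E, Cmod_0, Rmult_0_r in H; assert (0 < (1 + v) ^ 2) by (apply pow_lt; lra); lra.
Qed.

Lemma Cder_id s : Cder (fun s => RtoC s) s (RtoC 1).
Proof. apply (Cder_RtoC (fun s => s) s 1), (is_derive_id (K := R_AbsRing)). Qed.

Lemma Cder_den w v : Cder (den w) v (RtoC 2 * RtoC v)%C.
Proof.
eapply Cder_eq; [apply Cder_plus; [apply Cder_mult; apply Cder_id|apply Cder_const]|].
replace (RtoC 2) with (1 + 1)%C by (rewrite <- RtoC_plus; f_equal; ring); ring.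
Qed.

Definition psi0 (w : C) (v : R) : C := (lnC v * / den w v)%C.

Lemma Ccont_psi0 w v : 0 < Re w -> 0 < v -> Ccont (psi0 w) v.
Proof.
intros Hw Hv; apply Ccont_mult; [now apply Ccont_RtoC, continuous_ln|].
eapply Cder_Ccont, Cder_inv; [apply den_neq0; lra|apply Cder_den].
Qed.

Lemma Cmod_psi0 w : 0 < Re w -> exists K, 0 < K /\
  forall v, 0 < v -> Cmod (psi0 w v) * (1 + v) ^ 2 <= K * Rabs (ln v).
Proof.
intros Hw; destruct (den_lower w Hw) as [K [HK H]]; exists K; split; trivial; intros v Hv.
assert (Hd := den_neq0 w v Hw (Rlt_le _ _ Hv)); specialize (H v (Rlt_le _ _ Hv)).
unfold psi0, lnC; rewrite Cmod_mult, Cmod_inv, Cmod_R by trivial.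
apply Cmod_gt_0 in Hd.
rewrite Rmult_assoc, (Rmult_comm K); apply Rmult_le_compat_l; [apply Rabs_pos|].
apply Rmult_le_reg_l with (Cmod (den w v)); trivial.
rewrite <- Rmult_assoc, Rinv_r; lra.
Qed.

Lemma lapdom_psi0 w : 0 < Re w -> lapdom (psi0 w).
Proof.
intros Hw; split; [intros; now apply Ccont_psi0|].
destruct (Cmod_psi0 w Hw) as [K [HK H]].
destruct (lapdom_lnC 1 ltac:(lia)) as [_ [L [n HL]]].
exists (K * L), n; intros s Hs; specialize (H s Hs); specialize (HL s Hs).
unfold lnC in HL; rewrite Cmod_pow, Cmod_R, pow_1 in HL.
assert (Hp : Cmod (psi0 w s) <= K * Rabs (ln s)).
{ eapply Rle_trans; [|apply H]; rewrite <- (Rmult_1_r (Cmod _)) at 1.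
  apply Rmult_le_compat_l; [apply Cmod_ge_0|nra]. }
apply Rle_trans with (K * Rabs (ln s) * sqrt s); [apply Rmult_le_compat_r; [apply sqrt_pos|trivial]|].
rewrite !Rmult_assoc; apply Rmult_le_compat_l; lra.
Qed.

Definition lap_psi (w : C) (k : nat) (p : C) : C := lap (fun s => RtoC s ^ k * psi0 w s)%C p.

Lemma lapdom_pow_psi0 w k : 0 < Re w -> lapdom (fun s => RtoC s ^ k * psi0 w s)%C.
Proof.
intros Hw; assert (Hc : forall k s, Ccont (fun s => RtoC s ^ k)%C s).
{ clear k; intros k s; induction k as [|k IH]; [apply Ccont_const|].
  apply (Ccont_mult (fun s => RtoC s) (fun s => RtoC s ^ k)%C); trivial.
  eapply Cder_Ccont, Cder_id. }
induction k as [|k IH].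
- apply (lapdom_ext (psi0 w)).
  + intros; simpl; ring.
  + intros s Hs; apply Ccont_mult; [apply Ccont_const|now apply Ccont_psi0].
  + now apply lapdom_psi0.
- apply (lapdom_ext (fun s => RtoC s * (RtoC s ^ k * psi0 w s))%C).
  + intros; simpl; ring.
  + intros s Hs; apply Ccont_mult; [apply Hc|now apply Ccont_psi0].
  + now apply lapdom_mult_s.
Qed.

Lemma Cder_lap_psi w k p d t : 0 < Re w -> 0 < Re (p + RtoC t * d)%C ->
  Cder (fun t => lap_psi w k (p + RtoC t * d)%C) t (- d * lap_psi w (S k) (p + RtoC t * d))%C.
Proof.
intros Hw Hp; eapply Cder_eq; [apply Cder_lap; trivial; now apply lapdom_pow_psi0|].
f_equal; apply CInt_ext; intros s; simpl; ring.
Qed.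

Lemma lap_psi_2 w p : 0 < Re w -> 0 < Re p -> (lap_psi w 2 p = lapln 1 p - w * w * lap_psi w 0 p)%C.
Proof.
intros Hw Hp; apply isCI_unique.
apply (isCI_ext (fun s => Cexp (- (p * RtoC s)) * lnC s ^ 1 -
  w * w * (Cexp (- (p * RtoC s)) * (RtoC s ^ 0 * psi0 w s)))%C).
- intros s Hs; assert (Hd := den_neq0 w s Hw (Rlt_le _ _ Hs)); unfold psi0, den in *; simpl.
  field; trivial.
- apply isCI_minus; [apply isCI_lap; trivial; apply lapdom_lnC; lia|].
  apply isCI_scal, isCI_lap; trivial; now apply lapdom_pow_psi0.
Qed.

Lemma RtoC4_inv : (/ RtoC 4 = / RtoC 2 * / RtoC 2)%C.
Proof.
replace (RtoC 4) with (RtoC 2 * RtoC 2)%C by (rewrite <- RtoC_mult; f_equal; ring).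
field; apply RtoC2_neq0.
Qed.

Definition ray_up (e t : R) : C := (RtoC e + RtoC t * Ci)%C.
Definition ray_down (e t : R) : C := (RtoC e + RtoC t * - Ci)%C.

Lemma Re_ray_up e t : Re (ray_up e t) = e.
Proof. unfold Re; simpl; ring. Qed.
Lemma Re_ray_down e t : Re (ray_down e t) = e.
Proof. unfold Re; simpl; ring. Qed.

(* [abel_cos w e t] is [int_0^oo e^(-eu) u cos(tu) ln u / (u^2 + w^2) du], and [abel_sin] is the same with
   [sin(tu)] in place of [u cos(tu)]. *)
Definition abel_cos (w : C) (e t : R) : C := ((lap_psi w 1 (ray_up e t) + lap_psi w 1 (ray_down e t)) * / RtoC 2)%C.
Definition abel_sin (w : C) (e t : R) : C := (Ci * / RtoC 2 * (lap_psi w 0 (ray_up e t) - lap_psi w 0 (ray_down e t)))%C.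
Definition abel_log (e t : R) : C :=
  ((clog (ray_up e t) * clog (ray_up e t) + clog (ray_down e t) * clog (ray_down e t)) * / RtoC 4
   - lnint 1 expC * ((clog (ray_up e t) + clog (ray_down e t)) * / RtoC 2))%C.

Lemma Cder_abel_sin w e t : 0 < Re w -> 0 < e -> Cder (abel_sin w e) t (abel_cos w e t).
Proof.
intros Hw He; unfold abel_sin, abel_cos; eapply Cder_eq.
- apply Cder_scal, Cder_minus; apply Cder_lap_psi; trivial; [fold (ray_up e t); rewrite Re_ray_up|fold (ray_down e t); rewrite Re_ray_down]; trivial.
- fold (ray_up e t) (ray_down e t).
  replace (Ci * / RtoC 2 * (- Ci * lap_psi w 1 (ray_up e t) - - - Ci * lap_psi w 1 (ray_down e t)))%C with
    (- (Ci * Ci) * ((lap_psi w 1 (ray_up e t) + lap_psi w 1 (ray_down e t)) * / RtoC 2))%C by ring.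
  rewrite Ci_sqr; ring.
Qed.

Lemma Cder_abel_cos_sub_log w e t : 0 < Re w -> 0 < e ->
  Cder (fun t => abel_cos w e t - abel_log e t)%C t (w * w * abel_sin w e t)%C.
Proof.
intros Hw He; unfold abel_sin, abel_cos, abel_log.
assert (P1 : 0 < Re (RtoC e + RtoC t * Ci)%C) by (fold (ray_up e t); rewrite Re_ray_up; trivial).
assert (P2 : 0 < Re (RtoC e + RtoC t * - Ci)%C) by (fold (ray_down e t); rewrite Re_ray_down; trivial).
assert (L1 : Cder (fun t => clog (ray_up e t)) t (Ci / ray_up e t)%C) by (apply Cder_clog; [trivial|apply Cder_line]).
assert (L2 : Cder (fun t => clog (ray_down e t)) t (- Ci / ray_down e t)%C) by (apply Cder_clog; [trivial|apply Cder_line]).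
eapply Cder_eq.
- apply Cder_minus.
  + apply Cder_mult; [|apply Cder_const].
    apply Cder_plus; apply Cder_lap_psi; trivial.
  + apply Cder_minus.
    * apply Cder_mult; [|apply Cder_const].
      apply Cder_plus; apply Cder_mult; eassumption.
    * apply Cder_scal, Cder_mult; [|apply Cder_const]; apply Cder_plus; eassumption.
- fold (ray_up e t) (ray_down e t); cbv beta.
  assert (E1 := lapln_1_clog _ P1); assert (E2 := lapln_1_clog _ P2); fold (ray_up e t) (ray_down e t) in *.
  rewrite !lap_psi_2 by trivial.
  assert (N1 : ray_up e t <> RtoC 0) by (intros E; rewrite E in P1; simpl in P1; lra).
  assert (N2 : ray_down e t <> RtoC 0) by (intros E; rewrite E in P2; simpl in P2; lra).
  replace (lapln 1 (ray_up e t)) with ((ray_up e t * lapln 1 (ray_up e t)) / ray_up e t)%C by (field; trivial).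
  replace (lapln 1 (ray_down e t)) with ((ray_down e t * lapln 1 (ray_down e t)) / ray_down e t)%C by (field; trivial).
  rewrite E1, E2.
  assert (Hh2 : (/ RtoC 2 + / RtoC 2 = 1)%C) by (field; apply RtoC2_neq0).
  rewrite RtoC4_inv; unfold Cdiv; set (h := (/ RtoC 2)%C) in *.
  set (lp := clog (ray_up e t)); set (lm := clog (ray_down e t)).
  set (ip := (/ ray_up e t)%C); set (im := (/ ray_down e t)%C).
  transitivity (w * w * (Ci * h * (lap_psi w 0 (ray_up e t) - lap_psi w 0 (ray_down e t))) -
    (h + h - 1) * (h * Ci * (lp * ip - lm * im)))%C; [ring|rewrite Hh2; ring].
Qed.

Lemma abel_log_eq e t : 0 < e -> abel_log e t =
  (RtoC (((ln (e ^ 2 + t ^ 2) / 2) ^ 2 - atan (t / e) ^ 2) / 2)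
   - lnint 1 expC * RtoC (ln (e ^ 2 + t ^ 2) / 2))%C.
Proof.
intros He.
assert (E1 : clog (ray_up e t) = (ln (e ^ 2 + t ^ 2) / 2, atan (t / e))).
{ unfold clog; rewrite Re_ray_up; replace (Im (ray_up e t)) with t by (unfold Im; simpl; ring); trivial. }
assert (E2 : clog (ray_down e t) = (ln (e ^ 2 + t ^ 2) / 2, - atan (t / e))).
{ unfold clog; rewrite Re_ray_down; replace (Im (ray_down e t)) with (- t) by (unfold Im; simpl; ring).
  f_equal; [f_equal; f_equal; ring|].
  replace (- t / e) with (- (t / e)) by (field; lra); apply atan_opp. }
unfold abel_log; rewrite E1, E2, RtoC4_inv; set (x := ln _ / 2); set (th := atan _).
f_equal; [|f_equal; f_equal].
- rewrite <- RtoC_inv by lra; unfold RtoC, Cmult, Cplus; simpl; f_equal; field.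
- rewrite <- RtoC_inv by lra; unfold RtoC, Cmult, Cplus; simpl; f_equal; field.
Qed.

Lemma Ccont_abel_log e t : 0 < e -> Ccont (abel_log e) t.
Proof.
intros He.
assert (L1 : Ccont (fun t => clog (ray_up e t)) t).
{ eapply Cder_Ccont, Cder_clog; [rewrite Re_ray_up; trivial|apply Cder_line]. }
assert (L2 : Ccont (fun t => clog (ray_down e t)) t).
{ eapply Cder_Ccont, Cder_clog; [rewrite Re_ray_down; trivial|apply Cder_line]. }
apply Ccont_minus.
- apply Ccont_mult; [|apply Ccont_const]; apply Ccont_plus; now apply Ccont_mult.
- apply Ccont_mult; [apply Ccont_const|]; apply Ccont_mult; [now apply Ccont_plus|apply Ccont_const].
Qed.

Lemma abs_atan_le x : Rabs (atan x) <= 2.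
Proof. generalize (atan_bound x) PI_4; intros H1 H2; apply Rabs_le; lra. Qed.

Lemma abel_log_bound e : 0 < e -> exists B, forall t, 0 < t -> Cmod (abel_log e t) <= B * (1 + t) ^ 4.
Proof.
intros He; set (b := (e ^ 2 + 1 + / e ^ 2) / 2); set (g := Cmod (lnint 1 expC)).
assert (He2 : 0 < e ^ 2) by (apply pow_lt; lra); assert (Hi := Rinv_0_lt_compat _ He2).
exists (b ^ 2 + 4 + g * b); intros t Ht; rewrite abel_log_eq by trivial.
set (u := (1 + t) ^ 2); assert (Hu : 1 <= u) by (unfold u; nra).
assert (Hx : Rabs (ln (e ^ 2 + t ^ 2) / 2) <= b * u).
{ assert (Hy : 0 < e ^ 2 + t ^ 2) by nra.
  assert (H := abs_ln_le _ Hy).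
  assert (H1 : / (e ^ 2 + t ^ 2) <= / e ^ 2) by (apply Rinv_le_contravar; nra).
  unfold Rdiv; rewrite Rabs_mult, (Rabs_right (/ 2)) by lra.
  assert (t ^ 2 <= u) by (unfold u; nra).
  unfold b; nra. }
set (x := ln _ / 2) in *; assert (Hg : 0 <= g) by apply Cmod_ge_0.
assert (Ht2 := abs_atan_le (t / e)); set (th := atan (t / e)) in *.
assert (Hb : 0 < b) by (unfold b; lra).
eapply Rle_trans; [apply Cmod_triangle|]; rewrite Cmod_opp, Cmod_mult, !Cmod_R; fold g.
assert (H1 : Rabs ((x ^ 2 - th ^ 2) / 2) <= (b * u) ^ 2 + 4).
{ assert (A1 := pow2_abs x); assert (A2 := pow2_abs th).
  assert (A3 := Rabs_pos x); assert (A4 := Rabs_pos th).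
  assert (Rabs x ^ 2 <= (b * u) ^ 2) by (apply pow_incr; lra).
  assert (Rabs th ^ 2 <= 2 ^ 2) by (apply pow_incr; lra).
  apply Rabs_le; nra. }
replace ((1 + t) ^ 4) with (u ^ 2) by (unfold u; ring).
assert (g * Rabs x <= g * (b * u)) by (apply Rmult_le_compat_l; trivial).
assert (0 <= g * b) by nra.
assert (g * b * u <= g * b * u ^ 2) by (apply Rmult_le_compat_l; nra).
nra.
Qed.

Lemma lap_psi_bounded w k e : 0 < Re w -> 0 < e -> exists B, forall p, Re p = e -> Cmod (lap_psi w k p) <= B.
Proof.
intros Hw He; destruct (lapdom_exp _ e He (lapdom_pow_psi0 w k Hw)) as [L HL].
exists (L * PI); intros p Hp.
apply (isCI_bound _ _ L (isCI_lap _ p ltac:(lra) (lapdom_pow_psi0 w k Hw))).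
intros s Hs; rewrite Cmod_mult, Cmod_lapker, Hp, Rmult_comm; auto.
Qed.

(* Solves [w^2 N - N'' = w^2 delta_1] with [N'(0) = 0] and decay at infinity; the kink at [1] picks out the value of the
   paired solution there. *)
Definition nker (w : C) (s : R) : C := (w * Cexp (- (w * RtoC s)) * Ccosh w - sker w s)%C.

Lemma nker_le w s : s <= 1 -> nker w s = (w * Cexp (- w) * Ccosh (w * RtoC s))%C.
Proof.
intros Hs; unfold nker; rewrite sker_le by trivial; unfold Csinh, Ccosh.
replace (w * RtoC (1 - s))%C with (w + - (w * RtoC s))%C by (rewrite RtoC_minus; ring).
replace (- (w + - (w * RtoC s)))%C with (- w + w * RtoC s)%C by ring.
rewrite !Cexp_plus; field; apply RtoC2_neq0.
Qed.

Lemma nker_ge w s : 1 <= s -> nker w s = (w * Cexp (- (w * RtoC s)) * Ccosh w)%C.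
Proof. intros Hs; unfold nker; rewrite sker_ge by trivial; ring. Qed.

Lemma nker_pow2 w : 0 < Re w -> exists B, forall s, 0 < s -> Cmod (nker w s) * (1 + s) ^ 2 <= B.
Proof.
intros Hw; destruct (pow_exp_bound (Re w) 2 Hw) as [L HL].
exists (Cmod w * Cmod (Ccosh w) * L + 4 * (Cmod w * exp (Cmod w))); intros s Hs.
assert (H1 := HL s Hs); assert (H2 := Cmod_sker_pow2 w s Hs).
assert (H3 : Cmod (nker w s) <= Cmod w * Cmod (Ccosh w) * exp (- (Re w * s)) + Cmod (sker w s)).
{ eapply Rle_trans; [apply Cmod_triangle|]; rewrite Cmod_opp, !Cmod_mult, Cmod_lapker; lra. }
assert (P : 0 <= (1 + s) ^ 2) by apply pow2_ge_0.
apply (Rmult_le_compat_r _ _ _ P) in H3.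
assert (Q : 0 <= Cmod w * Cmod (Ccosh w)) by (apply Rmult_le_pos; apply Cmod_ge_0).
apply (Rmult_le_compat_l _ _ _ Q) in H1; nra.
Qed.

Lemma nker_mult_dom w : 0 < Re w -> exists B, forall phi A s, 0 < s ->
  Cmod (phi s) * sqrt s <= A * (1 + s) -> Cmod (nker w s * phi s) <= A * B * dominator s.
Proof.
intros Hw; destruct (nker_pow2 w Hw) as [B HB]; exists B; intros phi A s Hs H.
specialize (HB s Hs); assert (Hq : 0 < sqrt s) by (apply sqrt_lt_R0; lra).
assert (P1 := Cmod_ge_0 (nker w s)); assert (P2 := Cmod_ge_0 (phi s)).
assert (HA : 0 <= A) by nra.
unfold dominator; apply Rmult_le_reg_r with (sqrt s * (1 + s)); [nra|].
replace (A * B * / (sqrt s * (1 + s)) * (sqrt s * (1 + s))) with (A * B) by (field; lra).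
rewrite Cmod_mult.
replace (Cmod (nker w s) * Cmod (phi s) * (sqrt s * (1 + s))) with
  ((Cmod (nker w s) * (1 + s)) * (Cmod (phi s) * sqrt s)) by ring.
apply Rle_trans with ((Cmod (nker w s) * (1 + s)) * (A * (1 + s))).
- apply Rmult_le_compat_l; nra.
- replace (Cmod (nker w s) * (1 + s) * (A * (1 + s))) with (A * (Cmod (nker w s) * (1 + s) ^ 2)) by ring.
  now apply Rmult_le_compat_l.
Qed.

Lemma Cexp_inv_mult w : (Cexp (- w) * Cexp w)%C = RtoC 1.
Proof. rewrite <- Cexp_plus, <- Cexp_0; f_equal; ring. Qed.

Lemma isCI_nker_abel_log w e : 0 < Re w -> 0 < e ->
  isCI (fun s => nker w s * abel_log e s)%C (abel_log e 1 - abel_cos w e 1)%C.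
Proof.
intros Hw He.
set (Rf := fun s => (abel_cos w e s - abel_log e s)%C).
assert (HK := fun s => Cder_abel_sin w e s Hw He).
assert (HR := fun s => Cder_abel_cos_sub_log w e s Hw He); fold Rf in HR.
assert (HL : forall s, Cder (fun s => w * RtoC s)%C s w).
{ intros s; eapply Cder_eq; [apply Cder_scal, Cder_id|ring]. }
set (F1 := fun s => (Cexp (- w) * (w * (Ccosh (w * RtoC s) * abel_sin w e s) - Csinh (w * RtoC s) * Rf s))%C).
set (F2 := fun s => (Ccosh w * (Cexp (- (w * RtoC s)) * (w * abel_sin w e s + Rf s)))%C).
assert (D1 : forall s, Cder F1 s (w * Cexp (- w) * Ccosh (w * RtoC s) * abel_log e s)%C).
{ intros s; unfold F1; eapply Cder_eq.
  - apply Cder_scal, Cder_minus.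
    + apply Cder_scal, Cder_mult; [apply Cder_Ccosh, HL|apply HK].
    + apply Cder_mult; [apply Cder_Csinh, HL|apply HR].
  - unfold Rf; ring. }
assert (D2 : forall s, Cder F2 s (w * Cexp (- (w * RtoC s)) * Ccosh w * abel_log e s)%C).
{ intros s; unfold F2; eapply Cder_eq.
  - apply Cder_scal, Cder_mult; [apply Cder_lapker|apply Cder_plus; [apply Cder_scal, HK|apply HR]].
  - cbv beta; unfold Rf; ring. }
assert (HC1 : forall s, Ccont (fun s => Ccosh (w * RtoC s)) s).
{ intros s; exact (Cder_Ccont _ _ _ (Cder_Ccosh _ _ _ (HL s))). }
assert (H : isCI (fun s => nker w s * abel_log e s)%C (F1 1 - 0 + (0 - F2 1))%C).
{ apply (isCI_deriv2 _ (fun s => w * Cexp (- w) * Ccosh (w * RtoC s) * abel_log e s)%C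
    (fun s => w * Cexp (- (w * RtoC s)) * Ccosh w * abel_log e s)%C F1 F2); auto.
  - intros s _; apply Ccont_mult; [apply Ccont_mult; [apply Ccont_const|apply HC1]|now apply Ccont_abel_log].
  - intros s _; apply Ccont_mult; [|now apply Ccont_abel_log].
    apply Ccont_mult; [apply Ccont_mult; [apply Ccont_const|apply Ccont_lapker]|apply Ccont_const].
  - intros s Hs; rewrite nker_le by lra; ring.
  - intros s Hs; rewrite nker_ge by lra; ring.
  - apply filterlim_at_right_Ccont; [eapply Cder_Ccont, D1|].
    unfold F1; replace (w * RtoC 0)%C with (RtoC 0) by ring; rewrite Csinh_0.
    replace (abel_sin w e 0) with (RtoC 0); [ring|].
    unfold abel_sin; replace (ray_down e 0) with (ray_up e 0) by (unfold ray_up, ray_down; ring); ring.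
  - destruct (lap_psi_bounded w 0 e Hw He) as [B0 HB0]; destruct (lap_psi_bounded w 1 e Hw He) as [B1 HB1].
    destruct (abel_log_bound e He) as [B HB].
    destruct (pow_exp_bound (Re w / 2) 4 ltac:(lra)) as [L HL'].
    set (M := Cmod w * B0 + B1 + B).
    apply (filterlim_C0 _ _ (fun s => Cmod (Ccosh w) * M * L * exp (- (Re w / 2 * s)))).
    + exists 0; intros s Hs; unfold F2; rewrite !Cmod_mult, Cmod_lapker, !Rmult_assoc.
      apply Rmult_le_compat_l; [apply Cmod_ge_0|].
      replace (- (Re w * s)) with (- (Re w / 2 * s) + - (Re w / 2 * s)) by field; rewrite exp_plus.
      assert (Hh : Cmod (/ RtoC 2) = / 2).
      { rewrite Cmod_inv, Cmod_R, Rabs_right by (try apply RtoC2_neq0; lra); trivial. }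
      assert (Hci : Cmod Ci = 1).
      { unfold Cmod, Ci; simpl; replace (_ + _) with 1 by ring; apply sqrt_1. }
      assert (P := HB0 _ (Re_ray_up e s)); assert (P' := HB0 _ (Re_ray_down e s)).
      assert (Q := HB1 _ (Re_ray_up e s)); assert (Q' := HB1 _ (Re_ray_down e s)).
      assert (B0p : 0 <= B0) by (generalize (Cmod_ge_0 (lap_psi w 0 (ray_up e s))); lra).
      assert (B1p : 0 <= B1) by (generalize (Cmod_ge_0 (lap_psi w 1 (ray_up e s))); lra).
      assert (K1 : Cmod (abel_sin w e s) <= B0).
      { unfold abel_sin; rewrite !Cmod_mult, Hh, Hci.
        assert (T := Cmod_triangle (lap_psi w 0 (ray_up e s)) (- lap_psi w 0 (ray_down e s))); rewrite Cmod_opp in T.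
        unfold Cminus; lra. }
      assert (J1 : Cmod (abel_cos w e s) <= B1).
      { unfold abel_cos; rewrite !Cmod_mult, Hh.
        assert (T := Cmod_triangle (lap_psi w 1 (ray_up e s)) (lap_psi w 1 (ray_down e s))); lra. }
      specialize (HB s Hs); specialize (HL' s Hs).
      assert (Hp : 1 <= (1 + s) ^ 4) by (apply pow_R1_Rle; lra).
      assert (Z : Cmod (w * abel_sin w e s + Rf s) <= M * (1 + s) ^ 4).
      { eapply Rle_trans; [apply Cmod_triangle|]; unfold Rf.
        assert (T := Cmod_triangle (abel_cos w e s) (- abel_log e s)); rewrite Cmod_opp in T.
        rewrite Cmod_mult; unfold Cminus; assert (W := Cmod_ge_0 w); unfold M.
        assert (Cmod w * Cmod (abel_sin w e s) <= Cmod w * B0) by now apply Rmult_le_compat_l.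
        assert (0 <= Cmod w * B0) by now apply Rmult_le_pos.
        assert (Cmod w * B0 * 1 <= Cmod w * B0 * (1 + s) ^ 4) by now apply Rmult_le_compat_l.
        assert (B1 * 1 <= B1 * (1 + s) ^ 4) by now apply Rmult_le_compat_l.
        lra. }
      assert (Ex := exp_pos (- (Re w / 2 * s))).
      assert (M0 : 0 <= M).
      { assert (0 <= Cmod (w * abel_sin w e s + Rf s)) by apply Cmod_ge_0; nra. }
      set (x := exp (- (Re w / 2 * s))) in *.
      apply Rle_trans with (x * x * (M * (1 + s) ^ 4)); [apply Rmult_le_compat_l; nra|].
      replace (x * x * (M * (1 + s) ^ 4)) with (M * (((1 + s) ^ 4 * x) * x)) by ring.
      apply Rmult_le_compat_l; trivial; apply Rmult_le_compat_r; lra.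
    + apply filterlim_scal_0, filterlim_exp_m; lra. }
eapply isCI_eq; [exact H|]; unfold F1, F2.
rewrite !Cmult_1_r.
assert (E := Cexp_inv_mult w).
assert (E2 : (Csinh w + Ccosh w = Cexp w)%C) by (unfold Csinh, Ccosh; field; apply RtoC2_neq0).
transitivity (- (Cexp (- w) * (Csinh w + Ccosh w) * Rf 1))%C; [ring|rewrite E2, E; unfold Rf; ring].
Qed.

Definition abel_log0 (s : R) : C :=
  (RtoC ((ln s ^ 2 - (PI / 2) ^ 2) / 2) - lnint 1 expC * RtoC (ln s))%C.

Lemma fourth_root s : 0 < s -> exists r, 0 < r /\ s = r ^ 4 /\ sqrt s = r ^ 2 /\
  Rabs (ln s) * r <= 4 * (1 + r ^ 2).
Proof.
intros Hs; exists (sqrt (sqrt s)).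
assert (Hq : 0 < sqrt s) by now apply sqrt_lt_R0.
assert (E : sqrt (sqrt s) ^ 2 = sqrt s) by (apply pow2_sqrt; lra).
repeat split.
- now apply sqrt_lt_R0.
- replace (sqrt (sqrt s) ^ 4) with ((sqrt (sqrt s) ^ 2) ^ 2) by ring; rewrite E, pow2_sqrt; lra.
- now rewrite E.
- rewrite E; now apply abs_ln_root.
Qed.

Lemma atan_le_id x : 0 <= x -> 0 <= atan x <= x.
Proof.
intros [Hx|<-]; [|rewrite atan_0; lra].
assert (H1 := atan_increasing _ _ Hx); rewrite atan_0 in H1; split; [lra|].
destruct (MVT_gen atan 0 x (fun x => / (1 + x ^ 2))) as [c [Hc Ec]].
- intros y _; auto_derive; trivial; field; nra.
- intros y _; apply derivable_continuous_pt, derivable_pt_atan.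
- rewrite atan_0, !Rminus_0_r in Ec; rewrite Ec.
  assert (/ (1 + c ^ 2) <= 1); [|nra].
  rewrite <- Rinv_1; apply Rinv_le_contravar; nra.
Qed.

Lemma atan_compl y : 0 < y -> atan y = PI / 2 - atan (/ y).
Proof. intros Hy; rewrite atan_inv by trivial; lra. Qed.

(* The fourth root of the regularization parameter keeps the singularity at [0] integrable. *)
Lemma abel_log_near : exists A, forall eta s, 0 < eta <= 1 -> 0 < s ->
  Cmod (abel_log (eta ^ 4) s - abel_log0 s) * sqrt s <= eta * A * (1 + s).
Proof.
set (g := Cmod (lnint 1 expC)); exists (40 + 4 * g); intros eta s He Hs.
assert (Hg : 0 <= g) by apply Cmod_ge_0.
assert (He4 : 0 < eta ^ 4) by (apply pow_lt; lra).
rewrite abel_log_eq by trivial; unfold abel_log0.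
destruct (fourth_root s Hs) as [r [Hr [Es [Eq HL]]]].
set (y := eta / r); assert (Hy : 0 < y) by (apply Rdiv_lt_0_compat; lra).
assert (Ey : eta ^ 4 = y ^ 4 * s) by (unfold y; rewrite Es; field; lra).
set (x := ln ((eta ^ 4) ^ 2 + s ^ 2) / 2); set (th := atan (s / eta ^ 4)).
assert (Hx : 0 <= x - ln s <= 4 * y).
{ assert (Ex : x = ln s + ln (1 + y ^ 8) / 2).
  { unfold x; rewrite Ey; replace ((y ^ 4 * s) ^ 2 + s ^ 2) with (s * s * (1 + y ^ 8)) by ring.
    assert (0 < 1 + y ^ 8) by (assert (0 < y ^ 8) by (apply pow_lt; lra); lra).
    rewrite ln_mult, ln_mult by (trivial; nra); field. }
  assert (H8 : 0 <= y ^ 8) by (apply pow_le; lra).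
  assert (H1 : 0 <= ln (1 + y ^ 8)) by (rewrite <- ln_1; apply Rcomplements.ln_le; lra).
  assert (H2 : ln (1 + y ^ 8) <= 8 * y).
  { rewrite <- (ln_exp (8 * y)); apply Rcomplements.ln_le; [lra|].
    replace (8 * y) with (INR 8 * y) by (simpl; ring).
    apply Rle_trans with ((1 + y) ^ 8).
    - assert (Q2 : 1 + y ^ 2 <= (1 + y) ^ 2) by nra.
      assert (Q4 : 1 + y ^ 4 <= (1 + y) ^ 4).
      { replace ((1 + y) ^ 4) with (((1 + y) ^ 2) ^ 2) by ring.
        apply Rle_trans with ((1 + y ^ 2) ^ 2); [nra|apply pow_incr; nra]. }
      assert (0 < y ^ 4) by (apply pow_lt; lra).
      replace ((1 + y) ^ 8) with (((1 + y) ^ 4) ^ 2) by ring.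
      apply Rle_trans with ((1 + y ^ 4) ^ 2); [nra|apply pow_incr; nra].
    - assert (He1 := exp_ineq1_le y).
      replace (exp (INR 8 * y)) with (exp y ^ 8).
      + apply pow_incr; lra.
      + rewrite <- Rpower_pow by apply exp_pos; unfold Rpower; now rewrite ln_exp. }
  rewrite Ex; lra. }
assert (Ht : 0 <= PI / 2 - th <= 2 * y /\ 0 <= th <= 2).
{ assert (Hse : 0 < s / eta ^ 4) by now apply Rdiv_lt_0_compat.
  assert (Et : th = PI / 2 - atan (y ^ 4)).
  { unfold th; rewrite atan_compl by trivial; f_equal; f_equal; rewrite Ey; field.
    split; lra. }
  assert (H4 : 0 < y ^ 4) by (apply pow_lt; lra).
  assert (H1 := atan_le_id (y ^ 4) (Rlt_le _ _ H4)); assert (H2 := atan_bound (y ^ 4)).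
  assert (H3 := PI_4).
  assert (H5 := atan_le_id _ (Rlt_le _ _ Hse)); fold th in H5.
  destruct (Rle_dec y 1) as [H6|H6]; [|lra].
  assert (H7 : y ^ 3 <= 1 ^ 3) by (apply pow_incr; lra).
  assert (H8 : y ^ 4 <= y) by (replace (y ^ 4) with (y * y ^ 3) by ring; nra).
  lra. }
set (L := Rabs (ln s)) in *; assert (HL0 : 0 <= L) by apply Rabs_pos.
assert (HxA : Rabs (x - ln s) <= 4 * y) by (apply Rabs_le; lra).
assert (Hm : Cmod (RtoC ((x ^ 2 - th ^ 2) / 2) - lnint 1 expC * RtoC x -
   (RtoC ((ln s ^ 2 - (PI / 2) ^ 2) / 2) - lnint 1 expC * RtoC (ln s)))%C <=
   (8 * y ^ 2 + 4 * y * L + 4 * y) + g * (4 * y)).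
{ replace (RtoC ((x ^ 2 - th ^ 2) / 2) - lnint 1 expC * RtoC x -
   (RtoC ((ln s ^ 2 - (PI / 2) ^ 2) / 2) - lnint 1 expC * RtoC (ln s)))%C with
   (RtoC ((x - ln s) * (x - ln s + 2 * ln s) / 2 + (PI / 2 - th) * (PI / 2 + th) / 2)
      + - (lnint 1 expC * RtoC (x - ln s)))%C.
  - eapply Rle_trans; [apply Cmod_triangle|]; rewrite Cmod_opp, Cmod_mult, !Cmod_R; fold g.
    apply Rplus_le_compat; [|apply Rmult_le_compat_l; trivial].
    eapply Rle_trans; [apply Rabs_triang|].
    assert (A1 : Rabs ((x - ln s) * (x - ln s + 2 * ln s) / 2) <= 4 * y * (4 * y + 2 * L) / 2).
    { unfold Rdiv; rewrite !Rabs_mult, (Rabs_right (/ 2)) by lra.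
      apply Rmult_le_compat_r; [lra|]; apply Rmult_le_compat; trivial; try apply Rabs_pos.
      eapply Rle_trans; [apply Rabs_triang|]; rewrite (Rabs_mult 2), (Rabs_right 2) by lra; fold L; lra. }
    assert (A2 : Rabs ((PI / 2 - th) * (PI / 2 + th) / 2) <= 4 * y).
    { rewrite Rabs_right by (apply Rle_ge; apply Rmult_le_pos; [apply Rmult_le_pos|]; lra).
      assert (H3 := PI_4); assert ((PI / 2 - th) * (PI / 2 + th) <= 2 * y * 4); [|lra].
      apply Rmult_le_compat; lra. }
    nra.
  - replace ((x - ln s) * (x - ln s + 2 * ln s) / 2 + (PI / 2 - th) * (PI / 2 + th) / 2) with
     ((x ^ 2 - th ^ 2) / 2 - (ln s ^ 2 - (PI / 2) ^ 2) / 2) by field.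
    rewrite !RtoC_minus; ring. }
apply (Rmult_le_compat_r (sqrt s)) in Hm; [|apply sqrt_pos].
eapply Rle_trans; [apply Hm|]; rewrite Eq.
assert (Hyr : y * r = eta) by (unfold y; field; lra).
replace ((8 * y ^ 2 + 4 * y * L + 4 * y + g * (4 * y)) * r ^ 2) with
  (8 * (y * r) ^ 2 + 4 * (y * r) * (L * r) + (4 + 4 * g) * (y * r) * r) by ring.
rewrite Hyr.
assert (Hr4 : 2 * r ^ 2 <= 1 + s) by (rewrite Es; generalize (pow2_ge_0 (r ^ 2 - 1)); lra).
assert (Hr1 : r <= 1 + s) by (generalize (pow2_ge_0 (r - 1)); lra).
apply Rle_trans with (eta * (8 + 4 * (4 * (1 + r ^ 2)) + (4 + 4 * g) * (1 + s))).
- replace (8 * eta ^ 2 + 4 * eta * (L * r) + (4 + 4 * g) * eta * r) with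
    (eta * (8 * eta + 4 * (L * r) + (4 + 4 * g) * r)) by ring.
  apply Rmult_le_compat_l; [lra|].
  assert ((4 + 4 * g) * r <= (4 + 4 * g) * (1 + s)) by (apply Rmult_le_compat_l; lra); lra.
- rewrite Rmult_assoc; apply Rmult_le_compat_l; [lra|].
  replace ((40 + 4 * g) * (1 + s)) with (36 * (1 + s) + (4 + 4 * g) * (1 + s)) by ring.
  apply Rplus_le_compat_r.
  lra.
Qed.

Lemma expdom_pow phi j d : 0 < d -> expdom lnC phi 0 d ->
  exists d', 0 < d' /\ expdom lnC (fun s => lnC s ^ j * phi s)%C 0 d'.
Proof.
intros Hd H; induction j as [|j [d' [Hd' IH]]].
- exists d; split; trivial.
  replace (fun s => lnC s ^ 0 * phi s)%C with phi; trivial.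
  apply functional_extensionality; intros s; simpl; ring.
- exists (d' / 2); split; [lra|].
  replace (fun s => lnC s ^ S j * phi s)%C with (fun s => lnC s * (lnC s ^ j * phi s))%C.
  + apply (expdom_mult _ _ _ d'); trivial; lra.
  + apply functional_extensionality; intros s; simpl; ring.
Qed.

Lemma isCI_lnint_sker w j : isCI (fun s => lnC s ^ j * sker w s)%C (lnint j (sker w)).
Proof.
destruct (expdom_pow _ j (/ 2) ltac:(lra) (expdom_sker w)) as [d [Hd H]].
apply expdom_dominated in H; [|lra]; apply isCI_CInt.
replace (fun s => lnC s ^ j * sker w s)%C with
  (fun s => Cexp (RtoC 0 * lnC s) * (lnC s ^ j * sker w s))%C; trivial.
apply functional_extensionality; intros s; rewrite Cmult_0_l, Cexp_0; ring.
Qed.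

Definition nint (w : C) (j : nat) : C := (w * Ccosh w * lapln j w - lnint j (sker w))%C.

Lemma isCI_nint w j : 0 < Re w -> (j <= 2)%nat ->
  isCI (fun s => lnC s ^ j * nker w s)%C (nint w j).
Proof.
intros Hw Hj.
apply (isCI_ext (fun s => w * Ccosh w * (Cexp (- (w * RtoC s)) * lnC s ^ j) - lnC s ^ j * sker w s)%C).
- intros s Hs; unfold nker; ring.
- apply isCI_minus; [|apply isCI_lnint_sker].
  apply isCI_scal, isCI_lap; trivial; now apply lapdom_lnC.
Qed.

Lemma lnint_0_sker w : lnint 0 (sker w) = (Ccosh w - 1)%C.
Proof.
assert (HD : forall s, Cder (fun s => - Ccosh (w * RtoC (1 - s)))%C s (w * Csinh (w * RtoC (1 - s)))%C).
{ intros s; eapply Cder_eq; [apply Cder_opp, Cder_Ccosh, Cder_1m|cbv beta; ring]. }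
apply isCI_unique.
assert (H := isCI_deriv2 (fun s => lnC s ^ 0 * sker w s)%C (fun s => w * Csinh (w * RtoC (1 - s)))%C
  (fun _ => RtoC 0) (fun s => - Ccosh (w * RtoC (1 - s)))%C (fun _ => RtoC 0) (- Ccosh w)%C (RtoC 0)).
eapply isCI_eq; [apply H|]; clear H.
- intros; apply HD.
- intros; apply Cder_const.
- intros s _; apply Ccont_mult; [apply Ccont_const|apply Ccont_Csinh].
  eapply Cder_Ccont, Cder_1m.
- intros; apply Ccont_const.
- intros s Hs; rewrite sker_le by lra; simpl; ring.
- intros s Hs; rewrite sker_ge by lra; ring.
- apply filterlim_at_right_Ccont; [eapply Cder_Ccont, HD|].
  rewrite Rminus_0_r, Cmult_1_r; trivial.
- apply (filterlim_const (U := C_R_NormedModule)).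
- rewrite Rminus_diag, Cmult_0_r, Ccosh_0; ring.
Qed.

Lemma nint_0 w : 0 < Re w -> nint w 0 = RtoC 1.
Proof.
intros Hw; unfold nint; rewrite lnint_0_sker.
replace (w * Ccosh w * lapln 0 w)%C with (Ccosh w * (w * lapln 0 w))%C by ring.
rewrite lapln_0 by trivial; ring.
Qed.

Definition log_cos_value (w : C) : C := (lnint 1 expC * nint w 1 - / RtoC 2 * nint w 2)%C.

Lemma abel_cos_near_value w : 0 < Re w -> exists K, forall eta, 0 < eta <= 1 ->
  Cmod (abel_cos w (eta ^ 4) 1 - log_cos_value w) <= K * eta.
Proof.
intros Hw; destruct abel_log_near as [A HA]; destruct (nker_mult_dom w Hw) as [B HB].
set (c := RtoC ((PI / 2) ^ 2 / 2)).
assert (HI : isCI (fun s => nker w s * abel_log0 s)%C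
   (/ RtoC 2 * nint w 2 - lnint 1 expC * nint w 1 - c * nint w 0)%C).
{ apply (isCI_ext (fun s => / RtoC 2 * (lnC s ^ 2 * nker w s) - lnint 1 expC * (lnC s ^ 1 * nker w s)
    - c * (lnC s ^ 0 * nker w s))%C).
  - intros s Hs; unfold abel_log0, c, lnC.
    replace ((ln s ^ 2 - (PI / 2) ^ 2) / 2) with (/ 2 * (ln s * ln s) - (PI / 2) ^ 2 / 2) by field.
    rewrite RtoC_minus, !(RtoC_mult (/ 2)), RtoC_inv, (RtoC_mult (ln s)) by lra; simpl; ring.
  - apply isCI_minus; [apply isCI_minus|]; apply isCI_scal, isCI_nint; trivial; lia. }
exists (A * 2 + A * B * PI); intros eta He.
assert (He4 : 0 < eta ^ 4) by (apply pow_lt; lra).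
assert (HJ := isCI_minus _ _ _ _ (isCI_nker_abel_log w (eta ^ 4) Hw He4) HI).
assert (H1 := isCI_bound _ _ (eta * A * B) HJ).
assert (H2 : Cmod (abel_log (eta ^ 4) 1 - abel_log0 1) <= eta * A * 2).
{ generalize (HA eta 1 He Rlt_0_1); rewrite sqrt_1; lra. }
assert (EH : abel_log0 1 = (- c)%C).
{ unfold abel_log0, c; rewrite ln_1.
  replace ((0 ^ 2 - (PI / 2) ^ 2) / 2) with (- ((PI / 2) ^ 2 / 2)) by (simpl; field).
  rewrite RtoC_opp; ring. }
rewrite nint_0 in H1 by trivial.
replace (abel_cos w (eta ^ 4) 1 - log_cos_value w)%C with ((abel_log (eta ^ 4) 1 - abel_log0 1) +
  - (abel_log (eta ^ 4) 1 - abel_cos w (eta ^ 4) 1 - (/ RtoC 2 * nint w 2 - lnint 1 expC * nint w 1 - c * RtoC 1)))%C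
  by (rewrite EH; unfold log_cos_value; ring).
eapply Rle_trans; [apply Cmod_triangle|]; rewrite Cmod_opp.
eapply Rle_trans; [apply Rplus_le_compat; [apply H2|apply H1]|right; ring].
intros s Hs.
replace (nker w s * abel_log (eta ^ 4) s - nker w s * abel_log0 s)%C with
  (nker w s * (abel_log (eta ^ 4) s - abel_log0 s))%C by ring.
apply (HB (fun s => abel_log (eta ^ 4) s - abel_log0 s)%C (eta * A)); auto.
Qed.

(** * Removing the regularization *)

Definition psi (w : C) (u : R) : C := (RtoC u * psi0 w u)%C.
Definition dpsi (w : C) (u : R) : C :=
  (RtoC (ln u + 1) * / den w u - RtoC (2 * u ^ 2 * ln u) * (/ den w u * / den w u))%C.

Lemma Cder_psi w u : 0 < Re w -> 0 < u -> Cder (psi w) u (dpsi w u).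
Proof.
intros Hw Hu; assert (Hd := den_neq0 w u Hw (Rlt_le _ _ Hu)).
eapply Cder_eq.
- apply Cder_mult; [apply Cder_id|]; unfold psi0; apply Cder_mult; [now apply Cder_lnC|].
  apply Cder_inv; [exact Hd|apply Cder_den].
- cbv beta; unfold dpsi, psi0, lnC; rewrite RtoC_inv, RtoC_plus, !RtoC_mult, RtoC_pow by lra.
  field; split; trivial; apply RtoC_neq0; lra.
Qed.

Lemma Ccont_dpsi w u : 0 < Re w -> 0 < u -> Ccont (dpsi w) u.
Proof.
intros Hw Hu; assert (Hd := den_neq0 w u Hw (Rlt_le _ _ Hu)).
assert (H : Ccont (fun u => / den w u)%C u).
{ exact (Cder_Ccont _ _ _ (Cder_inv _ _ _ Hd (Cder_den w u))). }
apply Ccont_minus; (apply Ccont_mult; [apply Ccont_RtoC|]); trivial; [| |now apply Ccont_mult].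
- apply (ex_derive_continuous (fun u => ln u + 1)); auto_derive; trivial.
- apply (ex_derive_continuous (fun u => 2 * u ^ 2 * ln u)); auto_derive; trivial.
Qed.

Lemma psi_bounds w : 0 < Re w -> exists K, 0 < K /\ forall u, 0 < u ->
  Cmod (psi w u) * (1 + u) ^ 2 <= K * (u * Rabs (ln u)) /\
  Cmod (dpsi w u) * (1 + u) ^ 2 <= K * (1 + Rabs (ln u)).
Proof.
intros Hw; destruct (den_lower w Hw) as [K [HK H]].
exists (K + 2 * K ^ 2); split; [nra|]; intros u Hu.
assert (Hd := den_neq0 w u Hw (Rlt_le _ _ Hu)); specialize (H u (Rlt_le _ _ Hu)).
assert (Hi : Cmod (/ den w u) * (1 + u) ^ 2 <= K).
{ rewrite Cmod_inv by trivial; apply Cmod_gt_0 in Hd.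
  apply Rmult_le_reg_l with (Cmod (den w u)); trivial.
  rewrite <- Rmult_assoc, Rinv_r; lra. }
assert (Hi0 := Cmod_ge_0 (/ den w u)); set (i := Cmod (/ den w u)) in *.
assert (Hl := Rabs_pos (ln u)); set (L := Rabs (ln u)) in *.
assert (Hq : 0 < (1 + u) ^ 2) by (apply pow_lt; lra); set (q := (1 + u) ^ 2) in *.
assert (Huq : u ^ 2 <= q) by (unfold q; nra).
split.
- unfold psi, psi0, lnC; rewrite !Cmod_mult, !Cmod_R, (Rabs_right u) by lra; fold i L.
  assert (HuL : 0 <= u * L) by nra.
  replace (u * (L * i) * q) with ((u * L) * (i * q)) by ring.
  rewrite (Rmult_comm (K + _)); apply Rmult_le_compat_l; nra.
- unfold dpsi; eapply Rle_trans.
  { apply Rmult_le_compat_r; [lra|]; apply Cmod_triangle. }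
  rewrite Cmod_opp, !Cmod_mult, !Cmod_R; fold i.
  assert (A1 : Rabs (ln u + 1) <= 1 + L).
  { eapply Rle_trans; [apply Rabs_triang|]; rewrite (Rabs_right 1) by lra; fold L; lra. }
  assert (A2 : Rabs (2 * u ^ 2 * ln u) = 2 * u ^ 2 * L).
  { rewrite Rabs_mult, Rabs_right; trivial; nra. }
  rewrite A2; rewrite Rmult_plus_distr_r.
  assert (B1 : Rabs (ln u + 1) * i * q <= K * (1 + L)).
  { rewrite Rmult_assoc, (Rmult_comm K); apply Rmult_le_compat; trivial; [apply Rabs_pos|nra]. }
  assert (B2 : 2 * u ^ 2 * L * (i * i) * q <= 2 * K ^ 2 * L).
  { replace (2 * u ^ 2 * L * (i * i) * q) with ((2 * L) * (u ^ 2 * (i * (i * q)))) by ring.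
    replace (2 * K ^ 2 * L) with ((2 * L) * K ^ 2) by ring.
    apply Rmult_le_compat_l; [lra|].
    apply Rle_trans with (q * (i * (i * q))).
    - apply Rmult_le_compat_r; trivial; apply Rmult_le_pos; nra.
    - replace (q * (i * (i * q))) with ((i * q) ^ 2) by ring; apply pow_incr; nra. }
  nra.
Qed.

(* [u = r^4] turns all bounds against [dominator u = 1 / (r^2 (1 + r^4))] into polynomial ones. *)
Lemma dpsi_dom w : 0 < Re w -> exists K, 0 < K /\ forall u, 0 < u ->
  Cmod (dpsi w u) <= K * dominator u /\
  forall eta, 0 < eta <= 1 ->
    Cmod (dpsi w u) * (1 - exp (- (eta ^ 4 * u))) <= K * eta * dominator u /\
    Cmod (psi w u) * (eta ^ 4 * exp (- (eta ^ 4 * u))) <= K * eta * dominator u.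
Proof.
intros Hw; destruct (psi_bounds w Hw) as [K [HK H]].
exists (9 * K); split; [lra|]; intros u Hu; destruct (H u Hu) as [H1 H2]; clear H.
destruct (fourth_root u Hu) as [r [Hr [Eu [Eq HL]]]].
assert (HL0 := Rabs_pos (ln u)); set (L := Rabs (ln u)) in *.
assert (Hu1 : 0 < 1 + u) by lra; assert (Hr2 : 0 < r ^ 2) by nra.
assert (C1 := Cmod_ge_0 (dpsi w u)); assert (C2 := Cmod_ge_0 (psi w u)).
assert (S1 := pow2_ge_0 (r - 1)); assert (S2 := pow2_ge_0 (r ^ 2 - 1)); assert (S3 := pow2_ge_0 (r ^ 2 - r)).
assert (Hd : forall X Z, X * (r ^ 2 * (1 + u)) <= Z -> X <= Z * dominator u).
{ intros X Z HX; unfold dominator; rewrite Eq; apply Rmult_le_reg_r with (r ^ 2 * (1 + u)); [nra|].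
  rewrite Rmult_assoc, Rinv_l by nra; lra. }
assert (Hdp : forall c B, 0 <= c -> c * (r ^ 2 * (1 + L)) <= B * (1 + u) ->
  Cmod (dpsi w u) * c <= (K * B) * dominator u).
{ intros c B Hc HB; apply Hd; apply Rmult_le_reg_r with (1 + u); trivial.
  replace (Cmod (dpsi w u) * c * (r ^ 2 * (1 + u)) * (1 + u)) with
    ((Cmod (dpsi w u) * (1 + u) ^ 2) * (c * r ^ 2)) by ring.
  apply Rle_trans with (K * (1 + L) * (c * r ^ 2)); [apply Rmult_le_compat_r; nra|].
  replace (K * (1 + L) * (c * r ^ 2)) with (K * (c * (r ^ 2 * (1 + L)))) by ring.
  rewrite Rmult_assoc; apply Rmult_le_compat_l; lra. }
assert (HrL : r ^ 2 * L <= 4 * (1 + r ^ 2) * r).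
{ replace (r ^ 2 * L) with ((L * r) * r) by ring; apply Rmult_le_compat_r; lra. }
assert (Hr3 : 2 * r ^ 3 <= r ^ 4 + r ^ 2) by nra.
split.
- rewrite <- (Rmult_1_r (Cmod _)), (Rmult_comm 9); apply Hdp; [lra|].
  rewrite Eu; lra.
- intros eta He; set (y := eta * r); assert (Hy : 0 < y) by (unfold y; nra).
  assert (Ey : eta ^ 4 * u = y ^ 4) by (unfold y; rewrite Eu; ring).
  assert (He1 := exp_ineq1_le (y ^ 4)).
  assert (He2 : exp (- y ^ 4) * exp (y ^ 4) = 1) by (rewrite <- exp_plus, <- exp_0; f_equal; ring).
  assert (He3 := exp_pos (- y ^ 4)).
  assert (T1 := pow2_ge_0 (y - 1)); assert (T2 := pow2_ge_0 (y ^ 2 - 1)); assert (T3 := pow2_ge_0 (y ^ 2 - y)).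
  rewrite Ey; split.
  + replace (9 * K * eta) with (K * (9 * eta)) by ring.
    assert (Hc0 : 0 <= 1 - exp (- y ^ 4)).
    { assert (exp (- y ^ 4) <= exp 0) by (apply exp_le; assert (0 < y ^ 4) by (apply pow_lt; lra); lra).
      rewrite exp_0 in *; lra. }
    assert (Hc : 1 - exp (- y ^ 4) <= y).
    { destruct (Rle_dec y 1) as [H6|H6]; [|lra].
      assert (H7 : y ^ 3 <= 1 ^ 3) by (apply pow_incr; lra).
      assert (H8 : y ^ 4 <= y) by (replace (y ^ 4) with (y * y ^ 3) by ring; nra).
      assert (H9 := exp_ineq1_le (- y ^ 4)); lra. }
    apply Hdp; trivial.
    apply Rle_trans with (y * (r ^ 2 * (1 + L))); [apply Rmult_le_compat_r; nra|].
    unfold y; replace (eta * r * (r ^ 2 * (1 + L))) with (eta * (r ^ 3 + (L * r) * r ^ 2)) by ring.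
    replace (9 * eta * (1 + u)) with (eta * (9 * (1 + u))) by ring; apply Rmult_le_compat_l; [lra|].
    assert ((L * r) * r ^ 2 <= 4 * (1 + r ^ 2) * r ^ 2) by (apply Rmult_le_compat_r; lra).
    rewrite Eu; lra.
  + apply Hd; apply Rmult_le_reg_r with (1 + u); trivial.
    set (x := exp (- y ^ 4)) in *.
    replace (Cmod (psi w u) * (eta ^ 4 * x) * (r ^ 2 * (1 + u)) * (1 + u)) with
      ((Cmod (psi w u) * (1 + u) ^ 2) * (eta ^ 4 * x * r ^ 2)) by ring.
    assert (He4 : 0 < eta ^ 4) by (apply pow_lt; lra).
    apply Rle_trans with (K * (u * L) * (eta ^ 4 * x * r ^ 2)).
    { apply Rmult_le_compat_r; trivial; apply Rmult_le_pos; nra. }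
    replace (K * (u * L) * (eta ^ 4 * x * r ^ 2)) with (K * u * ((eta ^ 4 * x) * (r ^ 2 * L))) by ring.
    replace (9 * K * eta * (1 + u)) with (K * (1 + u) * (9 * eta)) by ring.
    assert (Hm : eta ^ 4 * x * (r ^ 2 * L) <= 9 * eta).
    { apply Rle_trans with (eta ^ 4 * x * (4 * (1 + r ^ 2) * r)); [apply Rmult_le_compat_l; nra|].
      replace (eta ^ 4 * x * (4 * (1 + r ^ 2) * r)) with (4 * eta * (x * (eta ^ 2 * y + y ^ 3))) by (unfold y; ring).
      assert (eta ^ 2 <= 1 ^ 2) by (apply pow_incr; lra).
      assert (Hy3 : 2 * y ^ 3 <= y ^ 4 + y ^ 2) by nra.
      assert (eta ^ 2 * y <= 1 * y) by (apply Rmult_le_compat_r; lra).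
      assert (Hs : eta ^ 2 * y + y ^ 3 <= exp (y ^ 4)) by lra.
      assert (x * (eta ^ 2 * y + y ^ 3) <= x * exp (y ^ 4)) by (apply Rmult_le_compat_l; lra).
      nra. }
    apply Rmult_le_compat; [nra|repeat apply Rmult_le_pos; lra|nra|exact Hm].
Qed.

(* What integration by parts against [sin u] leaves of the damped integrand. *)
Definition abel_parts_ker (w : C) (e u : R) : C :=
  (RtoC (sin u) * (RtoC (e * exp (- (e * u))) * psi w u - RtoC (exp (- (e * u))) * dpsi w u))%C.

Lemma psi_small w : 0 < Re w -> exists K, forall u, 0 < u ->
  (u < 1 -> Cmod (psi w u) <= K * sqrt u) /\ Cmod (psi w u) <= K * / sqrt u.
Proof.
intros Hw; destruct (psi_bounds w Hw) as [K [HK H]].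
exists (8 * K); intros u Hu; destruct (H u Hu) as [H1 _]; clear H.
destruct (fourth_root u Hu) as [r [Hr [Eu [Eq HL]]]].
assert (HL0 := Rabs_pos (ln u)); set (L := Rabs (ln u)) in *.
assert (C2 := Cmod_ge_0 (psi w u)); rewrite Eq.
assert (S1 := pow2_ge_0 (r - 1)); assert (S2 := pow2_ge_0 (r ^ 2 - 1)); assert (S3 := pow2_ge_0 (r ^ 2 - r)).
assert (Hr2 : 0 < r ^ 2) by nra; assert (Hr3 : 0 < r ^ 3) by (apply pow_lt; lra).
split.
- intros Hu1; assert (Hr1 : r <= 1).
  { destruct (Rle_dec r 1) as [|Hn]; trivial.
    assert (1 ^ 4 <= r ^ 4) by (apply pow_incr; lra); lra. }
  assert (Hr4 : r ^ 3 <= r ^ 2) by nra.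
  apply Rle_trans with (K * (u * L)); [nra|].
  rewrite Eu; replace (K * (r ^ 4 * L)) with (K * (r ^ 3 * (L * r))) by ring.
  replace (8 * K * r ^ 2) with (K * (r ^ 2 * 8)) by ring.
  apply Rmult_le_compat_l; [lra|]; apply Rmult_le_compat; nra.
- apply Rmult_le_reg_r with (r ^ 2); trivial.
  rewrite Rmult_assoc, Rinv_l, Rmult_1_r by lra.
  assert (Hp : 0 < (1 + u) ^ 2) by (apply pow_lt; lra).
  apply Rmult_le_reg_r with ((1 + u) ^ 2); trivial.
  replace (Cmod (psi w u) * r ^ 2 * (1 + u) ^ 2) with (Cmod (psi w u) * (1 + u) ^ 2 * r ^ 2) by ring.
  apply Rle_trans with (K * (u * L) * r ^ 2); [apply Rmult_le_compat_r; lra|].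
  replace (K * (u * L) * r ^ 2) with (K * (u * ((L * r) * r))) by ring.
  replace (8 * K * (1 + u) ^ 2) with (K * ((1 + u) * (8 * (1 + u)))) by ring.
  assert (HLr : 0 <= L * r) by nra.
  apply Rmult_le_compat_l; [lra|]; apply Rmult_le_compat; [lra|nra|lra|].
  apply Rle_trans with (4 * (1 + r ^ 2) * r); [apply Rmult_le_compat_r; lra|].
  assert (2 * r ^ 3 <= r ^ 4 + r ^ 2) by nra.
  rewrite Eu; lra.
Qed.

Lemma filterlim_inv_sqrt : filterlim (fun u => / sqrt u) (Rbar_locally p_infty) (locally 0).
Proof.
intros P [d Hd]; exists (/ (d * d)); intros u Hu; apply Hd.
assert (Hd0 := cond_pos d); assert (Hi : 0 < / (d * d)) by (apply Rinv_0_lt_compat; nra).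
assert (Hq : 0 < sqrt u) by (apply sqrt_lt_R0; lra); assert (Hs := sqrt_sqrt u ltac:(lra)).
change (Rabs (/ sqrt u - 0) < d); rewrite Rminus_0_r, Rabs_right
  by (apply Rle_ge, Rlt_le, Rinv_0_lt_compat; trivial).
assert (H1 : / d < sqrt u).
{ apply Rsqr_incrst_0; unfold Rsqr; [|apply Rlt_le, Rinv_0_lt_compat|]; try lra.
  rewrite Hs, <- Rinv_mult; trivial. }
rewrite <- (Rinv_inv d); apply Rinv_lt_contravar; trivial.
apply Rmult_lt_0_compat; trivial; now apply Rinv_0_lt_compat.
Qed.

Lemma Cder_sin u : Cder (fun u => RtoC (sin u)) u (RtoC (cos u)).
Proof. apply Cder_RtoC, is_derive_sin. Qed.

Lemma Cder_expm e u : Cder (fun u => RtoC (exp (- (e * u)))) u (RtoC (- (e * exp (- (e * u))))).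
Proof. apply Cder_RtoC; auto_derive; trivial; ring. Qed.

Lemma isCI_by_parts w e : 0 < Re w -> 0 <= e ->
  isCI (fun u => RtoC (exp (- (e * u))) * (RtoC (cos u) * psi w u) - abel_parts_ker w e u)%C (RtoC 0).
Proof.
intros Hw He.
assert (Cexpm : forall u, Ccont (fun u => RtoC (exp (- (e * u)))) u).
{ intros u; exact (Cder_Ccont _ _ _ (Cder_expm e u)). }
assert (Cpsi : forall u, 0 < u -> Ccont (psi w) u).
{ intros u Hu; exact (Cder_Ccont _ _ _ (Cder_psi w u Hw Hu)). }
assert (Hle : forall u, 0 < u ->
  Cmod (RtoC (exp (- (e * u))) * (RtoC (sin u) * psi w u))%C <= Cmod (psi w u)).
{ intros u Hu; rewrite !Cmod_mult, !Cmod_R, <- Rmult_assoc.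
  rewrite <- (Rmult_1_l (Cmod _)) at 2; apply Rmult_le_compat_r; [apply Cmod_ge_0|].
  rewrite (Rabs_right (exp _)) by (apply Rle_ge, Rlt_le, exp_pos).
  assert (H1 : exp (- (e * u)) <= 1) by (rewrite <- exp_0; apply exp_le; nra).
  assert (H2 : Rabs (sin u) <= 1) by (apply Rabs_le, SIN_bound).
  assert (H3 := exp_pos (- (e * u))); assert (H4 := Rabs_pos (sin u)); nra. }
eapply isCI_eq; [apply (isCI_deriv _ (fun u => RtoC (exp (- (e * u))) * (RtoC (sin u) * psi w u))%C (RtoC 0) (RtoC 0))|ring].
- intros u Hu; eapply Cder_eq.
  + apply Cder_mult; [apply Cder_expm|apply Cder_mult; [apply Cder_sin|now apply Cder_psi]].
  + cbv beta; unfold abel_parts_ker; rewrite RtoC_opp; ring.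
- intros u Hu; apply Ccont_minus.
  + apply Ccont_mult; [trivial|apply Ccont_mult; [apply Ccont_RtoC, continuous_cos|auto]].
  + apply Ccont_mult; [apply Ccont_RtoC, continuous_sin|apply Ccont_minus].
    * apply Ccont_mult; [|auto]; apply Ccont_RtoC.
      apply (ex_derive_continuous (fun u => e * exp (- (e * u)))); auto_derive; trivial.
    * apply Ccont_mult; [trivial|now apply Ccont_dpsi].
- destruct (psi_small w Hw) as [K HK].
  apply (filterlim_C0 _ _ (fun u => K * sqrt u)); [|apply filterlim_scal_0, filterlim_sqrt_0].
  generalize (at_right_lt 1 Rlt_0_1); apply filter_imp; intros u Hu.
  eapply Rle_trans; [apply Hle; lra|apply HK; lra].
- destruct (psi_small w Hw) as [K HK].
  apply (filterlim_C0 _ _ (fun u => K * / sqrt u)); [|apply filterlim_scal_0, filterlim_inv_sqrt].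
  exists 0; intros u Hu; eapply Rle_trans; [apply Hle; lra|apply HK; lra].
Qed.

Lemma abel_parts_ker_0_dominated w : 0 < Re w -> dominated (abel_parts_ker w 0).
Proof.
intros Hw; destruct (dpsi_dom w Hw) as [K [HK H]].
assert (E : forall u, abel_parts_ker w 0 u = (RtoC (sin u) * - dpsi w u)%C).
{ intros u; unfold abel_parts_ker; rewrite !Rmult_0_l, Ropp_0, exp_0; ring. }
split.
- intros u Hu; apply (Ccont_ext (fun u => RtoC (sin u) * - dpsi w u)%C); [intros; now rewrite E|].
  apply Ccont_mult; [apply Ccont_RtoC, continuous_sin|now apply Ccont_opp, Ccont_dpsi].
- exists K; intros u Hu; rewrite E, Cmod_mult, Cmod_opp, Cmod_R.
  destruct (H u Hu) as [H1 _]; assert (H2 : Rabs (sin u) <= 1) by (apply Rabs_le, SIN_bound).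
  assert (H3 := Rabs_pos (sin u)); assert (H4 := Cmod_ge_0 (dpsi w u)); nra.
Qed.

Lemma isCI_cos_psi w : 0 < Re w -> isCI (fun u => RtoC (cos u) * psi w u)%C (CInt (abel_parts_ker w 0)).
Proof.
intros Hw; assert (H := isCI_plus _ _ _ _ (isCI_by_parts w 0 Hw (Rle_refl 0))
  (isCI_CInt _ (abel_parts_ker_0_dominated w Hw))).
eapply isCI_eq; [eapply isCI_ext; [|exact H]|ring].
intros u Hu; cbv beta; rewrite Rmult_0_l, Ropp_0, exp_0; ring.
Qed.

Lemma Cexp_Ci t : Cexp (RtoC t * Ci) = (RtoC (cos t) + Ci * RtoC (sin t))%C.
Proof.
unfold Cexp, Re, Im; simpl; replace (t * 0 - 0 * 1) with 0 by ring.
replace (t * 1 + 0 * 0) with t by ring; rewrite exp_0.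
unfold Cplus, Cmult; simpl; f_equal; ring.
Qed.

Lemma isCI_abel_cos w e : 0 < Re w -> 0 < e ->
  isCI (fun u => RtoC (exp (- (e * u))) * (RtoC (cos u) * psi w u))%C (abel_cos w e 1).
Proof.
intros Hw He.
assert (H1 := isCI_lap _ (ray_up e 1) ltac:(rewrite Re_ray_up; lra) (lapdom_pow_psi0 w 1 Hw)).
assert (H2 := isCI_lap _ (ray_down e 1) ltac:(rewrite Re_ray_down; lra) (lapdom_pow_psi0 w 1 Hw)).
assert (H := isCI_scal (/ RtoC 2)%C _ _ (isCI_plus _ _ _ _ H1 H2)).
eapply isCI_eq; [eapply isCI_ext; [|exact H]|unfold abel_cos, lap_psi; ring].
intros u Hu; cbv beta.
replace (- (ray_up e 1 * RtoC u))%C with (RtoC (- (e * u)) + RtoC (- u) * Ci)%C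
  by (unfold ray_up; rewrite !RtoC_opp, RtoC_mult; ring).
replace (- (ray_down e 1 * RtoC u))%C with (RtoC (- (e * u)) + RtoC u * Ci)%C
  by (unfold ray_down; rewrite !RtoC_opp, RtoC_mult; ring).
rewrite !Cexp_plus, !Cexp_Ci, Cexp_RtoC, cos_neg, sin_neg, RtoC_opp; unfold psi.
simpl (_ ^ 1)%C; field; apply RtoC2_neq0.
Qed.

Lemma abel_cos_near_CInt w : 0 < Re w -> exists K, forall eta, 0 < eta <= 1 ->
  Cmod (abel_cos w (eta ^ 4) 1 - CInt (abel_parts_ker w 0)) <= K * eta.
Proof.
intros Hw; destruct (dpsi_dom w Hw) as [K [HK H]].
exists (2 * K * PI); intros eta He.
assert (He4 : 0 < eta ^ 4) by (apply pow_lt; lra).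
assert (H1 := isCI_minus _ _ _ _ (isCI_minus _ _ _ _ (isCI_abel_cos w _ Hw He4)
  (isCI_by_parts w (eta ^ 4) Hw (Rlt_le _ _ He4))) (isCI_CInt _ (abel_parts_ker_0_dominated w Hw))).
replace (abel_cos w (eta ^ 4) 1 - CInt (abel_parts_ker w 0))%C with
  (abel_cos w (eta ^ 4) 1 - RtoC 0 - CInt (abel_parts_ker w 0))%C by ring.
replace (2 * K * PI * eta) with (2 * K * eta * PI) by ring.
apply (isCI_bound _ _ _ H1); intros u Hu; destruct (H u Hu) as [_ H2].
destruct (H2 eta He) as [H3 H4].
set (x := exp (- (eta ^ 4 * u))) in *.
replace (_ - _ - _)%C with (RtoC (sin u) * (RtoC (eta ^ 4 * x) * psi w u + RtoC (1 - x) * dpsi w u))%C.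
2:{ unfold abel_parts_ker; fold x; rewrite !Rmult_0_l, Ropp_0, exp_0, RtoC_minus; ring. }
assert (Hx : 0 < x) by apply exp_pos.
assert (Hx1 : x <= 1) by (unfold x; rewrite <- exp_0; apply exp_le; nra).
rewrite Cmod_mult, Cmod_R.
assert (S1 : Rabs (sin u) <= 1) by (apply Rabs_le, SIN_bound).
assert (T := Cmod_triangle (RtoC (eta ^ 4 * x) * psi w u) (RtoC (1 - x) * dpsi w u)).
rewrite !Cmod_mult, !Cmod_R, (Rabs_right (eta ^ 4 * x)), (Rabs_right (1 - x)) in T by nra.
set (m := Cmod (_ + _)%C) in *; assert (Hm : 0 <= m) by apply Cmod_ge_0.
apply Rle_trans with (1 * m); [apply Rmult_le_compat_r; trivial|]; nra.
Qed.

Lemma eq_of_linear_bound (a b : C) K : (forall eta, 0 < eta <= 1 -> Cmod (a - b) <= K * eta) -> a = b.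
Proof.
intros H.
assert (H0 : Cmod (a - b) <= 0).
{ apply Rnot_lt_le; intros Hp.
  assert (HK : 0 < K) by (generalize (H 1 ltac:(lra)); lra).
  assert (He : 0 < Rmin 1 (Cmod (a - b) / (2 * K))).
  { apply Rmin_glb_lt; [lra|apply Rdiv_lt_0_compat; lra]. }
  specialize (H (Rmin 1 (Cmod (a - b) / (2 * K))) (conj He (Rmin_l _ _))).
  assert (H1 := Rmin_r 1 (Cmod (a - b) / (2 * K))).
  apply (Rmult_le_compat_l K) in H1; [|lra].
  replace (K * (Cmod (a - b) / (2 * K))) with (Cmod (a - b) / 2) in H1 by (field; lra); lra. }
assert (E : (a - b)%C = RtoC 0) by (apply Cmod_eq_0; generalize (Cmod_ge_0 (a - b)); lra).
replace a with (a - b + b)%C by ring; rewrite E; ring.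
Qed.

Lemma CInt_abel_parts_ker w : 0 < Re w -> CInt (abel_parts_ker w 0) = log_cos_value w.
Proof.
intros Hw; destruct (abel_cos_near_CInt w Hw) as [K1 H1]; destruct (abel_cos_near_value w Hw) as [K2 H2].
apply (eq_of_linear_bound _ _ (K1 + K2)); intros eta He.
specialize (H1 eta He); specialize (H2 eta He); set (J := abel_cos w (eta ^ 4) 1) in *.
replace (CInt (abel_parts_ker w 0) - log_cos_value w)%C with (- (J - CInt (abel_parts_ker w 0)) + (J - log_cos_value w))%C by ring.
eapply Rle_trans; [apply Cmod_triangle|]; rewrite Cmod_opp; lra.
Qed.

Lemma integrand_psi w u : integrand w u = (RtoC (cos u) * psi w u)%C.
Proof.
unfold integrand, psi, psi0, den, lnC, Cdiv.
replace (RtoC u ^ 2 + w ^ 2)%C with (RtoC u * RtoC u + w * w)%C by (simpl; ring).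
rewrite !RtoC_mult; ring.
Qed.

Lemma continuous_mul_ln_0 : continuous (fun u => u * ln u) 0.
Proof.
unfold continuous; rewrite Rmult_0_l.
apply (filterlim_le_0 _ _ (fun u => 8 * sqrt (Rabs u))).
- exists (mkposreal 1 Rlt_0_1); intros u Hu; change (Rabs (u - 0) < 1) in Hu; rewrite Rminus_0_r in Hu.
  destruct (Rlt_dec 0 u) as [H|H].
  + apply Rabs_def2 in Hu; destruct (fourth_root u H) as [r [Hr [Eu [Eq HL]]]].
    rewrite Rabs_mult, (Rabs_right u), Eq by lra; set (L := Rabs (ln u)) in *.
    assert (Hr1 : r <= 1).
    { destruct (Rle_dec r 1) as [|Hn]; trivial.
      assert (1 ^ 4 <= r ^ 4) by (apply pow_incr; lra); lra. }
    assert (Hr2 : 0 < r ^ 2) by nra; assert (Hr3 : 0 < r ^ 3) by (apply pow_lt; lra).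
    assert (Hr4 : r ^ 3 <= r ^ 2) by nra; assert (HL0 : 0 <= L) by apply Rabs_pos.
    rewrite Eu; replace (r ^ 4 * L) with (r ^ 3 * (L * r)) by ring.
    rewrite (Rmult_comm 8); apply Rmult_le_compat; nra.
  + replace (ln u) with 0.
    * rewrite Rmult_0_r, Rabs_R0; generalize (sqrt_pos (Rabs u)); lra.
    * unfold ln; destruct (Rlt_dec 0 u); tauto.
- assert (H : continuous (fun u => 8 * sqrt (Rabs u)) 0).
  { apply (continuous_mult (K := R_AbsRing) (fun _ => 8)); [apply continuous_const|].
    apply (continuous_comp Rabs sqrt); [apply continuous_Rabs|apply continuous_sqrt]. }
  unfold continuous in H; rewrite Rabs_R0, sqrt_0, Rmult_0_r in H; exact H.
Qed.

Lemma Ccont_integrand w u : 0 < Re w -> 0 <= u -> Ccont (integrand w) u.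
Proof.
intros Hw Hu; assert (Hd := den_neq0 w u Hw Hu).
assert (H : Ccont (fun u => / den w u)%C u).
{ exact (Cder_Ccont _ _ _ (Cder_inv _ _ _ Hd (Cder_den w u))). }
apply (Ccont_ext (fun u => RtoC (cos u * (u * ln u)) * / den w u)%C).
{ intros t; rewrite integrand_psi; unfold psi, psi0, lnC; rewrite !RtoC_mult; ring. }
apply Ccont_mult; trivial; apply Ccont_RtoC.
apply (continuous_mult (K := R_AbsRing)); [apply continuous_cos|].
destruct Hu as [Hu|<-]; [|apply continuous_mul_ln_0].
apply (ex_derive_continuous (fun u => u * ln u)); auto_derive; trivial.
Qed.

Lemma is_RInt_gen_at_point_0 (f : R -> C) (l : C) :
  (forall u, 0 <= u -> Ccont f u) -> isCI f l ->
  is_RInt_gen (V := C_R_NormedModule) f (at_point 0) (Rbar_locally p_infty) l.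
Proof.
intros Hc Hf.
assert (Hi : forall b, 0 <= b -> ex_RInt (V := C_R_NormedModule) f 0 b).
{ intros b Hb; apply (ex_RInt_continuous (V := C_R_CompleteNormedModule)).
  intros z; rewrite Rmin_left by lra; intros [Hz _]; now apply Hc. }
intros P [d Hd].
assert (Hd2 : 0 < d / 2) by apply is_pos_div_2; set (d2 := mkposreal _ Hd2).
destruct (Hf _ (locally_ball (T := C_R_NormedModule) l d2)) as [Q1 Q2 HQ1 HQ2 HQ].
set (B := Cmod (f 0) + 1); assert (HB : 0 < B) by (unfold B; generalize (Cmod_ge_0 (f 0)); lra).
destruct (proj1 (Ccont_pair f 0) (Hc 0 (Rle_refl 0))) as [Hre Him].
assert (Hh : 0 < / 2) by lra.
destruct (Hre _ (locally_ball _ (mkposreal _ Hh))) as [d3 Hd3].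
destruct (Him _ (locally_ball _ (mkposreal _ Hh))) as [d4 Hd4].
assert (Hf0 : forall u, 0 <= u < Rmin d3 d4 -> Cmod (f u) <= B).
{ intros u Hu.
  assert (U1 := Rlt_le_trans _ _ _ (proj2 Hu) (Rmin_l _ _)).
  assert (U2 := Rlt_le_trans _ _ _ (proj2 Hu) (Rmin_r _ _)).
  assert (V1 : Rabs (Re (f u) - Re (f 0)) < / 2).
  { apply (Hd3 u); change (Rabs (u - 0) < d3); rewrite Rminus_0_r, Rabs_right; lra. }
  assert (V2 : Rabs (Im (f u) - Im (f 0)) < / 2).
  { apply (Hd4 u); change (Rabs (u - 0) < d4); rewrite Rminus_0_r, Rabs_right; lra. }
  replace (f u) with (f 0 + (f u - f 0))%C by ring.
  eapply Rle_trans; [apply Cmod_triangle|]; unfold B; apply Rplus_le_compat_l.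
  apply Rnot_lt_le; intros Hn.
  assert (Hn2 : 1 < Cmod (f u - f 0) ^ 2) by nra; rewrite Cmod2_alt in Hn2.
  change (Re (f u - f 0)) with (Re (f u) - Re (f 0)) in Hn2.
  change (Im (f u - f 0)) with (Im (f u) - Im (f 0)) in Hn2.
  apply Rabs_def2 in V1; apply Rabs_def2 in V2; nra. }
assert (Hm : 0 < Rmin (Rmin d3 d4) (d / 2 / B)).
{ repeat apply Rmin_glb_lt; try apply cond_pos; apply Rdiv_lt_0_compat; trivial. }
destruct (filter_ex _ (filter_and _ _ HQ1 (at_right_lt _ Hm))) as [a [Ha1 Ha2]].
assert (Ha3 := Rlt_le_trans _ _ _ (proj2 Ha2) (Rmin_l _ _)).
assert (Ha4 := Rlt_le_trans _ _ _ (proj2 Ha2) (Rmin_r _ _)).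
destruct (Hi a ltac:(lra)) as [X HX].
assert (HXn : norm (V := C_R_NormedModule) X < d2).
{ apply Rle_lt_trans with ((a - 0) * B).
  - apply (norm_RInt_le_const f 0 a X B); trivial; [lra|].
    intros x Hx; rewrite norm_Cmod; apply Hf0; lra.
  - rewrite Rminus_0_r; simpl; apply (Rmult_lt_compat_r B) in Ha4; trivial.
    replace (d / 2 / B * B) with (d / 2) in Ha4 by (field; lra); exact Ha4. }
exists (fun x => x = 0) Q2; [reflexivity|trivial|].
intros x b -> Hb; destruct (HQ a b Ha1 Hb) as [y [Hy1 Hy2]]; simpl in Hy1.
exists (plus X y); split.
- apply (is_RInt_Chasles (V := C_R_NormedModule) f 0 a b); trivial.
- apply Hd; replace (pos d) with (d2 + d2) by (simpl; field).
  apply (ball_triangle l y (plus X y)); [exact Hy2|].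
  apply (norm_compat1 (V := C_R_NormedModule)).
  assert (E : forall z1 z2 : C, (z1 + z2 - z2)%C = z1) by (intros; ring).
  change (norm (V := C_R_NormedModule) ((X : C) + y - y)%C < d2); rewrite (E X y); exact HXn.
Qed.

Lemma derive2_value_eq w : 0 < Re w ->
  ((1 + lnint 0 (sker w)) * (RtoC 2 * lnint 1 expC ^ 2 - lnint 2 expC)
     - RtoC 2 * lnint 1 expC * lnint 1 (sker w) + lnint 2 (sker w)
   = clog w ^ 2 * Ccosh w + RtoC 2 * log_cos_value w)%C.
Proof.
intros Hw; assert (E1 := lapln_1_clog w Hw); assert (E2 := lapln_2_clog w Hw).
unfold log_cos_value, nint; rewrite lnint_0_sker.
set (g1 := lnint 1 expC) in *; set (g2 := lnint 2 expC) in *.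
set (s1 := lnint 1 (sker w)); set (s2 := lnint 2 (sker w)); set (c := Ccosh w); set (l := clog w) in *.
replace (w * c * lapln 1 w)%C with (c * (w * lapln 1 w))%C by ring; rewrite E1.
replace (w * c * lapln 2 w)%C with (c * (w * lapln 2 w))%C by ring; rewrite E2.
field; apply RtoC2_neq0.
Qed.

Lemma Clog_clog w : 0 < Re w -> Clog w = clog w.
Proof.
intros Hw; set (x := Re w) in *; set (y := Im w).
assert (Hp : 0 < x ^ 2 + y ^ 2) by nra.
assert (Em : Cmod w = sqrt (x ^ 2 + y ^ 2)) by reflexivity.
assert (Hm : 0 < Cmod w) by (rewrite Em; now apply sqrt_lt_R0).
assert (Em2 : Cmod w ^ 2 = x ^ 2 + y ^ 2) by apply Cmod2_alt.
assert (Ea : acos (x / Cmod w) = atan (Rabs y / x)).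
{ rewrite acos_atan by now apply Rdiv_lt_0_compat.
  f_equal; replace (1 - (x / Cmod w)²) with ((Rabs y / Cmod w)²).
  - rewrite sqrt_Rsqr; [field; lra|].
    apply Rmult_le_pos; [apply Rabs_pos|apply Rlt_le, Rinv_0_lt_compat; trivial].
  - rewrite !Rsqr_div', <- Rsqr_abs, !Rsqr_pow2, Em2; field; lra. }
unfold Clog, clog, Carg; fold x y; f_equal.
- rewrite <- Em2; replace (Cmod w ^ 2) with (Cmod w * Cmod w) by ring.
  rewrite ln_mult by trivial; field.
- rewrite Ea; destruct (Rle_dec 0 y) as [H|H].
  + now rewrite Rabs_right by lra.
  + rewrite Rabs_left by lra; rewrite <- atan_opp; f_equal; field; lra.
Qed.

Theorem theorem4p3 (w : C) (hw : 0 < Re w) :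
  ex_RInt_gen (V := C_R_NormedModule)
    (integrand w) (at_point 0) (Rbar_locally p_infty) /\
  is_derive2 (V := C_R_NormedModule) (fun b : R => MittagLeffler2 b (w ^ 2)%C) 1
    (Clog w ^ 2 * Ccosh w
     + RtoC 2 * RInt_gen (V := C_R_CompleteNormedModule)
                  (integrand w) (at_point 0) (Rbar_locally p_infty))%C.
Proof.
assert (HI : is_RInt_gen (V := C_R_NormedModule) (integrand w) (at_point 0) (Rbar_locally p_infty) (log_cos_value w)).
{ apply is_RInt_gen_at_point_0; [intros u; now apply Ccont_integrand|].
  rewrite <- CInt_abel_parts_ker by trivial.
  apply (isCI_ext (fun u => RtoC (cos u) * psi w u)%C); [intros; now rewrite integrand_psi|].
  now apply isCI_cos_psi. }
split; [now exists (log_cos_value w)|].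
rewrite (is_RInt_gen_unique (V := C_R_CompleteNormedModule) _ _ HI).
rewrite Clog_clog, <- derive2_value_eq by trivial.
apply is_derive2_MittagLeffler2; intros E; rewrite E in hw; simpl in hw; lra.
Qed.
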